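(* Let $N$ be a positive integer, $\mathcal{A}\subset\mathbb{N}\cap[1,N]$, and for each prime $p$ let $\Omega_p\subset\mathbb{Z}/p\mathbb{Z}$ be a set of residue classes with $\omega(p)=|\Omega_p|$. Let $\kappa\geq 3$ be an integer and suppose there is a finite set of primes $\mathcal{P}_0$ such that (C1) $\omega(p)<\kappa$ for all $p\in\mathcal{P}_0$ and $\omega(p)=\kappa$ for all primes $p\notin\mathcal{P}_0$, and (C2) $\omega(p)<p$ for all primes $p$. Put $z=\sqrt{\tfrac23 N}$. Then: (i) if $\kappa=3$ and $N\geq 437400$, \[S(\mathcal{A},\Omega,z) < 48\prod_p\left(1-\frac{\omega(p)}{p}\right)\left(1-\frac{1}{p}\right)^{-3}\frac{N}{P(\log N)},\] with $P(t) = t^3 - 34.549t^2 + 379.423t -553.222$; (ii) for every integer $\kappa\geq 3$ and $N>\exp(r_\kappa)$, where $r_\kappa = 5.961\cdot 10^{14}\kappa^2\log\kappa$, \[S(\mathcal{A},\Omega,z) <2^{\kappa}\kappa!\prod_p\left(1-\frac{\omega(p)}{p}\right)\left(1-\frac{1}{p}\right)^{-\kappa}\frac{N}{\log^\kappa N}\left(1-\frac{r_\kappa}{\log N}\right)^{-1}.\]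
   Context: The sifting function is $S(\mathcal{A},\Omega,z) = \#\{a\in\mathcal{A}: a \bmod p\notin\Omega_p \text{ for all primes } p\leq z\}$. Products $\prod_p$ run over all primes. *)

(* Defs.v *)
From Stdlib Require Import Reals.
From Coquelicot Require Import Coquelicot.
From mathcomp Require Import all_boot.

Open Scope R_scope.

(* Omega p r : "r is in Omega_p" for residues 0 <= r < p.
   omega(p) = |Omega_p| *)
Definition omega (Om : nat -> nat -> bool) (p : nat) : nat :=
  count (Om p) (iota 0%N p).

Definition Rleb (x y : R) : bool := if Rle_dec x y then true else false.

(* the primes p with p <= z (all of them are < up z) *)
Definition primes_upto (z : R) : seq nat :=
  [seq p <- iota 0%N (Z.to_nat (up z)) | prime p && Rleb (INR p) z].

Definition sift (N : nat) (A : nat -> bool) (Om : nat -> nat -> bool) (z : R) : nat :=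
  count (fun a => A a && all (fun p => ~~ Om p (a %% p)) (primes_upto z))
        (iota 1%N N).

Definition euler_partial (Om : nat -> nat -> bool) (kappa : nat) (n : nat) : R :=
  foldr (fun p acc => (1 - INR (omega Om p) / INR p) * / (1 - / INR p) ^ kappa * acc)
        1 [seq p <- iota 0%N n | prime p].

Definition euler_prod (Om : nat -> nat -> bool) (kappa : nat) : R :=
  real (Lim_seq (euler_partial Om kappa)).

Definition Ppoly (t : R) : R :=
  t ^ 3 - 34549 / 1000 * t ^ 2 + 379423 / 1000 * t - 553222 / 1000.

Definition r_kappa (kappa : nat) : R :=
  5961 / 10 * 10 ^ 12 * INR kappa ^ 2 * ln (INR kappa).

(* Main.v *)
(* The number S of sifted elements is bounded through the sum over [1,N] of F^2, where
   F = sum_q b(q) g_q and g_q is the product over p | q of the functions equal to -1 on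
   Omega_p and to h(p) = omega(p)/(p - omega(p)) elsewhere.  On the sifted set g_q = h(q),
   so that this sum is at least S (sum_q b(q) h(q))^2.  On the other hand g_q has mean
   square h(q), and its factors have mean 0, so its Fourier expansion only involves
   the reduced fractions a/q.  Splitting the fractions into dyadic blocks of denominators
   and estimating each pair of blocks with its own smoothing length gives a large sieve
   in which the block of denominators q ~ 2^(-D) Q costs N + O((2/3)^D Q^2).  So Q may be
   of order sqrt N, and S <= N / sum_q b(q) h(q) with b(q) = N / (N + 20 (2/3)^D Q^2).

   For the lower bound of sum_(q <= x) h(q), write prod_p (1 - omega(p)/p) times that sum as
   the probability that prod_p p^(e_p) <= x for independent e_p in {0,1} with
   P(e_p = 1) = omega(p)/p.  Each e_p is dominated by the sum of kappa geometric variables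
   and of one variable in {0,1} of mean eps_p = O(1/p^2).  The geometric variables produce
   iterated harmonic sums, bounded below by (log x)^kappa / kappa!, and by convexity the
   remaining variables cost at most a shift of log x by E = sum_p eps_p log p. *)

Require Import Defs.
From HB Require Import structures.
From Stdlib Require Import Reals ZArith Lra Lia Psatz FunctionalExtensionality.
From Coquelicot Require Import Coquelicot.
From mathcomp Require Import all_boot.
Open Scope R_scope.

(** * Finite sums and exponentials *)

(** Both bounds tolerate a relative error of order [1/log N] only. A large sieve with the same cost
    for all [q], such as [N + 2 Q^2], does not reach this: [Q] of order [sqrt N] loses a constant
    factor, and removing that factor by a smaller [Q] shifts [log Q] by an amount that must grow
    with [N]. When the cost decays geometrically below the top block, only a bounded number of
    blocks is lost, which is a bounded shift of [log x]; the poor constant 20 enters nowhere else.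
    All losses are collected in [y = log N / 2 - 343/100 - E], and the outcome is
    [S y^k / k! <= C N] with [C] the Euler product. For [kappa = 3] this puts [(t - 9.33)^3] in
    place of [P(t)], which suffices only from [t = 20.3] on. Below that [P] is bounded, and the
    unweighted sieve with the fixed value [Q = 256] and a computed threefold harmonic sum is enough.
    For general [kappa] the size of [r_kappa] leaves room for the crude shift
    [E = 3 kappa log kappa]. *)

HB.instance Definition _ :=
  Monoid.isComLaw.Build R 0 Rplus (fun x y z => esym (Rplus_assoc x y z)) Rplus_comm Rplus_0_l.
HB.instance Definition _ :=
  Monoid.isComLaw.Build R 1 Rmult (fun x y z => esym (Rmult_assoc x y z)) Rmult_comm Rmult_1_l.
HB.instance Definition _ := Monoid.isMulLaw.Build R 0 Rmult Rmult_0_l Rmult_0_r.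
HB.instance Definition _ :=
  Monoid.isAddLaw.Build R Rmult Rplus Rmult_plus_distr_r Rmult_plus_distr_l.

Lemma CplusA : associative Cplus. Proof. by move=> x y z; rewrite Cplus_assoc. Qed.
Lemma CmultDl : left_distributive Cmult Cplus.
Proof. by move=> x y z; ring. Qed.
Lemma CmultDr : right_distributive Cmult Cplus.
Proof. by move=> x y z; ring. Qed.
HB.instance Definition _ := Monoid.isComLaw.Build C (RtoC 0) Cplus CplusA Cplus_comm Cplus_0_l.
HB.instance Definition _ := Monoid.isMulLaw.Build C (RtoC 0) Cmult Cmult_0_l Cmult_0_r.
HB.instance Definition _ := Monoid.isAddLaw.Build C Cmult Cplus CmultDl CmultDr.

Local Notation "\rsum_ ( i <- r | P ) F" := (\big[Rplus/R0]_(i <- r | P) F)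
  (at level 41, F at level 41, i, r at level 50).
Local Notation "\rsum_ ( i <- r ) F" := (\big[Rplus/R0]_(i <- r) F)
  (at level 41, F at level 41, i, r at level 50).
Local Notation "\rsum_ ( i < n ) F" := (\big[Rplus/R0]_(i < n) F)
  (at level 41, F at level 41, i, n at level 50).
Local Notation "\rsum_ ( m <= i < n ) F" := (\big[Rplus/R0]_(m <= i < n) F)
  (at level 41, F at level 41, i, m, n at level 50).
Local Notation "\csum_ ( i <- r ) F" := (\big[Cplus/RtoC 0]_(i <- r) F%C)
  (at level 41, F at level 41, i, r at level 50).
Local Notation "\csum_ ( i < n ) F" := (\big[Cplus/RtoC 0]_(i < n) F%C)
  (at level 41, F at level 41, i, n at level 50).
Local Notation "\rprod_ ( i <- r ) F" := (\big[Rmult/R1]_(i <- r) F)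
  (at level 41, F at level 41, i, r at level 50).

Lemma rsum_le {I} (r : seq I) (P : pred I) (F G : I -> R) :
  (forall i, P i -> F i <= G i) -> \rsum_(i <- r | P i) F i <= \rsum_(i <- r | P i) G i.
Proof. by move=> H; elim/big_ind2: _ => //; [lra | move=> *; lra]. Qed.

Lemma rsum_le_seq {I : eqType} (r : seq I) (F G : I -> R) :
  (forall i, i \in r -> F i <= G i) -> \rsum_(i <- r) F i <= \rsum_(i <- r) G i.
Proof. by move=> H; rewrite big_seq [X in _ <= X]big_seq; apply: rsum_le. Qed.

Lemma rsum_ge0 {I} (r : seq I) (P : pred I) (F : I -> R) :
  (forall i, P i -> 0 <= F i) -> 0 <= \rsum_(i <- r | P i) F i.
Proof. by move=> H; elim/big_ind: _ => //; [lra | move=> *; lra]. Qed.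

Lemma rsum_const {I} (r : seq I) (c : R) : \rsum_(i <- r) c = INR (size r) * c.
Proof.
elim: r => [|x r IH]; first by rewrite big_nil /=; lra.
by rewrite big_cons IH /size -/(size r) S_INR; lra.
Qed.

Lemma rsum_const_ord n (c : R) : \rsum_(i < n) c = INR n * c.
Proof. by rewrite rsum_const /index_enum -enumT size_enum_ord. Qed.

Lemma rsum_sub {I : eqType} (s1 s2 : seq I) (F : I -> R) :
  uniq s1 -> uniq s2 -> {subset s1 <= s2} -> (forall i, i \in s2 -> 0 <= F i) ->
  \rsum_(i <- s1) F i <= \rsum_(i <- s2) F i.
Proof.
move=> u1 u2 sub F0.
have -> : \rsum_(i <- s1) F i = \rsum_(i <- s2 | i \in s1) F i.
  rewrite -[RHS]big_filter; apply: perm_big; apply: uniq_perm => //.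
    exact: filter_uniq.
  by move=> x; rewrite mem_filter; case: (boolP (x \in s1)) => // /sub ->.
rewrite [X in _ <= X](bigID (mem s1)) /=.
have := @rsum_ge0 _ s2 (fun i => (i \in s2) && (i \notin s1)) F
  (fun i H => F0 i (proj1 (andP H))).
by rewrite -big_seq_cond; lra.
Qed.

Lemma csum_Cmod {I} (r : seq I) (F : I -> C) :
  Cmod (\csum_(i <- r) F i) <= \rsum_(i <- r) Cmod (F i).
Proof.
elim: r => [|x r IH]; first by rewrite !big_nil Cmod_0; lra.
by rewrite !big_cons; have := Cmod_triangle (F x) (\csum_(i <- r) F i); lra.
Qed.

Lemma csum_conj {I} (r : seq I) (F : I -> C) :
  Cconj (\csum_(i <- r) F i) = \csum_(i <- r) Cconj (F i).
Proof.
elim: r => [|x r IH]; last by rewrite !big_cons Cplus_conj IH.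
by rewrite !big_nil /Cconj /RtoC /= Ropp_0.
Qed.

Lemma csum_RtoC {I} (r : seq I) (F : I -> R) :
  RtoC (\rsum_(i <- r) F i) = \csum_(i <- r) RtoC (F i).
Proof.
elim: r => [|x r IH]; first by rewrite !big_nil.
by rewrite !big_cons RtoC_plus IH.
Qed.

(** * The exponentials e^(2 pi i x) and their geometric sums *)

Definition cis (x : R) : C := (cos (2 * PI * x), sin (2 * PI * x)).

Lemma cisD x y : cis (x + y) = (cis x * cis y)%C.
Proof.
rewrite /cis /Cmult /= !Rmult_plus_distr_l cos_plus sin_plus.
by congr (_, _); ring.
Qed.

Lemma cis0 : cis 0 = RtoC 1.
Proof. by rewrite /cis Rmult_0_r cos_0 sin_0. Qed.

Lemma Cmod_cis x : Cmod (cis x) = 1.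
Proof.
rewrite /Cmod /cis /= !Rmult_1_r.
by have := sin2_cos2 (2 * PI * x); rewrite /Rsqr Rplus_comm => ->; rewrite sqrt_1.
Qed.

Lemma cis_conj x : Cconj (cis x) = cis (- x).
Proof.
by rewrite /cis /Cconj /= Ropp_mult_distr_r_reverse cos_neg sin_neg.
Qed.

Lemma cis_nat n : cis (INR n) = RtoC 1.
Proof.
rewrite /cis.
have := cos_period 0 n; have := sin_period 0 n.
rewrite cos_0 sin_0 => h1 h2.
have -> : 2 * PI * INR n = 0 + 2 * INR n * PI by ring.
by rewrite h1 h2.
Qed.

Lemma cis_sub1 b : Cmod (cis b - 1)%C = 2 * Rabs (sin (PI * b)).
Proof.
rewrite /Cmod /cis /=.
have -> : 2 * PI * b = 2 * (PI * b) by ring.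
rewrite cos_2a_sin sin_2a.
set s := sin _; set c := cos _.
have h : s * s + c * c = 1 by have := sin2_cos2 (PI * b); rewrite /Rsqr.
have -> : (1 - 2 * s * s + - (1)) * ((1 - 2 * s * s + - (1)) * 1) +
   (2 * s * c + - 0) * ((2 * s * c + - 0) * 1) = Rsqr (2 * s).
  have -> : Rsqr (2 * s) = 4 * (s * s) * (s * s + c * c) by rewrite h /Rsqr; ring.
  ring.
by rewrite sqrt_Rsqr_abs Rabs_mult (Rabs_pos_eq 2) //; lra.
Qed.

Lemma cis_geom M b :
  ((cis b - 1) * \csum_(v < M) cis (INR v * b))%C = (cis (INR M * b) - 1)%C.
Proof.
elim: M => [|M IH]; first by rewrite big_ord0 /= Rmult_0_l cis0; ring.
rewrite big_ord_recr /= CmultDr IH.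
have -> : (if M is 0 then 1 else INR M + 1) * b = INR M * b + b.
  by rewrite -/(INR M.+1) S_INR; ring.
by rewrite cisD; ring.
Qed.

(** A product rather than a quotient, so that integer [b] is no exception. *)
Lemma cis_geom_bound M b :
  Cmod (\csum_(v < M) cis (INR v * b)) * Rabs (sin (PI * b)) <= 1.
Proof.
have h := f_equal Cmod (cis_geom M b).
rewrite Cmod_mult cis_sub1 in h.
have : Cmod (cis (INR M * b) - 1)%C <= 2.
  apply: Rle_trans (Cmod_triangle _ _) _.
  by rewrite Cmod_opp Cmod_1 Cmod_cis; lra.
by rewrite -h; lra.
Qed.

Lemma cis_geom_orth q k : (0 < q)%N ->
  \csum_(a < q) cis (INR a * (INR k / INR q)) = if (q %| k)%N then RtoC (INR q) else RtoC 0.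
Proof.
move=> q0.
have q0' : INR q <> 0 by apply: not_0_INR => e; rewrite e in q0.
case: ifP => [/dvdnP [m ->]|nd].
  rewrite (eq_bigr (fun _ => RtoC 1)) => [|a _]; last first.
    rewrite mult_INR.
    have -> : INR a * (INR m * INR q / INR q) = INR (a * m).
      by rewrite mult_INR; field.
    exact: cis_nat.
  by rewrite -csum_RtoC rsum_const_ord Rmult_1_r.
have h := cis_geom q (INR k / INR q).
have e : INR q * (INR k / INR q) = INR k by field.
rewrite e cis_nat in h.
set S := \big[_/_]_(_ < _) _ in h *.
case: (Ceq_dec S 0) => // S0.
(* A nonzero sum forces the ratio of the geometric series to be 1, so [k / q] is an integer. *)
have h1 : Cmod (cis (INR k / INR q) - 1)%C = 0.
  have : Cmod ((cis (INR k / INR q) - 1) * S)%C = 0.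
    by rewrite h -Cmod_0; congr Cmod; ring.
  rewrite Cmod_mult => /Rmult_integral [] // /Cmod_eq_0 /S0 //.
rewrite cis_sub1 in h1.
have h2 : sin (PI * (INR k / INR q)) = 0.
  case: (Req_dec (sin (PI * (INR k / INR q))) 0) => // /Rabs_no_R0; lra.
case/sin_eq_0_0: h2 => z hz.
have hz' : INR k = IZR z * INR q.
  have p0 := PI_RGT_0.
  have : INR k / INR q = IZR z by apply: (Rmult_eq_reg_l PI); lra.
  move=> <-; field => //.
rewrite !INR_IZR_INZ -mult_IZR in hz'.
move/eq_IZR: hz' => hz'.
have : (q %| k)%N.
  apply/dvdnP; exists (Z.to_nat z).
  have : (0 <= z)%Z by move/ltP: q0 => q0; nia.
  move=> z0; rewrite -multE; nia.
by rewrite nd.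
Qed.

(** * Row sums over well-spaced points *)

Lemma PI_bounds : 3 <= PI <= 7 / 2.
Proof.
have h := PI2_3_2; split; first lra.
have [_ h2] := pi2_int.
suff -> : PI = 2 * PI2 by lra.
by [].
Qed.

(** The Taylor bound [sin x >= x - x^3/6] makes the claim polynomial in [t] and [PI]. The parabola
    shares the symmetry of the sine about 1/2, and its inverse square is easily compared with the
    two poles at 0 and 1. *)
Lemma sin_PI_ge_half t : 0 <= t <= 1 / 2 -> 3 * t * (1 - t) <= sin (PI * t).
Proof.
move=> [t0 t1]; have [p3 p4] := PI_bounds.
have x0 : 0 <= PI * t by nra.
have x1 : PI * t <= PI by nra.
have [h _] := sin_bound (PI * t) 0 x0 x1.
apply: Rle_trans h.
have -> : sin_approx (PI * t) ((2 * 0)%coq_nat + 1)%coq_nat = PI * t - (PI * t) ^ 3 / 6.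
  by rewrite /sin_approx /sin_term /=; field.
have e : 3 * t * (1 - t) <= t * (PI - PI * PI * PI * (t * t) / 6).
  rewrite (Rmult_comm 3) Rmult_assoc; apply: Rmult_le_compat_l => //.
  have tt : t * t <= t / 2 by nra.
  have q0 : 0 <= t * t by nra.
  (* The cube is convex on [3, 7/2], so it lies below its chord, of slope 127/4. *)
  have p30 : PI * PI * PI <= 27 + 127 / 4 * (PI - 3).
    have : 0 <= (PI - 3) * (7 / 2 - PI) * (PI + 13 / 2).
      by apply: Rmult_le_pos; [apply: Rmult_le_pos; lra | lra].
    by lra.
  have h1 : PI * PI * PI * (t * t) <= (27 + 127 / 4 * (PI - 3)) * (t * t).
    exact: Rmult_le_compat_r.
  case: (Rle_lt_dec (t * t) (18 / 100)) => ht; first by nra.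
  have h2 : (PI - 3) * (t * t) <= (PI - 3) / 4 by nra.
  have h3 : 42 / 100 <= t by nra.
  by nra.
by apply: Rle_trans e _; right; field.
Qed.

Lemma sin_PI_ge t : 0 <= t <= 1 -> 3 * t * (1 - t) <= sin (PI * t).
Proof.
move=> [t0 t1]; case: (Rle_lt_dec t (1 / 2)) => h; first by apply: sin_PI_ge_half.
have -> : sin (PI * t) = sin (PI * (1 - t)) by rewrite -sin_PI_x; congr sin; ring.
have := @sin_PI_ge_half (1 - t); lra.
Qed.

(** Since [t^2 + (1 - t)^2 >= 1/2], the parabola yields the constant 2/9, which is below 1/4. *)
Lemma inv_sin2_le t : 0 < t < 1 ->
  / Rsqr (sin (PI * t)) <= (/ Rsqr t + / Rsqr (1 - t)) / 4.
Proof.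
move=> [t0 t1].
have h := @sin_PI_ge t (conj (Rlt_le _ _ t0) (Rlt_le _ _ t1)).
have u0 : 0 < t * (1 - t) by nra.
have h1 : / Rsqr (sin (PI * t)) <= / Rsqr (3 * (t * (1 - t))).
  apply: Rinv_le_contravar; first by apply: Rlt_0_sqr; nra.
  by apply: Rsqr_incr_1; nra.
apply: Rle_trans h1 _.
have -> : (/ Rsqr t + / Rsqr (1 - t)) / 4 =
  / Rsqr (3 * (t * (1 - t))) * (9 * (Rsqr t + Rsqr (1 - t)) / 4).
  by rewrite /Rsqr; field; lra.
rewrite -[X in X <= _]Rmult_1_r; apply: Rmult_le_compat_l.
  by apply: Rlt_le; apply: Rinv_0_lt_compat; apply: Rlt_0_sqr; nra.
have := Rle_0_sqr (2 * t - 1); rewrite /Rsqr; lra.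
Qed.

(** Telescoping: [1/k^2 <= 2/k - 2/(k+1)] for all [k >= 1]. *)
Lemma sum_inv_sqr (m K : nat) : (0 < m)%N ->
  \rsum_(m <= k < K) / Rsqr (INR k) <= 2 / INR m.
Proof.
move=> m0; have m0' : 0 < INR m by apply: lt_0_INR; apply/ltP.
case: (leqP m K) => mK; last first.
  by rewrite big_geq ?(ltnW mK) //; apply: Rlt_le; apply: Rdiv_lt_0_compat; lra.
suff h : \rsum_(m <= k < K) / Rsqr (INR k) <= 2 / INR m - 2 / INR K.
  have : 0 < 2 / INR K.
    by apply: Rdiv_lt_0_compat; [lra | apply: lt_0_INR; apply/ltP; apply: leq_trans mK].
  lra.
elim: K mK => [|K IH]; first by rewrite leqn0 => /eqP e; rewrite e in m0.
rewrite leq_eqVlt => /orP [/eqP <-|]; first by rewrite big_geq //; lra.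
rewrite ltnS => mK; rewrite big_nat_recr //= -/(INR K.+1).
have {IH} := IH mK.
have K0 : 1 <= INR K by rewrite -/(INR 1); apply: le_INR; apply/leP; apply: leq_trans mK.
rewrite S_INR.
have : / Rsqr (INR K) <= 2 / INR K - 2 / (INR K + 1).
  have -> : 2 / INR K - 2 / (INR K + 1) = / Rsqr (INR K) * (2 * INR K / (INR K + 1)).
    by rewrite /Rsqr; field; lra.
  rewrite -[X in X <= _]Rmult_1_r; apply: Rmult_le_compat_l.
    by apply: Rlt_le; apply: Rinv_0_lt_compat; rewrite /Rsqr; nra.
  by apply: (Rmult_le_reg_r (INR K + 1)); [lra | field_simplify; lra].
lra.
Qed.

Definition nfloor (x : R) : nat := Z.to_nat (Int_part x).

Lemma nfloorP x : 0 <= x -> INR (nfloor x) <= x < INR (nfloor x) + 1.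
Proof.
move=> x0; have [h1 h2] := base_Int_part x.
have i0 : (0 <= Int_part x)%Z.
  suff : (-1 < Int_part x)%Z by lia.
  by apply: lt_IZR; lra.
by rewrite /nfloor INR_IZR_INZ Z2Nat.id //; lra.
Qed.

Lemma nfloor_ge m x : INR m <= x -> (m <= nfloor x)%N.
Proof.
move=> h; have x0 : 0 <= x by apply: Rle_trans h; apply: pos_INR.
have [_ h2] := nfloorP _ x0.
have : INR m < INR (nfloor x).+1 by rewrite S_INR; lra.
by move/INR_lt/ltP; rewrite ltnS.
Qed.

(** A half-open cell of length [d] holds at most one point, so the cell numbers [k i] are distinct
    integers from [m] on. *)
Lemma sep_sum_inv_sqr {I : eqType} (r : seq I) (t : I -> R) (d : R) (m : nat) :
  0 < d -> (0 < m)%N -> uniq r ->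
  (forall i, i \in r -> INR m * d <= t i <= 1) ->
  (forall i j, i \in r -> j \in r -> i != j -> d <= Rabs (t i - t j)) ->
  \rsum_(i <- r) / Rsqr (t i) <= 2 / INR m / Rsqr d.
Proof.
move=> d0 m0 u H1 H2.
pose k i := nfloor (t i / d).
have m0' : 0 < INR m by apply: lt_0_INR; apply/ltP.
have tk i : i \in r -> INR (k i) * d <= t i < (INR (k i) + 1) * d /\ (m <= k i)%N.
  move=> ir; have [h1 h2] := H1 i ir.
  have e : t i = t i / d * d by field; lra.
  have mt : INR m <= t i / d.
    by apply: (Rmult_le_reg_r d) => //; lra.
  have [h3 h4] := @nfloorP (t i / d) (Rle_trans _ _ _ (Rlt_le _ _ m0') mt).
  split; last exact: nfloor_ge.
  rewrite -/(k i) in h3 h4.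
  by rewrite e; split; [apply: Rmult_le_compat_r; lra | apply: Rmult_lt_compat_r].
have kinj : {in r &, injective k}.
  move=> i j ir jr e; apply/eqP; apply/negP => /negP ne.
  have := H2 i j ir jr ne.
  have [hi _] := tk i ir; have [hj _] := tk j jr.
  rewrite e in hi; rewrite /Rabs; case: Rcase_abs; lra.
have dd : 0 < Rsqr d by apply: Rlt_0_sqr; lra.
apply: (@Rle_trans _ (\rsum_(i <- r) / Rsqr (INR (k i)) * / Rsqr d)).
  apply: rsum_le_seq => i ir; have [[h1 _] h2] := tk i ir.
  have k0 : 0 < INR (k i) by apply: lt_0_INR; apply/ltP; apply: leq_trans h2.
  rewrite -Rinv_mult -Rsqr_mult; apply: Rinv_le_contravar.
    by apply: Rlt_0_sqr; nra.
  by apply: Rsqr_incr_1; nra.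
rewrite -big_distrl /=; apply: Rmult_le_compat_r.
  by apply: Rlt_le; apply: Rinv_0_lt_compat.
rewrite -(big_map k xpredT (fun k => / Rsqr (INR k))).
apply: Rle_trans (sum_inv_sqr m (\max_(i <- r) k i).+1 m0).
apply: rsum_sub => [||x /mapP [i ir ->]|x].
- by rewrite map_inj_in_uniq.
- exact: iota_uniq.
- by rewrite mem_index_iota (proj2 (tk i ir)) ltnS leq_bigmax_seq.
- rewrite mem_index_iota => /andP [h _]; apply: Rlt_le; apply: Rinv_0_lt_compat.
  by apply: Rlt_0_sqr; apply: not_0_INR => e; rewrite e leqn0 in h; rewrite (eqP h) in m0.
Qed.

(* For x and y in [0,1): their distance on the circle R/Z is at least d. *)
Definition circ_sep (d x y : R) := d <= Rabs (x - y) <= 1 - d.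

Lemma circ_sepC d x y : circ_sep d x y -> circ_sep d y x.
Proof. by rewrite /circ_sep Rabs_minus_sym. Qed.

(** Both ends of the circle cut open at [x0] contribute [2 / (m d^2)], weighted by 1/4. The
    clearance [m d] around [x0] may be wider than the spacing [d]; the gain [1/m] is what makes two
    blocks of very different sizes interact weakly. *)
Lemma row_sum {I : eqType} (r : seq I) (x : I -> R) (x0 d : R) (m : nat) :
  0 < d -> (0 < m)%N -> uniq r ->
  (forall i, i \in r -> circ_sep (INR m * d) x0 (x i)) ->
  (forall i j, i \in r -> j \in r -> i != j -> circ_sep d (x i) (x j)) ->
  \rsum_(i <- r) / Rsqr (sin (PI * (x0 - x i))) <= / INR m / Rsqr d.
Proof.
move=> d0 m0 u H1 H2.
have m1 : 1 <= INR m by rewrite -/(INR 1); apply: le_INR; apply/leP.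
(* The position of [x i] on the circle cut open at [x0]. *)
pose t i := if Rle_lt_dec x0 (x i) then x i - x0 else x i - x0 + 1.
have ht i : i \in r -> INR m * d <= t i <= 1 - INR m * d.
  move=> /H1; rewrite /circ_sep /t; case: Rle_lt_dec => h /=; rewrite /Rabs; case: Rcase_abs; lra.
have hs i : Rsqr (sin (PI * (x0 - x i))) = Rsqr (sin (PI * t i)).
  rewrite /t; case: Rle_lt_dec => h /=.
    by rewrite Rsqr_neg -sin_neg; congr (Rsqr (sin _)); ring.
  have -> : PI * (x i - x0 + 1) = - (PI * (x0 - x i)) + PI by ring.
  by rewrite neg_sin sin_neg Ropp_involutive //.
have hd i j : i \in r -> j \in r -> i != j -> d <= Rabs (t i - t j).
  move=> ir jr ne; have := H2 i j ir jr ne; rewrite /circ_sep /t.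
  case: Rle_lt_dec => h /=; case: Rle_lt_dec => h' /=; rewrite /Rabs; case: Rcase_abs; case: Rcase_abs; lra.
have md : 0 < INR m * d by nra.
apply: (@Rle_trans _ (\rsum_(i <- r) (/ Rsqr (t i) + / Rsqr (1 - t i)) * / 4)).
  apply: rsum_le_seq => i ir; rewrite hs; apply: inv_sin2_le.
  by have := ht i ir; lra.
rewrite -big_distrl /= big_split /=.
have A : \rsum_(i <- r) / Rsqr (t i) <= 2 / INR m / Rsqr d.
  by apply: sep_sum_inv_sqr => // i ir; have := ht i ir; lra.
have B : \rsum_(i <- r) / Rsqr (1 - t i) <= 2 / INR m / Rsqr d.
  apply: (@sep_sum_inv_sqr I r (fun i => 1 - t i)) => // [i ir|i j ir jr ne].
    by have := ht i ir; lra.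
  have := hd i j ir jr ne; rewrite Rabs_minus_sym.
  by have -> : 1 - t i - (1 - t j) = t j - t i by ring.
have -> : / INR m / Rsqr d = (2 / INR m / Rsqr d + 2 / INR m / Rsqr d) * / 4.
  by rewrite /Rsqr; field; lra.
by apply: Rmult_le_compat_r; lra.
Qed.

(** * The large sieve for one block and for two blocks *)

Lemma seg_split {T : Type} {idx : T} (op : Monoid.law idx) (f : R -> T) a (L1 L2 : nat) :
  \big[op/idx]_(j < L1 + L2) f (a + INR j) =
  op (\big[op/idx]_(j < L1) f (a + INR j)) (\big[op/idx]_(j < L2) f (a + INR L1 + INR j)).
Proof.
rewrite big_split_ord /=; congr (op _ _); apply: eq_bigr => j _.
by rewrite plus_INR Rplus_assoc.
Qed.

Lemma rseg_split (f : R -> R) a (L1 L2 : nat) :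
  \rsum_(j < L1 + L2) f (a + INR j) =
  (\rsum_(j < L1) f (a + INR j)) + \rsum_(j < L2) f (a + INR L1 + INR j).
Proof. exact: seg_split. Qed.

(** Schur's test: AM-GM on each term, then row and column sums. The weight [l] is left free because
    blocks of unequal size need an unequal split. *)
Lemma schur {I J : eqType} (rs : seq I) (ss : seq J) (a : I -> R) (b : J -> R)
    (k : I -> J -> R) (Row Col l : R) :
  0 < l -> (forall r s, 0 <= k r s) ->
  (forall r, r \in rs -> \rsum_(s <- ss) k r s <= Row) ->
  (forall s, s \in ss -> \rsum_(r <- rs) k r s <= Col) ->
  2 * (\rsum_(r <- rs) \rsum_(s <- ss) (a r * b s * k r s)) <=
  l * Row * (\rsum_(r <- rs) a r ^ 2) + / l * Col * (\rsum_(s <- ss) b s ^ 2).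
Proof.
move=> l0 k0 HR HC; have il := Rinv_0_lt_compat _ l0.
apply: (@Rle_trans _ (\rsum_(r <- rs) \rsum_(s <- ss)
   ((l * a r ^ 2) * k r s + (/ l * b s ^ 2) * k r s))).
  rewrite big_distrr /=; apply: rsum_le => r _; rewrite big_distrr /=; apply: rsum_le => s _.
  have : 0 <= k r s * (l * (a r - / l * b s) ^ 2).
    by apply: Rmult_le_pos => //; apply: Rmult_le_pos; [lra | apply: pow2_ge_0].
  have -> : k r s * (l * (a r - / l * b s) ^ 2) =
    l * a r ^ 2 * k r s + / l * b s ^ 2 * k r s - 2 * (a r * b s * k r s) by field; lra.
  lra.
under eq_bigr => r _ do rewrite big_split /= -big_distrr /=.
rewrite big_split /=; apply: Rplus_le_compat.
  rewrite big_distrr /=; apply: rsum_le_seq => r rr.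
  have -> : l * Row * a r ^ 2 = l * a r ^ 2 * Row by ring.
  apply: Rmult_le_compat_l; last exact: HR.
  by apply: Rmult_le_pos; [lra | exact: pow2_ge_0].
rewrite exchange_big /= big_distrr /=; apply: rsum_le_seq => s sr; rewrite -big_distrr /=.
have -> : / l * Col * b s ^ 2 = / l * b s ^ 2 * Col by ring.
apply: Rmult_le_compat_l; last exact: HC.
by apply: Rmult_le_pos; [lra | exact: pow2_ge_0].
Qed.

Definition trigp {I : Type} (c : I -> C) (x : I -> R) (rs : seq I) (t : R) : C :=
  \csum_(r <- rs) (c r * cis (t * x r)).

Definition cgeom (L : nat) (b : R) : R := Cmod (\csum_(v < L) cis (INR v * b)).

Lemma cgeom_ge0 L b : 0 <= cgeom L b. Proof. exact: Cmod_ge_0. Qed.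

(** One geometric sum is only [O(1/|sin|)], whose row sums cost a logarithm; the inverse square of
    the sine has convergent row sums. *)
Lemma cgeom_mul_le H L b : sin (PI * b) <> 0 ->
  cgeom H b * cgeom L b <= / Rsqr (sin (PI * b)).
Proof.
move=> s0; have s1 : 0 < Rabs (sin (PI * b)) by apply: Rabs_pos_lt.
have h1 := cis_geom_bound H b; have h2 := cis_geom_bound L b.
rewrite -/(cgeom _ _) in h1; rewrite -/(cgeom _ _) in h2.
apply: (Rmult_le_reg_r (Rsqr (sin (PI * b)))); first exact: Rsqr_pos_lt.
rewrite Rinv_l; last by move=> e; have := Rsqr_pos_lt _ s0; lra.
rewrite (Rsqr_abs (sin _)) /Rsqr.
have g1 := cgeom_ge0 H b; have g2 := cgeom_ge0 L b.
have -> : cgeom H b * cgeom L b * (Rabs (sin (PI * b)) * Rabs (sin (PI * b))) =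
  cgeom H b * Rabs (sin (PI * b)) * (cgeom L b * Rabs (sin (PI * b))) by ring.
by rewrite -(Rmult_1_l 1); apply: Rmult_le_compat => //; apply: Rmult_le_pos => //; lra.
Qed.

Lemma cgeom_0 L : cgeom L 0 = INR L.
Proof.
rewrite /cgeom (eq_bigr (fun _ => RtoC 1)) => [|v _]; last by rewrite Rmult_0_r cis0.
rewrite -csum_RtoC rsum_const_ord Rmult_1_r Cmod_R Rabs_pos_eq //; exact: pos_INR.
Qed.

Section Forms.
Context {I : eqType} (c : I -> C) (x : I -> R).
Implicit Types (rs ss : seq I).
Let F := trigp c x.

(** Two independent shifts [u] and [v] turn the coefficient of each frequency difference into a
    product of two geometric sums, as [cgeom_mul_le] requires. *)
Lemma window_bound rs ss (t0 : R) (H L : nat) :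
  Cmod (\csum_(u < H) \csum_(v < L) (F rs (t0 + INR u + INR v) * Cconj (F ss (t0 + INR u + INR v))))
  <= \rsum_(r <- rs) \rsum_(s <- ss)
       (Cmod (c r) * Cmod (c s) * (cgeom H (x r - x s) * cgeom L (x r - x s))).
Proof.
have -> : \csum_(u < H) \csum_(v < L) (F rs (t0 + INR u + INR v) * Cconj (F ss (t0 + INR u + INR v)))
  = \csum_(r <- rs) \csum_(s <- ss) (c r * Cconj (c s) * cis (t0 * (x r - x s)) *
    ((\csum_(u < H) cis (INR u * (x r - x s))) * (\csum_(v < L) cis (INR v * (x r - x s))))).
  transitivity (\csum_(u < H) \csum_(r <- rs) \csum_(v < L) \csum_(s <- ss)
     (c r * cis ((t0 + INR u + INR v) * x r) * Cconj (c s * cis ((t0 + INR u + INR v) * x s)))).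
    apply: eq_bigr => u _; rewrite [RHS]exchange_big; apply: eq_bigr => v _ /=.
    rewrite /F /trigp csum_conj big_distrl /=; apply: eq_bigr => r _.
    by rewrite big_distrr.
  rewrite exchange_big /=; apply: eq_bigr => r _.
  under eq_bigr => u _ do rewrite exchange_big /=.
  rewrite exchange_big /=; apply: eq_bigr => s _.
  rewrite big_distrl big_distrr /=; apply: eq_bigr => u _.
  rewrite !big_distrr /=; apply: eq_bigr => v _.
  rewrite Cmult_conj cis_conj.
  have -> : cis ((t0 + INR u + INR v) * x r) =
    (cis (t0 * x r) * cis (INR u * x r) * cis (INR v * x r))%C.
    by rewrite -!cisD; congr cis; ring.
  have -> : cis (- ((t0 + INR u + INR v) * x s)) =
    (cis (- (t0 * x s)) * cis (- (INR u * x s)) * cis (- (INR v * x s)))%C.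
    by rewrite -!cisD; congr cis; ring.
  have E t : cis (t * (x r - x s)) = (cis (t * x r) * cis (- (t * x s)))%C.
    by rewrite -cisD; congr cis; ring.
  by rewrite !E; ring.
apply: Rle_trans (csum_Cmod _ _) _; apply: rsum_le => r _.
apply: Rle_trans (csum_Cmod _ _) _; apply: rsum_le => s _.
rewrite !Cmod_mult Cmod_conj Cmod_cis /cgeom; right; ring.
Qed.

Definition sep_family d rs :=
  forall r s, r \in rs -> s \in rs -> r != s -> circ_sep d (x r) (x s).

Lemma circ_sep_sin d a b : 0 < d -> circ_sep d a b -> sin (PI * (a - b)) <> 0.
Proof.
move=> d0 [h1 h2] e; case/sin_eq_0_0: e => z hz.
have p0 := PI_RGT_0.
have {}hz : a - b = IZR z by apply: (Rmult_eq_reg_l PI); lra.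
rewrite hz -abs_IZR in h1 h2.
have g1 : (0 < Z.abs z)%Z by apply: lt_IZR; lra.
have g2 : (Z.abs z < 1)%Z by apply: lt_IZR; lra.
lia.
Qed.

Lemma circ_sep_weak d d' a b : d <= d' -> circ_sep d' a b -> circ_sep d a b.
Proof. by rewrite /circ_sep; lra. Qed.

Lemma Cmod_sqr (z : C) : RtoC (Cmod z ^ 2) = (z * Cconj z)%C.
Proof. exact: Cmod2_conj. Qed.

(* The window [0,M) is contained in each of the windows [u-H, u+M), u < H; averaging
   over u makes the exponential sums O(1/(H b^2)) off the diagonal.  Here H = X^2. *)
Lemma large_sieve_block rs (X M : nat) (t : R) :
  (0 < X)%N -> uniq rs -> sep_family (/ (INR X * INR X)) rs ->
  \rsum_(n < M) Cmod (F rs (t + INR n)) ^ 2 <=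
  (INR M + 2 * (INR X * INR X)) * \rsum_(r <- rs) Cmod (c r) ^ 2.
Proof.
move=> X0 u sep; set A := \rsum_(r <- rs) _.
set H := (X * X)%N.
have H0 : 1 <= INR H by rewrite -/(INR 1); apply: le_INR; apply/leP; rewrite muln_gt0 X0.
have eH : INR H = INR X * INR X by rewrite mult_INR.
rewrite -eH in sep *.
have d0 : 0 < / INR H by apply: Rinv_0_lt_compat; lra.
pose phi s := Cmod (F rs s) ^ 2.
have p0 s : 0 <= phi s by exact: pow2_ge_0.
suff h : INR H * (\rsum_(n < M) phi (t + INR n)) <= INR H * ((INR M + 2 * INR H) * A).
  by apply: Rmult_le_reg_l h; lra.
apply: (@Rle_trans _ (\rsum_(u < H) \rsum_(v < M + H) phi (t - INR H + INR u + INR v))).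
  rewrite -rsum_const_ord; apply: rsum_le => u' _.
  have uH := ltnW (ltn_ord u').
  have -> : (M + H = (H - u') + (M + u'))%N by rewrite [RHS]addnCA subnK.
  rewrite !seg_split /= minus_INR; last exact/leP.
  set S1 := \big[_/_]_(_ < H - u') _; set S2 := \big[_/_]_(_ < M) _.
  set S3 := \big[_/_]_(_ < M) _; set S4 := \big[_/_]_(_ < _) _.
  have -> : S3 = S2 by apply: eq_bigr => j _; congr phi; ring.
  have : 0 <= S1 by apply: rsum_ge0.
  have : 0 <= S4 by apply: rsum_ge0.
  lra.
apply: (@Rle_trans _ (Cmod (\csum_(u < H) \csum_(v < M + H)
   (F rs (t - INR H + INR u + INR v) * Cconj (F rs (t - INR H + INR u + INR v)))))).
  have -> : \csum_(u < H) \csum_(v < M + H)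
     (F rs (t - INR H + INR u + INR v) * Cconj (F rs (t - INR H + INR u + INR v))) =
     RtoC (\rsum_(u < H) \rsum_(v < M + H) phi (t - INR H + INR u + INR v)).
    rewrite csum_RtoC; apply: eq_bigr => u' _; rewrite csum_RtoC; apply: eq_bigr => v _.
    by rewrite -Cmod_sqr.
  by rewrite Cmod_R; exact: Rle_abs.
apply: Rle_trans (window_bound _ _ _ _ _) _.
set k := fun r s => cgeom H (x r - x s) * cgeom (M + H) (x r - x s).
have k0 r s : 0 <= k r s by apply: Rmult_le_pos; exact: cgeom_ge0.
(* The diagonal term is [H (M + H)]; the others sum to at most [H^2] by [row_sum] with spacing [1/H]
   and [m = 1]. *)
have row r : r \in rs -> \rsum_(s <- rs) k r s <= INR H * (INR M + 2 * INR H).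
  move=> rr; rewrite (bigD1_seq r) //= {1}/k Rminus_diag !cgeom_0 plus_INR.
  have : \rsum_(s <- rs | s != r) k r s <= / INR 1 / Rsqr (/ INR H).
    rewrite -big_filter.
    apply: Rle_trans (row_sum [seq s <- rs | s != r] x (x r) (/ INR H) 1 d0 isT _ _ _).
    - apply: rsum_le_seq => s; rewrite mem_filter => /andP [ne sr].
      apply: cgeom_mul_le; apply: (circ_sep_sin (/ INR H)) => //.
      by apply: sep => //; rewrite eq_sym.
    - exact: filter_uniq.
    - move=> s; rewrite mem_filter => /andP [ne sr]; rewrite Rmult_1_l.
      by apply: sep => //; rewrite eq_sym.
    - move=> i j; rewrite !mem_filter => /andP [_ ir] /andP [_ jr] ne; exact: sep.
  rewrite /Rsqr /=.
  have -> : / 1 / (/ INR H * / INR H) = INR H * INR H by field; lra.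
  set S := \big[_/_]_(_ <- _ | _) _; lra.
(* Negating the frequency conjugates the geometric sums, so columns are rows. *)
have col s : s \in rs -> \rsum_(r <- rs) k r s <= INR H * (INR M + 2 * INR H).
  move=> /row; congr (_ <= _); apply: eq_bigr => r _; rewrite /k /cgeom -Ropp_minus_distr.
  have E L b : Cmod (\csum_(v < L) cis (INR v * - b)) = Cmod (\csum_(v < L) cis (INR v * b)).
    rewrite -[RHS]Cmod_conj csum_conj; congr Cmod; apply: eq_bigr => v _.
    by rewrite cis_conj; congr cis; ring.
  by rewrite !E.
have := schur rs rs (fun r => Cmod (c r)) (fun r => Cmod (c r)) k _ _ 1 Rlt_0_1 k0 row col.
rewrite -/A; set S := \big[_/_]_(_ <- _) _; lra.
Qed.

Definition prodF rs ss (s : R) : C := (F rs s * Cconj (F ss s))%C.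

(* Average over the windows [u-H, u+M) with H = X Y, and treat the two edges of length H
   by large_sieve_block; l and mu are the weights of the two AM-GM inequalities. *)
Lemma large_sieve_cross rs ss (X Y m M : nat) (t l mu : R) :
  (0 < Y)%N -> (0 < m)%N -> X = (m * Y)%N -> 0 < l -> 0 < mu ->
  uniq rs -> uniq ss ->
  sep_family (/ (INR X * INR X)) rs -> sep_family (/ (INR Y * INR Y)) ss ->
  (forall r s, r \in rs -> s \in ss -> circ_sep (/ (INR X * INR Y)) (x r) (x s)) ->
  2 * Cmod (\csum_(n < M) prodF rs ss (t + INR n)) <=
  (l * (INR X * INR Y) + 2 * mu * (INR X * INR Y + 2 * (INR X * INR X)))
     * (\rsum_(r <- rs) Cmod (c r) ^ 2) +
  (/ l * (INR X * INR X) + 2 * / mu * (INR X * INR Y + 2 * (INR Y * INR Y)))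
     * (\rsum_(s <- ss) Cmod (c s) ^ 2).
Proof.
move=> Y0 m0 eX l0 mu0 ur us sepr seps sepc.
set A := \rsum_(r <- rs) _; set B := \rsum_(r <- ss) _.
have X0 : (0 < X)%N by rewrite eX muln_gt0 m0.
have m1 : 1 <= INR m by rewrite -/(INR 1); apply: le_INR; apply/leP.
have Y1 : 1 <= INR Y by rewrite -/(INR 1); apply: le_INR; apply/leP.
have X1 : 1 <= INR X by rewrite -/(INR 1); apply: le_INR; apply/leP.
have eX' : INR X = INR m * INR Y by rewrite eX mult_INR.
set H := (X * Y)%N.
have eH : INR H = INR X * INR Y by rewrite mult_INR.
have H0 : 1 <= INR H by rewrite -/(INR 1); apply: le_INR; apply/leP; rewrite muln_gt0 X0.
rewrite -eH in sepc *.
have imu := Rinv_0_lt_compat _ mu0.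
set T := \csum_(n < M) _.
(* An AM-GM majorant of [2 |prodF|] whose sums over short ranges are controlled by the one-block
   inequality. *)
pose phi s := mu * Cmod (F rs s) ^ 2 + / mu * Cmod (F ss s) ^ 2.
have Gphi s : 2 * Cmod (prodF rs ss s) <= phi s.
  rewrite /prodF /phi Cmod_mult Cmod_conj.
  have : 0 <= mu * (Cmod (F rs s) - / mu * Cmod (F ss s)) ^ 2.
    by apply: Rmult_le_pos; [lra | exact: pow2_ge_0].
  have -> : mu * (Cmod (F rs s) - / mu * Cmod (F ss s)) ^ 2 =
    mu * Cmod (F rs s) ^ 2 + / mu * Cmod (F ss s) ^ 2 - 2 * (Cmod (F rs s) * Cmod (F ss s)).
    by field; lra.
  lra.
have phi0 s : 0 <= phi s.
  by have := Gphi s; have := Cmod_ge_0 (prodF rs ss s); lra.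
have edge a (L : nat) :
  2 * Cmod (\csum_(j < L) prodF rs ss (a + INR j)) <= \rsum_(j < L) phi (a + INR j).
  apply: (@Rle_trans _ (2 * (\rsum_(j < L) Cmod (prodF rs ss (a + INR j))))).
    by apply: Rmult_le_compat_l; [lra | exact: csum_Cmod].
  by rewrite big_distrr; apply: rsum_le => j _.
have full a : \rsum_(j < H) phi (a + INR j) <=
   mu * ((INR H + 2 * (INR X * INR X)) * A) + / mu * ((INR H + 2 * (INR Y * INR Y)) * B).
  rewrite /phi big_split /= -!big_distrr /=.
  apply: Rplus_le_compat; apply: Rmult_le_compat_l; try lra; exact: large_sieve_block.
set E := mu * _ + _ in full.
(* A window exceeds the range of [T] by edges of lengths [H - u] and [u]; each may be lengthened to
   [H] because [phi] is nonnegative. *)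
have each (u : 'I_H) :
  2 * Cmod (T - \csum_(v < M + H) prodF rs ss (t - INR H + INR u + INR v))%C <= 2 * E.
  have uH := ltnW (ltn_ord u).
  have -> : (M + H = (H - u) + (M + u))%N by rewrite [RHS]addnCA subnK.
  rewrite !seg_split /=.
  have -> : \csum_(j < M) prodF rs ss (t - INR H + INR u + INR (H - u) + INR j) = T.
    by apply: eq_bigr => j _; rewrite minus_INR; [congr prodF; ring | exact/leP].
  set S1 := \big[_/_]_(_ < H - u) _; set S2 := \big[_/_]_(_ < u) _.
  have -> : (T - (S1 + (T + S2)) = - (S1 + S2))%C by ring.
  rewrite Cmod_opp.
  have h1 : 2 * Cmod S1 <= E.
    apply: Rle_trans (edge _ _) _; apply: Rle_trans (full (t - INR H)).
    have := rseg_split phi (t - INR H) u (H - u); rewrite subnKC // => -> /=.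
    rewrite -[X in X <= _]Rplus_0_l; apply: Rplus_le_compat_r; exact: rsum_ge0.
  have h2 : 2 * Cmod S2 <= E.
    apply: Rle_trans (edge _ _) _; apply: Rle_trans (full (t + INR M)).
    have := rseg_split phi (t + INR M) u (H - u); rewrite subnKC // => -> /=.
    rewrite minus_INR; last exact/leP.
    set S3 := \big[_/_]_(_ < u) _; set S4 := \big[_/_]_(_ < u) _.
    have -> : S3 = S4 by apply: eq_bigr => j _; congr phi; ring.
    rewrite -[X in X <= _]Rplus_0_r; apply: Rplus_le_compat_l; exact: rsum_ge0.
  by have := Cmod_triangle S1 S2; lra.
pose W := \csum_(u < H) \csum_(v < M + H) prodF rs ss (t - INR H + INR u + INR v).
have hW : 2 * Cmod W <= l * (INR H * INR H) * A + / l * (INR H * (INR X * INR X)) * B.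
  have h := window_bound rs ss (t - INR H) H (M + H).
  pose k r s := cgeom H (x r - x s) * cgeom (M + H) (x r - x s).
  have k0 r s : 0 <= k r s by apply: Rmult_le_pos; exact: cgeom_ge0.
  have dc : 0 < / INR H by apply: Rinv_0_lt_compat; lra.
  have dx : 0 < / (INR X * INR X) by apply: Rinv_0_lt_compat; nra.
  have kle r s : r \in rs -> s \in ss -> k r s <= / Rsqr (sin (PI * (x r - x s))).
    move=> rr sr; apply: cgeom_mul_le; apply: (circ_sep_sin (/ INR H)) => //; exact: sepc.
  (* Since [Y <= X], the points of [ss] are spaced by at least [1/H], which is also their distance
     from [x r]. *)
  have row r : r \in rs -> \rsum_(s <- ss) k r s <= INR H * INR H.
    move=> rr.
    have -> : INR H * INR H = / INR 1 / Rsqr (/ INR H) by rewrite /Rsqr /=; field; lra.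
    apply: Rle_trans (row_sum ss x (x r) (/ INR H) 1 dc isT us _ _).
    - by apply: rsum_le_seq => s sr; exact: kle.
    - by move=> s sr; rewrite Rmult_1_l; exact: sepc.
    - move=> i j ir jr ne; apply: circ_sep_weak (seps i j ir jr ne).
      by apply: Rinv_le_contravar; nra.
  (* The points of [rs] are spaced by [1/X^2], and their distance [1/H] from [x s] is [m] such
     spacings: the gain [1/m] turns [X^4] into [H X^2]. *)
  have col s : s \in ss -> \rsum_(r <- rs) k r s <= INR H * (INR X * INR X).
    move=> sr.
    have -> : INR H * (INR X * INR X) = / INR m / Rsqr (/ (INR X * INR X)).
      by rewrite /Rsqr eH eX'; field; nra.
    apply: Rle_trans (row_sum rs x (x s) (/ (INR X * INR X)) m dx m0 ur _ _).
    - apply: rsum_le_seq => r rr; apply: Rle_trans (kle _ _ rr sr) _.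
      right; congr (/ _); rewrite Rsqr_neg -sin_neg; congr (Rsqr (sin _)); ring.
    - move=> r rr; apply: circ_sepC.
      have -> : INR m * / (INR X * INR X) = / INR H by rewrite eH eX'; field; lra.
      exact: sepc.
    - by [].
  have := schur rs ss (fun r => Cmod (c r)) (fun r => Cmod (c r)) k _ _ l l0 k0 row col.
  rewrite -/A -/B; apply: Rle_trans; apply: Rmult_le_compat_l; first lra.
  exact: h.
have hTW : 2 * Cmod (RtoC (INR H) * T - W)%C <= INR H * (2 * E).
  have -> : (RtoC (INR H) * T - W)%C =
    \csum_(u < H) (T - \csum_(v < M + H) prodF rs ss (t - INR H + INR u + INR v)).
    have aux (f : nat -> C) K : (RtoC (INR K) * T - \csum_(u < K) f u)%C = \csum_(u < K) (T - f u).
      elim: K => [|K IH]; first by rewrite !big_ord0; change (INR 0) with 0; ring.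
      rewrite S_INR RtoC_plus !big_ord_recr /= -IH.
      have E' (a b c' d : C) : ((a + 1) * b - (c' + d) = (a * b - c') + (b - d))%C by ring.
      exact: E'.
    exact: (aux (fun u => \csum_(v < M + H) prodF rs ss (t - INR H + INR u + INR v))).
  rewrite -rsum_const_ord.
  apply: Rle_trans.
    by apply: Rmult_le_compat_l; [lra | exact: csum_Cmod].
  by rewrite big_distrr; apply: rsum_le => u _; exact: each.
have hT : INR H * (2 * Cmod T) <=
   INR H * (2 * E) + (l * (INR H * INR H) * A + / l * (INR H * (INR X * INR X)) * B).
  have -> : INR H * (2 * Cmod T) = 2 * Cmod (RtoC (INR H) * T)%C.
    by rewrite Cmod_mult Cmod_R (Rabs_pos_eq (INR H)); [ring | lra].
  have -> : (RtoC (INR H) * T)%C = ((RtoC (INR H) * T - W) + W)%C by ring.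
  have := Cmod_triangle (RtoC (INR H) * T - W)%C W; lra.
apply: (Rmult_le_reg_l (INR H)); first lra.
apply: Rle_trans hT _; right; rewrite /E; ring.
Qed.
End Forms.

(** * A weighted large sieve *)

Lemma INR_expn b n : INR (b ^ n)%N = INR b ^ n.
Proof. by elim: n => [|n IH] //; rewrite expnS mult_INR IH. Qed.

Lemma Cmod_add_sqr (a b : C) :
  Cmod (a + b) ^ 2 = Cmod a ^ 2 + Cmod b ^ 2 + 2 * Re (b * Cconj a)%C.
Proof.
case: a => a1 a2; case: b => b1 b2.
have E (z : C) : Cmod z ^ 2 = z.1 ^ 2 + z.2 ^ 2.
  by rewrite /Cmod pow2_sqrt //; have := pow2_ge_0 z.1; have := pow2_ge_0 z.2; lra.
by rewrite !E /Re /=; ring.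
Qed.

Lemma Re_csum {I} (r : seq I) (F : I -> C) : Re (\csum_(i <- r) F i) = \rsum_(i <- r) Re (F i).
Proof.
elim: r => [|x r IH]; first by rewrite !big_nil.
by rewrite !big_cons -IH.
Qed.

Lemma pow_sum_34 n : \rsum_(i < n) (3 / 4) ^ (n - i) <= 3.
Proof.
suff -> : \rsum_(i < n) (3 / 4) ^ (n - i) = 3 - 3 * (3 / 4) ^ n.
  have h : 0 <= (3 / 4) ^ n by apply: pow_le; lra.
  lra.
elim: n => [|n IH]; first by rewrite big_ord0 /=; lra.
rewrite big_ord_recl subn0 [(3 / 4) ^ n.+1]/=.
have -> : \rsum_(i < n) (3 / 4) ^ (n.+1 - lift ord0 i) = \rsum_(i < n) (3 / 4) ^ (n - i).
  by apply: eq_bigr.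
by rewrite IH; lra.
Qed.

Lemma csum_recr n (f : nat -> C) : \csum_(i < n.+1) f i = (\csum_(i < n) f i + f n)%C.
Proof. by rewrite big_ord_recr. Qed.

Lemma rsum_recr n (f : nat -> R) : \rsum_(i < n.+1) f i = (\rsum_(i < n) f i) + f n.
Proof. by rewrite big_ord_recr. Qed.

Section Weighted.
Context {I : eqType} (c : I -> C) (x : I -> R) (rs : nat -> seq I).
Let F i := trigp c x (rs i).
Let A i := \rsum_(r <- rs i) Cmod (c r) ^ 2.
Hypothesis urs : forall i, uniq (rs i).
Hypothesis seprs : forall i, sep_family x (/ (INR (2 ^ i) * INR (2 ^ i))) (rs i).
Hypothesis sepcross : forall i k r s, (i < k)%N -> r \in rs k -> s \in rs i ->
  circ_sep (/ (INR (2 ^ k) * INR (2 ^ i))) (x r) (x s).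

(** The AM-GM weights [(3/2)^d] and [(3/4)^d], with [d = k - i], are chosen so that both
    coefficients decay: that of the large block must be summable over [i], and that of the small one
    must still decay relative to [4^k]. *)
Lemma cross_blocks (i k M : nat) (t : R) : (i < k)%N ->
  2 * Cmod (\csum_(n < M) (F k (t + INR n) * Cconj (F i (t + INR n)))) <=
  4 ^ k * (6 * (3 / 4) ^ (k - i) * A k + 5 * (2 / 3) ^ (k - i) * A i).
Proof.
move=> ik; set d := (k - i)%N.
have d1 : (0 < d)%N by rewrite subn_gt0.
have e2 n : INR (2 ^ n) = 2 ^ n by rewrite INR_expn.
have p2 n : (0 < 2 ^ n)%N by rewrite expn_gt0.
have eX : (2 ^ k = 2 ^ d * 2 ^ i)%N by rewrite -expnD subnK // ltnW.
have l0 : 0 < (3 / 2) ^ d by apply: pow_lt; lra.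
have mu0 : 0 < (3 / 4) ^ d by apply: pow_lt; lra.
have h := large_sieve_cross c x (rs k) (rs i) (2 ^ k) (2 ^ i) (2 ^ d) M t _ _ (p2 i) (p2 d) eX l0 mu0
  (urs k) (urs i) (seprs k) (seprs i) (fun r s rr sr => sepcross i k r s ik rr sr).
apply: Rle_trans h _; rewrite -/(A k) -/(A i) !e2.
have hX : 2 ^ k = 2 ^ d * 2 ^ i by rewrite -!e2 eX mult_INR.
have h4 : 4 ^ k = 2 ^ k * 2 ^ k by rewrite -Rpow_mult_distr; congr (_ ^ _); ring.
rewrite h4.
(* As [u v w = 1], the weights are [l = u v], [1/l = w], [mu = v] and [1/mu = u w], and both sides
   become polynomials. *)
set u := 2 ^ d; set v := (3 / 4) ^ d; set w := (2 / 3) ^ d.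
have u2 : 2 <= u.
  by rewrite /u; have := Rle_pow 2 1 d; rewrite pow_1; apply; [lra | apply/leP].
have w0 : 0 < w by apply: pow_lt; lra.
have el : (3 / 2) ^ d = u * v by rewrite -Rpow_mult_distr; congr (_ ^ _); field.
have uvw : u * v * w = 1.
  by rewrite -!Rpow_mult_distr -(pow1 d); congr (_ ^ _); field.
have v0 : 0 < v by exact: mu0.
have uv0 : 0 < u * v by apply: Rmult_lt_0_compat; lra.
have il : / (u * v) = w.
  by apply: (Rmult_eq_reg_l (u * v)); [rewrite Rinv_r; lra | lra].
have imu : / v = u * w.
  by apply: (Rmult_eq_reg_l v); [rewrite Rinv_r; lra | lra].
rewrite el il imu; rewrite -/u in hX; rewrite hX.
have y0 : 0 < 2 ^ i by apply: pow_lt; lra.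
set y := 2 ^ i in y0 *.
have A0 : 0 <= A k by apply: rsum_ge0 => *; exact: pow2_ge_0.
have B0 : 0 <= A i by apply: rsum_ge0 => *; exact: pow2_ge_0.
apply: (@Rle_trans _ (v * (y * y) * u * (6 * u) * A k + w * (y * y) * u * (5 * u) * A i));
  last by right; ring.
apply: Rplus_le_compat; apply: Rmult_le_compat_r => //.
  have -> : u * v * (u * y * y) + 2 * v * (u * y * y + 2 * (u * y * (u * y))) =
     v * (y * y) * u * (5 * u + 2) by ring.
  apply: Rmult_le_compat_l; last lra.
  by apply: Rmult_le_pos; [apply: Rmult_le_pos; nra | lra].
have -> : w * (u * y * (u * y)) + 2 * (u * w) * (u * y * y + 2 * (y * y)) =
   w * (y * y) * u * (3 * u + 4) by ring.
apply: Rmult_le_compat_l; last lra.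
by apply: Rmult_le_pos; [apply: Rmult_le_pos; nra | lra].
Qed.

(** Induction on the number of blocks, expanding the square of the old sum plus the new block. The
    constant is [20 = 2 + 6 * 3]: the new block costs [2 * 4^(J+1)] by itself and, by [pow_sum_34],
    at most [18 * 4^(J+1)] through the cross terms. *)
Lemma weighted_large_sieve (J M : nat) (t : R) :
  \rsum_(n < M) Cmod (\csum_(i < J.+1) F i (t + INR n)) ^ 2 <=
  \rsum_(i < J.+1) ((INR M + 20 * 4 ^ J * (2 / 3) ^ (J - i)) * A i).
Proof.
have block i : \rsum_(n < M) Cmod (F i (t + INR n)) ^ 2 <= (INR M + 2 * 4 ^ i) * A i.
  have -> : 4 ^ i = INR (2 ^ i) * INR (2 ^ i).
    by rewrite INR_expn -Rpow_mult_distr; congr (_ ^ _); rewrite /=; lra.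
  by apply: large_sieve_block => //; rewrite expn_gt0.
have A0 i : 0 <= A i by apply: rsum_ge0 => *; exact: pow2_ge_0.
elim: J => [|J IH].
  rewrite big_ord1 subnn /=.
  under eq_bigr => n _ do rewrite big_ord1.
  by apply: Rle_trans (block _) _; have := A0 0%N; rewrite /=; nra.
have E : \rsum_(n < M) Cmod (\csum_(i < J.+2) F i (t + INR n)) ^ 2 =
   \rsum_(n < M) Cmod (\csum_(i < J.+1) F i (t + INR n)) ^ 2 +
   \rsum_(n < M) Cmod (F J.+1 (t + INR n)) ^ 2 +
   2 * Re (\csum_(i < J.+1) \csum_(n < M) (F J.+1 (t + INR n) * Cconj (F i (t + INR n)))).
  rewrite exchange_big Re_csum big_distrr -!big_split; apply: eq_bigr => n _.
  by rewrite (csum_recr _ (fun i => F i _)) Cmod_add_sqr csum_conj big_distrr.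
rewrite E (rsum_recr _ (fun i => (INR M + 20 * 4 ^ J.+1 * (2 / 3) ^ (J.+1 - i)) * A i)) subnn pow_O Rmult_1_r.
have C1 : 2 * Re (\csum_(i < J.+1) \csum_(n < M) (F J.+1 (t + INR n) * Cconj (F i (t + INR n)))) <=
  \rsum_(i < J.+1) (4 ^ J.+1 * (6 * (3 / 4) ^ (J.+1 - i) * A J.+1 + 5 * (2 / 3) ^ (J.+1 - i) * A i)).
  rewrite Re_csum big_distrr; apply: rsum_le => i _ /=.
  have := cross_blocks i J.+1 M t (ltn_ord i).
  set W := \big[_/_]_(_ < _) _ => h.
  have := re_le_Cmod W; have := Rle_abs (Re W); rewrite -/(4 ^ J.+1) in h *; rewrite /= in h *; lra.
have C2 : \rsum_(i < J.+1) (4 ^ J.+1 * (6 * (3 / 4) ^ (J.+1 - i) * A J.+1 + 5 * (2 / 3) ^ (J.+1 - i) * A i))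
  <= 18 * 4 ^ J.+1 * A J.+1 + \rsum_(i < J.+1) (5 * 4 ^ J.+1 * (2 / 3) ^ (J.+1 - i) * A i).
  have -> : \rsum_(i < J.+1) (4 ^ J.+1 * (6 * (3 / 4) ^ (J.+1 - i) * A J.+1 + 5 * (2 / 3) ^ (J.+1 - i) * A i))
    = 4 ^ J.+1 * 6 * A J.+1 * (\rsum_(i < J.+1) (3 / 4) ^ (J.+1 - i)) +
      \rsum_(i < J.+1) (5 * 4 ^ J.+1 * (2 / 3) ^ (J.+1 - i) * A i).
    by rewrite big_distrr -big_split; apply: eq_bigr => i _; rewrite [LHS]/= [RHS]/=; ring.
  apply: Rplus_le_compat_r.
  have p4 : 0 < 4 ^ J.+1 by apply: pow_lt; lra.
  have -> : 18 * 4 ^ J.+1 * A J.+1 = 4 ^ J.+1 * 6 * A J.+1 * 3 by ring.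
  apply: Rmult_le_compat_l; last exact: pow_sum_34.
  by have := A0 J.+1; apply: Rmult_le_pos; lra.
(* The quantity [4^J (2/3)^(J-i)] grows by the factor 8/3 in each step, and
   [20 + 5 * 8/3 <= 20 * 8/3]. *)
have C3 : \rsum_(i < J.+1) ((INR M + 20 * 4 ^ J * (2 / 3) ^ (J - i)) * A i) +
   \rsum_(i < J.+1) (5 * 4 ^ J.+1 * (2 / 3) ^ (J.+1 - i) * A i) <=
   \rsum_(i < J.+1) ((INR M + 20 * 4 ^ J.+1 * (2 / 3) ^ (J.+1 - i)) * A i).
  rewrite -big_split; apply: rsum_le => i _.
  have -> : (J.+1 - i = (J - i).+1)%N by rewrite subSn // -ltnS.
  have h1 : 0 < (2 / 3) ^ (J - i) by apply: pow_lt; lra.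
  have h2 : 0 < 4 ^ J by apply: pow_lt; lra.
  rewrite [LHS in LHS <= _]/= -Rmult_plus_distr_r; apply: Rmult_le_compat_r => //.
  by rewrite /=; nra.
have := block J.+1; have := A0 J.+1.
move: C1 C2 C3 IH; rewrite -[4 ^ J.+1]/(4 * 4 ^ J).
move=> C1 C2 C3 IH A1 B1; lra.
Qed.
End Weighted.

(** * Fourier expansion of the sieve functions *)

Lemma INR_gt0 n : (0 < n)%N -> 0 < INR n.
Proof. by move=> h; apply: lt_0_INR; apply/ltP. Qed.

Lemma iota0E n : iota 0 n = index_iota 0 n.
Proof. by rewrite /index_iota subn0. Qed.

Section DFT.
Variables (q : nat) (f : nat -> R).
Hypothesis q0 : (0 < q)%N.

Definition dft (a : nat) : C := \csum_(m < q) (RtoC (f m / INR q) * cis (- (INR m * (INR a / INR q)))).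

Lemma dft_orth (m n : nat) : (m < q)%N -> (n < q)%N ->
  \csum_(a < q) (cis (INR n * (INR a / INR q)) * cis (- (INR m * (INR a / INR q)))) =
  if m == n then RtoC (INR q) else RtoC 0.
Proof.
move=> mq nq; have q1 := INR_gt0 q q0.
(* Adding [q] keeps the difference [n - m] in [nat] and changes each phase by the integer [a]. *)
rewrite (eq_bigr (fun a : 'I_q => cis (INR a * (INR (n + q - m) / INR q)))) => [|a _]; last first.
  rewrite -cisD minus_INR ?plus_INR; last by apply/leP; rewrite ltnW // (leq_trans mq) // leq_addl.
  have -> : INR a * ((INR n + INR q - INR m) / INR q) =
     INR n * (INR a / INR q) + - (INR m * (INR a / INR q)) + INR a by field; lra.
  by rewrite [RHS]cisD cis_nat Cmult_1_r.
rewrite cis_geom_orth //; congr (if _ then _ else _).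
case: eqP => [->|ne]; first by rewrite addnC addnK dvdnn.
apply/negP => /dvdnP [k hk]; apply: ne.
move: hk mq nq; case: k => [|[|k]].
- by move=> h mq nq; move: h; rewrite mul0n => /eqP; rewrite subn_eq0 leqNgt (leq_trans mq) ?leq_addl.
- by rewrite mul1n => h mq nq; apply/eqP; rewrite -(eqn_add2r q) -{1}h addnC subnK // (leq_trans (ltnW mq)) ?leq_addl.
- move=> h mq nq; have : (n + q - m < 2 * q)%N.
    by apply: leq_ltn_trans (leq_subr _ _) _; rewrite mul2n -addnn ltn_add2r.
  by rewrite h ltn_mul2r q0 /=.
Qed.

Lemma dft_inv (n : nat) : (n < q)%N ->
  \csum_(a < q) (dft a * cis (INR n * (INR a / INR q))) = RtoC (f n).
Proof.
move=> nq; have q1 := INR_gt0 q q0.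
transitivity (\csum_(m < q) (RtoC (f m / INR q) *
  (\csum_(a < q) (cis (INR n * (INR a / INR q)) * cis (- (INR m * (INR a / INR q))))))).
  under [RHS]eq_bigr => m _ do rewrite big_distrr /=.
  rewrite [RHS]exchange_big; apply: eq_bigr => a _.
  by rewrite /dft big_distrl; apply: eq_bigr => m _ /=; ring.
rewrite (eq_bigr (fun m : 'I_q => if (m : nat) == n then RtoC (f m) else RtoC 0)) => [|m _].
  rewrite (bigD1 (Ordinal nq)) //= eqxx big1 ?Cplus_0_r // => m ne.
  by rewrite ifF //; apply/negbTE; move: ne; rewrite -val_eqE.
rewrite dft_orth //; case: eqP => _; last by rewrite Cmult_0_r.
by rewrite -RtoC_mult; congr RtoC; field; lra.
Qed.

Lemma dft_parseval :
  \rsum_(a < q) Cmod (dft a) ^ 2 = (\rsum_(m < q) f m ^ 2) / INR q.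
Proof.
have q1 := INR_gt0 q q0.
apply: RtoC_inj; rewrite csum_RtoC.
transitivity (\csum_(a < q) (dft a * \csum_(m < q) (RtoC (f m / INR q) * cis (INR m * (INR a / INR q))))).
  apply: eq_bigr => a _; rewrite Cmod_sqr; congr (_ * _)%C.
  rewrite /dft csum_conj; apply: eq_bigr => m _.
  rewrite Cmult_conj cis_conj Ropp_involutive; congr (_ * _)%C.
  by rewrite /Cconj /RtoC /= Ropp_0.
transitivity (\csum_(m < q) (RtoC (f m / INR q) * RtoC (f m))).
  under [LHS]eq_bigr => a _ do rewrite big_distrr /=.
  rewrite exchange_big; apply: eq_bigr => m _.
  rewrite -dft_inv // big_distrr; apply: eq_bigr => a _ /=; ring.
rewrite /Rdiv Rmult_comm big_distrr csum_RtoC; apply: eq_bigr => m _.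
by rewrite -RtoC_mult; congr RtoC => /=; ring.
Qed.
End DFT.

Lemma sum_split_mul {T : Type} {idx : T} (op : Monoid.law idx) (F : nat -> T) (a b : nat) :
  \big[op/idx]_(m < a * b) F m = \big[op/idx]_(j < b) \big[op/idx]_(i < a) F (i + a * j)%N.
Proof.
elim: b => [|b IH]; first by rewrite muln0 !big_ord0.
rewrite mulnS addnC big_split_ord IH big_ord_recr; congr (op _ _).
by apply: eq_bigr => i _ /=; rewrite addnC.
Qed.

(** The map [j -> i + a j] permutes the residues modulo [p]. *)
Lemma sum_coprime_shift {T : Type} {idx : T} (op : Monoid.com_law idx) (F : nat -> T) (p a i : nat) :
  (0 < p)%N -> coprime p a ->
  \big[op/idx]_(j < p) F ((i + a * j) %% p)%N = \big[op/idx]_(j < p) F j.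
Proof.
move=> p0 cop; pose s (j : 'I_p) : 'I_p := Ordinal (ltn_pmod (i + a * j) p0).
have sinj : injective s.
  move=> j k /(congr1 val) /= /eqP; rewrite eqn_modDl => h; apply: val_inj => /=.
  wlog le : j k h / (k <= j)%N.
    by move=> H; case/orP: (leq_total k j) => hh; [exact: H | symmetry; apply: H; rewrite // eq_sym].
  move: h; rewrite eqn_mod_dvd ?leq_mul2l ?le ?orbT // -mulnBr Gauss_dvdr // => h.
  apply/eqP; rewrite eqn_leq le andbT -subn_eq0.
  case: posnP => // pos; have := dvdn_leq pos h.
  by rewrite leqNgt (leq_ltn_trans (leq_subr _ _)).
by rewrite [RHS](reindex_inj sinj).
Qed.

(** * Squarefree moduli and the local sieve functions *)

Definition sqf (q : nat) := (0 < q)%N && all (fun p => logn p q == 1%N) (primes q).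

Lemma primes_mul_prime p q : prime p -> (0 < q)%N -> ~~ (p %| q)%N ->
  perm_eq (primes (p * q)) (p :: primes q).
Proof.
move=> pp q0 nd; have p0 := prime_gt0 pp.
apply: uniq_perm; rewrite ?primes_uniq //=.
  by rewrite mem_primes pp q0 (negbTE nd) primes_uniq.
by move=> r; rewrite primesM // inE primes_prime // mem_seq1.
Qed.

Lemma sqf_mul p q : prime p -> (0 < q)%N -> ~~ (p %| q)%N -> sqf (p * q) = sqf q.
Proof.
move=> pp q0 nd; have p0 := prime_gt0 pp.
rewrite /sqf muln_gt0 p0 q0 /= (perm_all _ (primes_mul_prime _ _ pp q0 nd)) /=.
have l0 : logn p q = 0%N by apply/eqP; rewrite -leqn0 leqNgt logn_gt0 mem_primes pp q0.
rewrite lognM // l0 addn0 logn_prime // eqxx /=.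
apply: eq_in_all => r; rewrite mem_primes => /and3P [pr _ rq].
rewrite lognM // (logn_prime r pp); case: (eqVneq r p) => // e.
by rewrite e in rq; rewrite rq in nd.
Qed.

Lemma sqf_div p q : sqf q -> prime p -> (p %| q)%N ->
  [/\ (0 < q %/ p)%N, ~~ (p %| q %/ p)%N, sqf (q %/ p) & q = (p * (q %/ p))%N].
Proof.
move=> /andP [q0 /allP h] pp pq.
have e : q = (p * (q %/ p))%N by rewrite mulnC divnK.
have d0 : (0 < q %/ p)%N by rewrite divn_gt0 ?prime_gt0 // dvdn_leq.
have nd : ~~ (p %| q %/ p)%N.
  have h1 : logn p q = (1 + logn p (q %/ p))%N.
    by rewrite [in LHS]e lognM ?(prime_gt0 pp) ?(logn_prime p pp) ?eqxx.
  have := h p; rewrite mem_primes pp q0 pq => /(_ isT).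
  rewrite h1 add1n eqSS => /eqP h0.
  by apply/negP => pd; move: h0; apply/eqP; rewrite -lt0n logn_gt0 mem_primes pp d0.
split=> //; rewrite -(sqf_mul p) // -e; apply/andP; split=> //; exact/allP.
Qed.

Section Sieve.
Variable (Om : nat -> nat -> bool).
Hypothesis om_lt : forall p, prime p -> (omega Om p < p)%N.

Definition hp (p : nat) : R := INR (omega Om p) / (INR p - INR (omega Om p)).
Definition gp (p n : nat) : R := if Om p (n %% p) then - 1 else hp p.
Definition hq (q : nat) : R := \rprod_(p <- primes q) hp p.
Definition gq (q n : nat) : R := \rprod_(p <- primes q) gp p n.

Lemma om_lt_R p : prime p -> INR (omega Om p) < INR p.
Proof. by move/om_lt/ltP/lt_INR. Qed.

Lemma hp_ge0 p : prime p -> 0 <= hp p.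
Proof.
move=> pp; have := om_lt_R p pp => h; apply: Rmult_le_pos; first exact: pos_INR.
by apply: Rlt_le; apply: Rinv_0_lt_compat; lra.
Qed.

Lemma sum_gp p (F : R -> R) : (0 < p)%N ->
  \rsum_(j < p) F (gp p j) = INR (omega Om p) * F (- 1) + (INR p - INR (omega Om p)) * F (hp p).
Proof.
move=> p0.
have -> : \rsum_(j < p) F (gp p j) = \rsum_(j <- iota 0 p) (if Om p j then F (- 1) else F (hp p)).
  rewrite iota0E big_mkord; apply: eq_bigr => j _.
  by rewrite /gp modn_small //; case: (Om p j).
rewrite /omega; have : INR p = INR (size (iota 0 p)) by rewrite size_iota.
move=> ->; elim: (iota 0 p) => [|j s IH]; first by rewrite big_nil /=; lra.
rewrite big_cons IH.
have -> : count (Om p) (j :: s) = (Om p j + count (Om p) s)%N by [].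
have -> : size (j :: s) = (size s).+1 by [].
by case: (Om p j); rewrite ?add1n ?add0n !S_INR; lra.
Qed.

Lemma gp_mean p : prime p -> \rsum_(j < p) gp p j = 0.
Proof.
move=> pp; rewrite (sum_gp p id) ?prime_gt0 // /hp.
by have := om_lt_R p pp => h; field; lra.
Qed.

Lemma gp_mean_sq p : prime p -> \rsum_(j < p) gp p j ^ 2 = INR p * hp p.
Proof.
move=> pp; rewrite (sum_gp p (fun t => t ^ 2)) ?prime_gt0 // /hp.
by have := om_lt_R p pp => h; field; lra.
Qed.

Lemma gp_mod p n : gp p (n %% p) = gp p n.
Proof. by rewrite /gp modn_mod. Qed.

Lemma gq_mod q n d : (q %| d)%N -> gq q (n %% d) = gq q n.
Proof.
move=> qd; apply: eq_big_seq => p; rewrite mem_primes => /and3P [_ _ pq].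
by rewrite -gp_mod modn_dvdm ?gp_mod // (dvdn_trans pq).
Qed.

Lemma gq_mul p q n : prime p -> (0 < q)%N -> ~~ (p %| q)%N -> gq (p * q) n = gp p n * gq q n.
Proof.
by move=> pp q0 nd; rewrite /gq (perm_big _ (primes_mul_prime _ _ pp q0 nd)) big_cons.
Qed.

Lemma hq_mul p q : prime p -> (0 < q)%N -> ~~ (p %| q)%N -> hq (p * q) = hp p * hq q.
Proof.
by move=> pp q0 nd; rewrite /hq (perm_big _ (primes_mul_prime _ _ pp q0 nd)) big_cons.
Qed.

Lemma hq_ge0 q : 0 <= hq q.
Proof.
rewrite /hq big_seq; elim/big_ind: _ => //; first lra.
  by move=> x y; exact: Rmult_le_pos.
by move=> p; rewrite mem_primes => /andP [/hp_ge0].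
Qed.

Lemma gq_addl q i j : gq q (i + q * j) = gq q i.
Proof. by rewrite -(gq_mod q _ q) // addnC mulnC modnMDl gq_mod. Qed.

(** Chinese remaindering, one prime at a time: with [q = p d] and [m = i + d j], the factor [gq d]
    sees only [i], while [j] runs through all residues modulo [p]. *)
Lemma gq_mean_sq q : sqf q -> \rsum_(m < q) gq q m ^ 2 = INR q * hq q.
Proof.
elim/ltn_ind: q => q IH sq.
case: (ltngtP q 1) => [|q1|->]; first by rewrite ltnS leqn0 => /eqP e; rewrite e in sq.
  set p := pdiv q; have pp : prime p by apply: pdiv_prime.
  have [d0 nd sd e] := sqf_div p q sq pp (pdiv_dvd q).
  set d := (q %/ p)%N in d0 nd sd e.
  have dq : (d < q)%N by rewrite e ltn_Pmull // prime_gt1.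
  have eq_sum : \rsum_(m < q) gq q m ^ 2 = \rsum_(m < d * p) gq q m ^ 2 by rewrite mulnC -e.
  rewrite eq_sum (sum_split_mul Rplus (fun m => gq q m ^ 2)) exchange_big.
  rewrite e hq_mul // mult_INR.
  under eq_bigr => i _.
    under eq_bigr => j _ do rewrite gq_mul // gq_addl Rpow_mult_distr -gp_mod.
    rewrite -big_distrl /= (sum_coprime_shift Rplus (fun n => gp p n ^ 2)) ?prime_gt0 ?prime_coprime //.
    rewrite gp_mean_sq //.
    over.
  by rewrite -big_distrr /= IH //; ring.
by rewrite big_ord1 /gq /hq /= !big_nil; ring.
Qed.

Definition dq (q a : nat) : C := dft q (gq q) a.

Lemma gq_fourier q n : (0 < q)%N ->
  RtoC (gq q n) = \csum_(a < q) (dq q a * cis (INR n * (INR a / INR q))).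
Proof.
move=> q0; have q1 := INR_gt0 q q0.
rewrite -(gq_mod q n q) // -(dft_inv q (gq q) q0 _ (ltn_pmod n q0)).
apply: eq_bigr => a _; congr (_ * _)%C.
rewrite {2}(divn_eq n q) plus_INR mult_INR Rmult_plus_distr_r cisD.
have -> : INR (n %/ q) * INR q * (INR a / INR q) = INR (n %/ q * a) by rewrite mult_INR; field; lra.
by rewrite cis_nat Cmult_1_l.
Qed.

(** If [p] divides both [a] and [q = p d], the exponential has period [d] in [m]. The sum over [j]
    in [m = i + d j] then meets only [gp p], which has mean 0. *)
Lemma dq_noncoprime q a : sqf q -> ~~ coprime a q -> dq q a = RtoC 0.
Proof.
move=> sq; have q0 : (0 < q)%N by case/andP: sq.
rewrite /coprime => nc.
have g1 : (1 < gcdn a q)%N by rewrite ltn_neqAle eq_sym nc gcdn_gt0 q0 orbT.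
set p := pdiv (gcdn a q); have pp : prime p by apply: pdiv_prime.
have pa : (p %| a)%N by apply: dvdn_trans (pdiv_dvd _) (dvdn_gcdl _ _).
have pq : (p %| q)%N by apply: dvdn_trans (pdiv_dvd _) (dvdn_gcdr _ _).
have [d0 nd sd e] := sqf_div p q sq pp pq.
set d := (q %/ p)%N in d0 nd sd e.
have d1 := INR_gt0 d d0; have p1 := INR_gt0 p (prime_gt0 pp).
rewrite /dq /dft.
pose G m := (RtoC (gq q m / INR q) * cis (- (INR m * (INR a / INR q))))%C.
have eq_sum : \csum_(m < q) G m = \csum_(m < d * p) G m by rewrite mulnC -e.
rewrite -/(\csum_(m < q) G m) eq_sum (sum_split_mul Cplus (fun m => (RtoC (gq q m / INR q) * cis (- (INR m * (INR a / INR q))))%C)) exchange_big /=.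
apply: big1 => i _.
have E (j : 'I_p) : (RtoC (gq q (i + d * j) / INR q) * cis (- (INR (i + d * j) * (INR a / INR q))))%C =
  (RtoC (gp p ((i + d * j) %% p)) * (RtoC (gq d i / INR q) * cis (- (INR i * (INR a / INR q)))))%C.
  rewrite gp_mod; case/dvdnP: pa => a1 ea.
  have -> : cis (- (INR (i + d * j) * (INR a / INR q))) = cis (- (INR i * (INR a / INR q))).
    have -> : - (INR i * (INR a / INR q)) = - (INR (i + d * j) * (INR a / INR q)) + INR (j * a1).
      by rewrite ea e plus_INR !mult_INR; field; lra.
    by rewrite cisD cis_nat Cmult_1_r.
  rewrite e gq_mul // gq_addl -e Cmult_assoc -RtoC_mult; congr (RtoC _ * _)%C.
  by rewrite /Rdiv; ring.
rewrite (eq_bigr _ (fun j _ => E j)) -big_distrl /=.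
rewrite (sum_coprime_shift Cplus (fun n => RtoC (gp p n))) ?prime_gt0 ?prime_coprime //.
by rewrite -csum_RtoC gp_mean // Cmult_0_l.
Qed.

Lemma gq_farey q n : sqf q ->
  RtoC (gq q n) = \csum_(a <- [seq a <- iota 0 q | coprime a q]) (dq q a * cis (INR n * (INR a / INR q))).
Proof.
move=> sq; have q0 : (0 < q)%N by case/andP: sq.
rewrite gq_fourier // big_filter iota0E big_mkord.
rewrite (bigID (fun a : 'I_q => coprime a q)) /= [X in (_ + X)%C]big1 ?Cplus_0_r // => a nc.
by rewrite dq_noncoprime // Cmult_0_l.
Qed.

Lemma dq_parseval q : sqf q ->
  \rsum_(a <- [seq a <- iota 0 q | coprime a q]) Cmod (dq q a) ^ 2 = hq q.
Proof.
move=> sq; have q0 : (0 < q)%N by case/andP: sq.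
have q1 := INR_gt0 q q0.
have h := dft_parseval q (gq q) q0; rewrite gq_mean_sq // in h.
have {}h : \rsum_(a < q) Cmod (dq q a) ^ 2 = hq q by rewrite h; field; lra.
rewrite -h big_filter iota0E big_mkord.
rewrite [RHS](bigID (fun a : 'I_q => coprime a q)) /= [X in _ + X]big1 ?Rplus_0_r // => a nc.
by rewrite dq_noncoprime // Cmod_0; ring.
Qed.
End Sieve.

(** * Sieve upper bounds *)

(** The range starts at 0 so that [q = 1] has its residue 0. *)
Definition residues (q : nat) := [seq a <- iota 0 q | coprime a q].
Definition farey (qs : seq nat) : seq (nat * nat) := [seq (q, a) | q <- qs, a <- residues q].
Definition fpt (r : nat * nat) : R := INR r.2 / INR r.1.

Lemma residuesP q a : a \in residues q -> (a < q)%N /\ coprime a q.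
Proof. by rewrite mem_filter mem_iota add0n => /andP [-> /andP [_ ->]]. Qed.

Lemma farey_in qs r : r \in farey qs -> r.1 \in qs /\ r.2 \in residues r.1.
Proof. by case/allpairsPdep => q [a [h1 h2 ->]]. Qed.

Lemma farey_uniq qs : uniq qs -> uniq (farey qs).
Proof.
move=> u; apply: allpairs_uniq_dep => // [q _|]; first by rewrite filter_uniq ?iota_uniq.
by move=> [q a] [q' a'] _ _ [-> ->].
Qed.

(** Over the common denominator [q q'] the two fractions have distinct numerators in [[0, q q')], so
    they also stay apart modulo 1. *)
Lemma farey_sep (X Y : nat) (r s : nat * nat) :
  (0 < r.1 <= X)%N -> (0 < s.1 <= Y)%N -> r.2 \in residues r.1 -> s.2 \in residues s.1 ->
  r != s -> circ_sep (/ (INR X * INR Y)) (fpt r) (fpt s).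
Proof.
case: r => q a; case: s => q' a' /= /andP [q0 qX] /andP [q0' qY].
move=> /residuesP [aq cop] /residuesP [aq' cop'] ne.
have p1 := INR_gt0 q q0; have p2 := INR_gt0 q' q0'.
have X1 : INR q <= INR X by apply: le_INR; apply/leP.
have Y1 : INR q' <= INR Y by apply: le_INR; apply/leP.
(* Both fractions are reduced: if they are equal, each denominator divides the other. *)
have ne' : (a * q' != a' * q)%N.
  apply/eqP => e; move: ne; rewrite xpair_eqE negb_and.
  have d1 : (q %| q')%N by rewrite -(Gauss_dvdr q' (n := a)) 1?coprime_sym // e dvdn_mull.
  have d2 : (q' %| q)%N by rewrite -(Gauss_dvdr q (n := a')) 1?coprime_sym // -e dvdn_mull.
  have eq : q = q' by apply/eqP; rewrite eqn_dvd d1 d2.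
  by rewrite eq eqxx /=; move: e; rewrite eq => /eqP; rewrite eqn_pmul2r // => ->.
pose qq := (q * q')%N.
have qq1 : INR qq = INR q * INR q' by rewrite mult_INR.
have qq0 : 0 < INR qq by rewrite qq1; nra.
have key (u v : nat) : (u < qq)%N -> (v < qq)%N -> u != v ->
    / INR qq <= Rabs (INR u / INR qq - INR v / INR qq) <= 1 - / INR qq.
  wlog uv : u v / (u < v)%N.
    move=> H hu hv; rewrite neq_ltn => /orP [h|h]; first by apply: H; rewrite // neq_ltn h.
    by rewrite Rabs_minus_sym; apply: H; rewrite // neq_ltn h.
  move=> _ hv _.
  have h1 : INR u + 1 <= INR v by rewrite -S_INR; apply: le_INR; apply/leP.
  have h2 : INR v + 1 <= INR qq by rewrite -S_INR; apply: le_INR; apply/leP.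
  have h3 := pos_INR u.
  have -> : INR u / INR qq - INR v / INR qq = - ((INR v - INR u) * / INR qq) by field; lra.
  have i0 := Rinv_0_lt_compat _ qq0.
  rewrite Rabs_Ropp Rabs_pos_eq; last by apply: Rmult_le_pos; lra.
  have e1 : 1 - / INR qq = (INR qq - 1) * / INR qq by field; lra.
  rewrite e1; split; last by apply: Rmult_le_compat_r; lra.
  by rewrite -{1}(Rmult_1_l (/ INR qq)); apply: Rmult_le_compat_r; lra.
have l1 : (a * q' < qq)%N by rewrite ltn_pmul2r.
have l2 : (a' * q < qq)%N by rewrite /qq (mulnC q) ltn_pmul2r.
move: (key _ _ l1 l2 ne').
rewrite qq1 !mult_INR.
have -> : INR a * INR q' / (INR q * INR q') = INR a / INR q by field; lra.
have -> : INR a' * INR q / (INR q * INR q') = INR a' / INR q' by field; lra.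
apply: circ_sep_weak.
by apply: Rinv_le_contravar; [nra | apply: Rmult_le_compat; lra].
Qed.

Section SieveBound.
Variables (Om : nat -> nat -> bool).
Hypothesis om_lt : forall p, prime p -> (omega Om p < p)%N.

Definition fcoef (y : nat -> R) (r : nat * nat) : C := (RtoC (y r.1) * dq Om r.1 r.2)%C.

Lemma farey_trigp (y : nat -> R) qs (n : nat) : all sqf qs ->
  trigp (fcoef y) fpt (farey qs) (INR n) = RtoC (\rsum_(q <- qs) (y q * gq Om q n)).
Proof.
move=> /allP sq; rewrite /trigp /farey big_allpairs_dep csum_RtoC.
apply: eq_big_seq => q /sq sqq; rewrite RtoC_mult gq_farey // big_distrr.
by apply: eq_bigr => a _; rewrite /fcoef /fpt /= Cmult_assoc.
Qed.

Lemma farey_norm (y : nat -> R) qs : all sqf qs ->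
  \rsum_(r <- farey qs) Cmod (fcoef y r) ^ 2 = \rsum_(q <- qs) (y q ^ 2 * hq Om q).
Proof.
move=> /allP sq; rewrite /farey big_allpairs_dep.
apply: eq_big_seq => q /sq sqq; rewrite -dq_parseval // big_distrr.
apply: eq_bigr => a _; rewrite /fcoef Cmod_mult Cmod_R Rpow_mult_distr.
by rewrite RPow_abs (Rabs_pos_eq (_ ^ 2)) //; exact: pow2_ge_0.
Qed.

Definition sqfs (Q : nat) := [seq q <- iota 1 Q | sqf q].
(** The dyadic range [2^(i-1) < q <= 2^i]; block 0 is [q = 1]. *)
Definition block (i : nat) := [seq q <- iota 1 (2 ^ i) | sqf q & up_log 2 q == i].

Definition Gsum (Q : nat) : R := \rsum_(q <- sqfs Q) hq Om q.
Definition Hsum (i : nat) : R := \rsum_(q <- block i) hq Om q.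

Lemma sqfs_all Q : all sqf (sqfs Q). Proof. exact: filter_all. Qed.
Lemma block_all i : all sqf (block i).
Proof. by apply/allP => q; rewrite mem_filter => /andP [/andP []]. Qed.

Lemma Hsum_ge0 i : 0 <= Hsum i.
Proof. by apply: rsum_ge0 => q _; exact: hq_ge0. Qed.

Lemma Gsum_Hsum i : Gsum (2 ^ i) = \rsum_(k < i.+1) Hsum k.
Proof.
rewrite /Gsum /sqfs big_filter big_mkcond /=.
rewrite (eq_big_seq (fun q => \rsum_(k < i.+1) (if sqf q && (up_log 2 q == k) then hq Om q else 0))); last first.
  move=> q; rewrite mem_iota add1n ltnS => /andP [q0 qi].
  case: (sqf q) => /=; last by rewrite big1.
  have ui : (up_log 2 q < i.+1)%N by rewrite ltnS; apply: up_log_min.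
  rewrite (bigD1 (Ordinal ui)) //= eqxx big1 ?Rplus_0_r // => k; rewrite -val_eqE /= eq_sym => ne.
  by rewrite (negbTE ne).
rewrite exchange_big; apply: eq_bigr => k _ /=.
rewrite /Hsum /block big_filter -big_mkcond.
have ki : (2 ^ k <= 2 ^ i)%N by rewrite leq_exp2l // -ltnS.
have -> : iota 1 (2 ^ i) = iota 1 (2 ^ k) ++ iota (1 + 2 ^ k) (2 ^ i - 2 ^ k).
  by rewrite -iotaD subnKC.
rewrite big_cat /= [X in _ + X]big_seq_cond [X in _ + X]big1 ?Rplus_0_r //.
move=> q /andP []; rewrite mem_iota add1n => /andP [h _] /andP [_ /eqP e].
by have := up_logP q (isT : 1 < 2)%N; rewrite e leqNgt h.
Qed.

Lemma iota1_sum (N : nat) (F : R -> R) :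
  \rsum_(n <- iota 1 N) F (INR n) = \rsum_(n < N) F (1 + INR n).
Proof.
rewrite -[iota 1 N]/(iota (1 + 0) N) iotaDl big_map iota0E big_mkord.
by apply: eq_bigr => n _; rewrite plus_INR.
Qed.

Section Sift.
Variables (A : nat -> bool) (N : nat) (z : R).

Lemma sifted_gq q n : (0 < q)%N -> INR q <= z ->
  all (fun p => ~~ Om p (n %% p)) (primes_upto z) -> gq Om q n = hq Om q.
Proof.
move=> q0 qz /allP h; apply: eq_big_seq => p; rewrite mem_primes => /and3P [pp _ pq].
have pz : INR p <= z.
  by apply: Rle_trans qz; apply: le_INR; apply/leP; apply: dvdn_leq.
rewrite /gp; have -> // : Om p (n %% p) = false.
apply/negbTE; apply: h; rewrite mem_filter pp /= mem_iota add0n /=.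
apply/andP; split; first by rewrite /Rleb; case: Rle_dec.
apply/ltP; apply: INR_lt; have [h1 _] := archimed z.
have z0 : (0 <= up z)%Z by apply: le_IZR; have := pos_INR p; lra.
by rewrite [X in _ < X]INR_IZR_INZ Z2Nat.id //; lra.
Qed.

(** Positivity: all terms except those of sifted elements are dropped. *)
Lemma sift_large_sieve (g : R -> C) (w : R) :
  (forall n, all (fun p => ~~ Om p (n %% p)) (primes_upto z) -> g (INR n) = RtoC w) ->
  INR (sift N A Om z) * w ^ 2 <= \rsum_(n < N) Cmod (g (1 + INR n)) ^ 2.
Proof.
move=> H; rewrite -(iota1_sum N (fun t => Cmod (g t) ^ 2)) /sift.
elim: (iota 1 N) => [|n s IH]; first by rewrite big_nil /=; lra.
rewrite big_cons.
set P := (fun a => _) in IH *.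
have -> : count P (n :: s) = (P n + count P s)%N by [].
rewrite plus_INR Rmult_plus_distr_r; apply: Rplus_le_compat => //.
case E: (P n); last by change (INR false) with 0; rewrite Rmult_0_l; exact: pow2_ge_0.
move: E; rewrite /P => /andP [_ /H ->]; rewrite Cmod_R RPow_abs Rabs_pos_eq; last exact: pow2_ge_0.
by change (INR true) with 1; rewrite Rmult_1_l; exact: Rle_refl.
Qed.

(** The unweighted form, for the bounded range of [N] where a fixed [Q] is enough. *)
Lemma sift_plain (Q : nat) : (0 < Q)%N -> INR Q <= z -> 0 < Gsum Q ->
  INR (sift N A Om z) * Gsum Q <= INR N + 2 * (INR Q * INR Q).
Proof.
move=> Q0 Qz G0.
have ge1 q : q \in sqfs Q -> (0 < q <= Q)%N.
  by rewrite mem_filter mem_iota add1n ltnS => /andP [].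
have h := sift_large_sieve (trigp (fcoef (fun _ => 1)) fpt (farey (sqfs Q))) (Gsum Q).
have h1 := large_sieve_block (fcoef (fun _ => 1)) fpt (farey (sqfs Q)) Q N 1 Q0 _ _.
rewrite farey_norm ?sqfs_all // in h1.
have e : \rsum_(q <- sqfs Q) (1 ^ 2 * hq Om q) = Gsum Q.
  by apply: eq_bigr => q _; ring.
rewrite e in h1.
apply: (Rmult_le_reg_r (Gsum Q)) => //; rewrite Rmult_assoc.
have -> : Gsum Q * Gsum Q = Gsum Q ^ 2 by ring.
apply: Rle_trans (h _) (h1 _ _).
- move=> n hn; rewrite farey_trigp ?sqfs_all //; congr RtoC; apply: eq_big_seq => q /ge1 /andP [q0 qQ].
  rewrite Rmult_1_l sifted_gq //; apply: Rle_trans Qz; apply: le_INR; exact/leP.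
- by apply: farey_uniq; rewrite filter_uniq ?iota_uniq.
- move=> r s /farey_in [/ge1 r1 r2] /farey_in [/ge1 s1 s2] ne; exact: farey_sep.
Qed.

(** The weights satisfy [(N + c_i) b_i^2 = N b_i], where [c_i] is the cost of block [i]. The right
    side of the large sieve is therefore [N] times the same sum whose square stands on the left, and
    one factor cancels. *)
Lemma sift_weighted (J : nat) (b := fun i => INR N / (INR N + 20 * 4 ^ J * (2 / 3) ^ (J - i))) :
  (0 < N)%N -> 2 ^ J <= z -> 0 < \rsum_(i < J.+1) (b i * Hsum i) ->
  INR (sift N A Om z) * (\rsum_(i < J.+1) (b i * Hsum i)) <= INR N.
Proof.
move=> N0 Jz; have N1 := INR_gt0 N N0; set G := \rsum_(i < J.+1) _ => G0.
pose y q := b (up_log 2 q).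
pose rs i := farey (block i).
have blockP q i : q \in block i -> (0 < q <= 2 ^ i)%N /\ up_log 2 q = i.
  by rewrite mem_filter mem_iota add1n ltnS => /andP [/andP [_ /eqP ->] ->].
have urs i : uniq (rs i) by apply: farey_uniq; rewrite filter_uniq ?iota_uniq.
have seprs i : sep_family fpt (/ (INR (2 ^ i) * INR (2 ^ i))) (rs i).
  move=> r s /farey_in [/blockP [r1 _] r2] /farey_in [/blockP [s1 _] s2] ne; exact: farey_sep.
have sepc i k r s : (i < k)%N -> r \in rs k -> s \in rs i ->
    circ_sep (/ (INR (2 ^ k) * INR (2 ^ i))) (fpt r) (fpt s).
  move=> ik /farey_in [/blockP [r1 r3] r2] /farey_in [/blockP [s1 s3] s2]; apply: farey_sep => //.
  by apply/eqP => e; move: ik; rewrite -r3 -s3 e ltnn.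
have h1 := weighted_large_sieve (fcoef y) fpt rs urs seprs sepc J N 1.
have h := sift_large_sieve (fun t => \csum_(i < J.+1) trigp (fcoef y) fpt (rs i) t) G.
apply: (Rmult_le_reg_r G) => //; rewrite Rmult_assoc.
have -> : G * G = G ^ 2 by ring.
apply: Rle_trans (h _) _.
  move=> n hn; rewrite /G csum_RtoC; apply: eq_bigr => i _.
  rewrite farey_trigp ?block_all //; congr RtoC; rewrite /Hsum big_distrr.
  apply: eq_big_seq => q /blockP [/andP [q0 qi] qe].
  rewrite /y qe sifted_gq //; apply: Rle_trans Jz.
  have -> : 2 ^ J = INR (2 ^ J) by rewrite INR_expn.
  by apply: le_INR; apply/leP; rewrite (leq_trans qi) // leq_exp2l // -ltnS.
apply: Rle_trans h1 _; right; rewrite /G big_distrr; apply: eq_bigr => i _.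
rewrite farey_norm ?block_all //.
have -> : \rsum_(q <- block i) (y q ^ 2 * hq Om q) = b i ^ 2 * Hsum i.
  by rewrite /Hsum big_distrr; apply: eq_big_seq => q /blockP [_ qe]; rewrite /y qe.
rewrite /b.
have h4 : 0 < 4 ^ J by apply: pow_lt; lra.
have h5 : 0 < (2 / 3) ^ (J - i) by apply: pow_lt; lra.
by rewrite [RHS]/=; field; nra.
Qed.
End Sift.
End SieveBound.

(** * Comparison of local factors *)

(* Averages of Phi over random dilations of its argument: by p with probability w, and by
   a geometrically distributed power of p, truncated below exponent K. *)
Definition mix (w : R) (p : nat) (Phi : R -> R) (x : R) : R :=
  (1 - w) * Phi x + w * Phi (x / INR p).
Definition geo (K p : nat) (Phi : R -> R) (x : R) : R :=
  \rsum_(k < K) ((1 - / INR p) * / INR (p ^ k) * Phi (x / INR (p ^ k))).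

Lemma geo_comm K p q Phi : geo K p (geo K q Phi) = geo K q (geo K p Phi).
Proof.
apply: functional_extensionality => x; rewrite /geo.
under eq_bigr => d _ do rewrite big_distrr /=.
rewrite exchange_big; apply: eq_bigr => e _ /=; rewrite big_distrr; apply: eq_bigr => d _ /=.
have -> : x / INR (p ^ d) / INR (q ^ e) = x / INR (q ^ e) / INR (p ^ d) by rewrite /Rdiv; ring.
ring.
Qed.

Lemma geo_mix K p w q Phi : geo K p (mix w q Phi) = mix w q (geo K p Phi).
Proof.
apply: functional_extensionality => x; rewrite /mix {2 3}/geo !big_distrr -big_split.
apply: eq_bigr => d _ /=.
have -> : x / INR (p ^ d) / INR q = x / INR q / INR (p ^ d) by rewrite /Rdiv; ring.
ring.
Qed.

Definition mixes (w : nat -> R) (ps : seq nat) (Phi : R -> R) : R -> R :=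
  foldr (fun p => mix (w p) p) Phi ps.
Definition geos (K : nat) (ps : seq nat) (Phi : R -> R) : R -> R := foldr (geo K) Phi ps.

Lemma geo_mixes K p w ps Phi : geo K p (mixes w ps Phi) = mixes w ps (geo K p Phi).
Proof. by elim: ps => //= q ps IH; rewrite geo_mix IH. Qed.

Lemma geo_geos K p ps Phi : geo K p (geos K ps Phi) = geos K ps (geo K p Phi).
Proof. by elim: ps => //= q ps IH; rewrite geo_comm IH. Qed.

Lemma iter_geo_mixes K p w ps n Phi :
  iter n (geo K p) (mixes w ps Phi) = mixes w ps (iter n (geo K p) Phi).
Proof. by elim: n => //= n ->; rewrite geo_mixes. Qed.

Lemma iter_geo_geos K p ps n Phi :
  iter n (geo K p) (iter n (geos K ps) Phi) = iter n (geos K (p :: ps)) Phi.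
Proof.
elim: n => //= n <-; congr geo.
have H Psi m : iter m (geo K p) (geos K ps Psi) = geos K ps (iter m (geo K p) Psi).
  by elim: m => //= m ->; rewrite geo_geos.
exact: H.
Qed.

Definition nonneg_mono (Phi : R -> R) :=
  (forall x, 0 < x -> 0 <= Phi x) /\ (forall x y, 0 < x <= y -> Phi x <= Phi y).

Lemma INR_ge1 p : (0 < p)%N -> 1 <= INR p.
Proof. by move=> h; rewrite -/(INR 1); apply: le_INR; apply/leP. Qed.

Lemma INR_ge2 p : (1 < p)%N -> 2 <= INR p.
Proof. by move=> /leP /le_INR /=; lra. Qed.

Lemma div_pos_le x p : (0 < p)%N -> 0 < x -> 0 < x / INR p <= x.
Proof.
move=> /INR_ge1 h x0; split; first by apply: Rdiv_lt_0_compat; lra.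
apply: (Rmult_le_reg_r (INR p)); first lra.
by rewrite /Rdiv Rmult_assoc Rinv_l; nra.
Qed.

Lemma div_mono x y p : (0 < p)%N -> 0 < x <= y -> 0 < x / INR p <= y / INR p.
Proof.
move=> /INR_ge1 h [x0 xy]; split; first by apply: Rdiv_lt_0_compat; lra.
by apply: Rmult_le_compat_r => //; apply: Rlt_le; apply: Rinv_0_lt_compat; lra.
Qed.

Lemma mix_good w p Phi : (0 < p)%N -> 0 <= w <= 1 -> nonneg_mono Phi -> nonneg_mono (mix w p Phi).
Proof.
move=> p0 w01 [P0 Pm]; split=> [x x0|x y xy]; rewrite /mix.
  have := P0 x x0; have := P0 _ (proj1 (div_pos_le x p p0 x0)); nra.
have := Pm x y xy; have := Pm _ _ (div_mono x y p p0 xy); nra.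
Qed.

Lemma geo_coef_ge0 p k : (0 < p)%N -> 0 <= (1 - / INR p) * / INR (p ^ k).
Proof.
move=> p0; have h := INR_ge1 p p0.
have pk : (0 < p ^ k)%N by rewrite expn_gt0 p0.
apply: Rmult_le_pos; last by apply: Rlt_le; apply: Rinv_0_lt_compat; exact: INR_gt0.
suff : / INR p <= / 1 by rewrite Rinv_1; lra.
by apply: Rinv_le_contravar; lra.
Qed.

Lemma geo_good K p Phi : (0 < p)%N -> nonneg_mono Phi -> nonneg_mono (geo K p Phi).
Proof.
move=> p0 [P0 Pm]; split=> [x x0|x y xy]; rewrite /geo.
  apply: rsum_ge0 => k _; apply: Rmult_le_pos; first exact: geo_coef_ge0.
  by apply: P0; apply: (proj1 (div_pos_le _ _ _ _)) => //; rewrite expn_gt0 p0.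
apply: rsum_le => k _; apply: Rmult_le_compat_l; first exact: geo_coef_ge0.
by apply: Pm; apply: div_mono => //; rewrite expn_gt0 p0.
Qed.

(** Every nontrivial power of [p] is replaced by [p] itself, which can only increase [Phi];
    truncation leaves these powers a total mass of at most [1/p]. *)
Lemma geo_le K p Phi x : prime p -> nonneg_mono Phi -> 0 < x ->
  geo K p Phi x <= (1 - / INR p) * Phi x + / INR p * Phi (x / INR p).
Proof.
move=> pp [P0 Pm] x0; have p0 := prime_gt0 pp.
have p2 : 2 <= INR p by apply: INR_ge2; exact: prime_gt1.
have i0 : 0 < / INR p by apply: Rinv_0_lt_compat; lra.
have i1 : / INR p <= / 2 by apply: Rinv_le_contravar; lra.
have [y0 _] := div_pos_le x p p0 x0.
have q0 := P0 _ y0; have q1 := P0 x x0.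
case: K => [|K].
  rewrite /geo big_ord0; apply: Rplus_le_le_0_compat; apply: Rmult_le_pos; lra.
rewrite /geo big_ord_recl; apply: Rplus_le_compat.
  by rewrite /= Rinv_1 Rmult_1_r /Rdiv Rinv_1 Rmult_1_r; exact: Rle_refl.
apply: (@Rle_trans _ (\rsum_(k < K) ((1 - / INR p) * / INR (p ^ k.+1) * Phi (x / INR p)))).
  apply: rsum_le => k _; apply: Rmult_le_compat_l; first exact: geo_coef_ge0.
  apply: Pm; rewrite /=.
  have -> : x / INR (p ^ k.+1) = x / INR p / INR (p ^ k).
    have pk : 0 < INR (p ^ k) by apply: INR_gt0; rewrite expn_gt0 p0.
    by rewrite expnS mult_INR; field; lra.
  by apply: div_pos_le => //; rewrite expn_gt0 p0.
rewrite -big_distrl; apply: Rmult_le_compat_r => //=.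
suff -> : \rsum_(k < K) ((1 - / INR p) * / INR (p ^ k.+1)) = / INR p - / INR (p ^ K.+1).
  by have := Rinv_0_lt_compat _ (INR_gt0 (p ^ K.+1) _); rewrite expn_gt0 p0 => /(_ isT); lra.
elim: {y0 q0 q1} K => [|K IH]; first by rewrite big_ord0 expn1; lra.
rewrite (rsum_recr _ (fun k => (1 - / INR p) * / INR (p ^ k.+1))) IH.
rewrite [in X in _ = _ - / INR X]expnS mult_INR Rinv_mult; lra.
Qed.

Lemma iter_geo_good K p n Phi : (0 < p)%N -> nonneg_mono Phi -> nonneg_mono (iter n (geo K p) Phi).
Proof. by move=> p0 h; elim: n => //= n; exact: geo_good. Qed.

(** All [n] dilations are trivial with probability [(1 - 1/p)^n]; otherwise the argument is divided
    at least by [p]. *)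
Lemma iter_geo_le K p n Phi x : prime p -> nonneg_mono Phi -> 0 < x ->
  iter n (geo K p) Phi x <=
  (1 - / INR p) ^ n * Phi x + (1 - (1 - / INR p) ^ n) * Phi (x / INR p).
Proof.
move=> pp hP x0; have p0 := prime_gt0 pp.
have p2 : 2 <= INR p by apply: INR_ge2; exact: prime_gt1.
have i0 : 0 < / INR p by apply: Rinv_0_lt_compat; lra.
have i1 : / INR p <= / 2 by apply: Rinv_le_contravar; lra.
have sub m y : 0 < y -> iter m (geo K p) Phi y <= Phi y.
  elim: m y => [|m IH] y y0; first by exact: Rle_refl.
  apply: Rle_trans (geo_le _ _ _ _ pp (iter_geo_good K p m Phi p0 hP) y0) _.
  have [z0 zy] := div_pos_le y p p0 y0.
  have := IH y y0; have := IH _ z0; have := proj2 hP _ _ (conj z0 zy).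
  move=> h1 h2 h3.
  have h4 : (1 - / INR p) * iter m (geo K p) Phi y <= (1 - / INR p) * Phi y.
    by apply: Rmult_le_compat_l; lra.
  have h5 : / INR p * iter m (geo K p) Phi (y / INR p) <= / INR p * Phi y.
    by apply: Rmult_le_compat_l; lra.
  lra.
have [z0 zx] := div_pos_le x p p0 x0.
elim: n => [|n IH]; first by rewrite /=; lra.
apply: Rle_trans (geo_le _ _ _ _ pp (iter_geo_good K p n Phi p0 hP) x0) _.
have h1 := sub n _ z0; rewrite -[_ ^ n.+1]/((1 - / INR p) * (1 - / INR p) ^ n).
set t := (1 - / INR p) ^ n in IH *.
have h2 : (1 - / INR p) * iter n (geo K p) Phi x <=
  (1 - / INR p) * (t * Phi x + (1 - t) * Phi (x / INR p)) by apply: Rmult_le_compat_l; lra.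
have h3 : / INR p * iter n (geo K p) Phi (x / INR p) <= / INR p * Phi (x / INR p).
  by apply: Rmult_le_compat_l; lra.
lra.
Qed.

(* The two random dilations are stochastically ordered because the left one is trivial with
   the smaller probability. *)
Lemma mix_geo_le K p n Phi eps w x : prime p -> nonneg_mono Phi -> 0 < x ->
  0 <= eps <= 1 -> (1 - / INR p) ^ n * (1 - eps) <= 1 - w ->
  mix eps p (iter n (geo K p) Phi) x <= mix w p Phi x.
Proof.
move=> pp hP x0 he hw; have p0 := prime_gt0 pp; rewrite /mix.
have [z0 zx] := div_pos_le x p p0 x0.
have m1 := proj2 hP _ _ (conj z0 zx).
have h1 := iter_geo_le K p n Phi x pp hP x0.
have h2 := iter_geo_le K p n Phi _ pp hP z0.
have [z1 zz] := div_pos_le _ p p0 z0.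
have m2 := proj2 hP _ _ (conj z1 zz).
set t := (1 - / INR p) ^ n in h1 h2 hw.
have t0 : 0 <= t.
  apply: pow_le; suff : / INR p <= / 1 by rewrite Rinv_1; lra.
  by apply: Rinv_le_contravar; [lra | exact: INR_ge1].
have t1 : t <= 1.
  rewrite -[X in _ <= X](pow1 n); apply: pow_incr; split; last first.
    by have := Rinv_0_lt_compat _ (INR_gt0 p p0); lra.
  suff : / INR p <= / 1 by rewrite Rinv_1; lra.
  by apply: Rinv_le_contravar; [lra | exact: INR_ge1].
have h3 : iter n (geo K p) Phi (x / INR p) <= Phi (x / INR p).
  by apply: Rle_trans h2 _; nra.
have h4 : (1 - eps) * iter n (geo K p) Phi x <= (1 - eps) * (t * Phi x + (1 - t) * Phi (x / INR p)).
  by apply: Rmult_le_compat_l; lra.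
have h5 : eps * iter n (geo K p) Phi (x / INR p) <= eps * Phi (x / INR p).
  by apply: Rmult_le_compat_l; lra.
have h6 : 0 <= (1 - w - t * (1 - eps)) * (Phi x - Phi (x / INR p)).
  by apply: Rmult_le_pos; lra.
lra.
Qed.

Lemma mix_le w p Phi Psi X : (0 < p)%N -> 0 <= w <= 1 ->
  (forall x, 0 < x <= X -> Phi x <= Psi x) ->
  forall x, 0 < x <= X -> mix w p Phi x <= mix w p Psi x.
Proof.
move=> p0 hw H x [x0 xX]; have [z0 zx] := div_pos_le x p p0 x0.
have h1 := H x (conj x0 xX); have h2 := H (x / INR p) (conj z0 (Rle_trans _ _ _ zx xX)).
by rewrite /mix; apply: Rplus_le_compat; apply: Rmult_le_compat_l; lra.
Qed.

Lemma mixes_le w ps Phi Psi X : {in ps, forall p, (0 < p)%N /\ 0 <= w p <= 1} ->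
  (forall x, 0 < x <= X -> Phi x <= Psi x) ->
  forall x, 0 < x <= X -> mixes w ps Phi x <= mixes w ps Psi x.
Proof.
elim: ps => [|p ps IH] //= hw H.
have [p0 wp] := hw p (mem_head _ _).
by apply: mix_le => //; apply: IH => // q qps; apply: hw; rewrite inE qps orbT.
Qed.

Lemma mixes_good w ps Phi : {in ps, forall p, (0 < p)%N /\ 0 <= w p <= 1} ->
  nonneg_mono Phi -> nonneg_mono (mixes w ps Phi).
Proof.
elim: ps => [|p ps IH] //= hw H.
have [p0 wp] := hw p (mem_head _ _).
by apply: mix_good => //; apply: IH => // q qps; apply: hw; rewrite inE qps orbT.
Qed.

Lemma geos_good K ps Phi : {in ps, forall p, (0 < p)%N} ->
  nonneg_mono Phi -> nonneg_mono (geos K ps Phi).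
Proof.
elim: ps => [|p ps IH] //= hw H.
apply: geo_good; first by apply: hw; exact: mem_head.
by apply: IH => // q qps; apply: hw; rewrite inE qps orbT.
Qed.

Lemma iter_geos_good K ps n Phi : {in ps, forall p, (0 < p)%N} ->
  nonneg_mono Phi -> nonneg_mono (iter n (geos K ps) Phi).
Proof. by move=> hp H; elim: n => //= n; exact: geos_good. Qed.

Lemma mixes_geos_le K ps n Phi (eps w : nat -> R) x :
  {in ps, forall p, [/\ prime p, 0 <= eps p <= 1, 0 <= w p <= 1 &
     (1 - / INR p) ^ n * (1 - eps p) <= 1 - w p]} ->
  nonneg_mono Phi -> 0 < x ->
  mixes eps ps (iter n (geos K ps) Phi) x <= mixes w ps Phi x.
Proof.
move=> H hP; elim: ps H x => [|p ps IH] H x x0.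
  by rewrite /=; elim: n {H} => [|n IHn]; [exact: Rle_refl|].
have H' : {in ps, forall p, [/\ prime p, 0 <= eps p <= 1, 0 <= w p <= 1 &
     (1 - / INR p) ^ n * (1 - eps p) <= 1 - w p]}.
  by move=> q qps; apply: H; rewrite inE qps orbT.
have [pp he hw hh] := H p (mem_head _ _).
have He : {in ps, forall p, (0 < p)%N /\ 0 <= eps p <= 1}.
  by move=> q /H' [/prime_gt0].
have Hp : {in ps, forall p, (0 < p)%N} by move=> q /He [].
(* By commutation the [n] operators [geo K p] move next to [mix (eps p) p], where the comparison at
   the single prime [p] applies. *)
rewrite -iter_geo_geos /= -iter_geo_mixes.
apply: (@Rle_trans _ (mix (w p) p (mixes eps ps (iter n (geos K ps) Phi)) x)).
  by apply: mix_geo_le => //; apply: mixes_good => //; exact: iter_geos_good.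
apply: (mix_le _ _ _ _ x) => //; first exact: prime_gt0.
  by move=> y [y0 _]; exact: IH.
by split=> //; exact: Rle_refl.
Qed.

(** * Divisor sums *)

Definition prime_support (ps : seq nat) (n : nat) := all (fun p => p \in ps) (primes n).

Lemma prime_support_part p ps n : prime p -> (0 < n)%N -> prime_support (p :: ps) n ->
  prime_support ps (n %/ p ^ logn p n).
Proof.
move=> pp n0 /allP h; apply/allP => r.
have d0 : (0 < n %/ p ^ logn p n)%N by rewrite divn_gt0 ?expn_gt0 ?prime_gt0 // dvdn_leq // pfactor_dvdnn.
have nd : ~~ (p %| n %/ p ^ logn p n)%N.
  rewrite -p_part; apply/negP => pd; have := logn_gt0 p (n %/ n`_p).
  rewrite mem_primes pp pd andbT p_part d0 logn_div ?pfactor_dvdnn // pfactorK // subnn.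
  by [].
rewrite mem_primes => /and3P [pr _ rd].
have : r \in p :: ps.
  by apply: h; rewrite mem_primes pr n0 (dvdn_trans rd) // dvdn_div // pfactor_dvdnn.
rewrite inE => /orP [/eqP e|//]; by rewrite e in rd; rewrite rd in nd.
Qed.

Definition hsum (X : nat) (Phi : R -> R) (x : R) : R :=
  \rsum_(n <- iota 1 X) (/ INR n * Phi (x / INR n)).

Definition hsum_over (X : nat) ps (Phi : R -> R) (x : R) : R :=
  \rsum_(n <- iota 1 X | prime_support ps n) (/ INR n * Phi (x / INR n)).

Lemma inv_INR_ge0 n : 0 <= / INR n.
Proof.
case: (posnP n) => [->|/INR_gt0 h]; first by rewrite /= Rinv_0; lra.
by apply: Rlt_le; apply: Rinv_0_lt_compat.
Qed.

(** The [n] are sorted by their exponent [k] at [p]. For fixed [k] the cofactors [n / p^k] are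
    distinct [ps]-supported numbers up to [X]; allowing all such numbers only adds nonnegative
    terms. *)
Lemma hsum_over_cons X p ps Phi x : prime p -> nonneg_mono Phi -> 0 < x ->
  hsum_over X (p :: ps) Phi x <=
  \rsum_(k < X.+1) (/ INR (p ^ k) * hsum_over X ps Phi (x / INR (p ^ k))).
Proof.
move=> pp [P0 _] x0; have p0 := prime_gt0 pp.
have -> : hsum_over X (p :: ps) Phi x = \rsum_(k < X.+1)
   \rsum_(n <- iota 1 X | prime_support (p :: ps) n && (logn p n == k)) (/ INR n * Phi (x / INR n)).
  rewrite /hsum_over big_mkcond /=.
  rewrite (eq_big_seq (fun n => \rsum_(k < X.+1) (if prime_support (p :: ps) n && (logn p n == k) then / INR n * Phi (x / INR n) else 0))); last first.
    move=> n; rewrite mem_iota add1n ltnS => /andP [n0 nX].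
    case: (prime_support _ n) => /=; last by rewrite big1.
    have ln : (logn p n < X.+1)%N by rewrite ltnW // ltnS (leq_trans (ltn_logl p n0)).
    rewrite (bigD1 (Ordinal ln)) //= eqxx big1 ?Rplus_0_r // => k; rewrite -val_eqE /= eq_sym => ne.
    by rewrite (negbTE ne).
  by rewrite exchange_big; apply: eq_bigr => k _ /=; rewrite -big_mkcond.
apply: rsum_le => k _; have pk : (0 < p ^ k)%N by rewrite expn_gt0 p0.
have pk' := INR_gt0 _ pk.
rewrite /hsum_over big_distrr -big_filter -[X in _ <= X]big_filter.
set L := [seq n <- _ | _]; set L' := [seq n <- _ | prime_support ps n].
have LP n : n \in L -> [/\ (0 < n <= X)%N, prime_support (p :: ps) n, logn p n = k & n = (p ^ k * (n %/ p ^ k))%N].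
  rewrite mem_filter mem_iota add1n ltnS => /andP [/andP [o /eqP l] h]; split=> //.
  by rewrite mulnC divnK // -l pfactor_dvdnn.
have -> : \rsum_(n <- L) (/ INR n * Phi (x / INR n)) =
   \rsum_(m <- [seq n %/ p ^ k | n <- L]) (/ INR (p ^ k) * (/ INR m * Phi (x / INR (p ^ k) / INR m))).
  rewrite big_map; apply: eq_big_seq => n /LP [/andP [n0 _] _ _ e].
  have eR : INR n = INR (p ^ k) * INR (n %/ p ^ k) by rewrite [in LHS]e mult_INR.
  have n0' := INR_gt0 _ n0; rewrite eR in n0' *.
  rewrite -Rmult_assoc -Rinv_mult; congr (_ * Phi _).
  by field; nra.
apply: rsum_sub.
- rewrite map_inj_in_uniq ?filter_uniq ?iota_uniq // => m n /LP [_ _ _ em] /LP [_ _ _ en] e.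
  by rewrite em en e.
- by rewrite filter_uniq ?iota_uniq.
- move=> m /mapP [n /LP [/andP [n0 nX] o l e] ->].
  rewrite mem_filter -{1}l prime_support_part //= mem_iota add1n ltnS.
  rewrite (leq_trans (leq_div _ _)) // andbT divn_gt0 //.
  by rewrite dvdn_leq // -l pfactor_dvdnn.
- move=> m _; apply: Rmult_le_pos; first exact: inv_INR_ge0.
  case: (posnP m) => [->|m0]; first by rewrite /= Rinv_0 Rmult_0_l; lra.
  apply: Rmult_le_pos; first exact: inv_INR_ge0.
  by apply: P0; apply: Rdiv_lt_0_compat; [apply: Rdiv_lt_0_compat | exact: INR_gt0].
Qed.

Definition pprod (f : nat -> R) (ps : seq nat) : R := \rprod_(p <- ps) f p.

Lemma pprod_ge0 f ps : {in ps, forall p, 0 <= f p} -> 0 <= pprod f ps.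
Proof.
move=> H; rewrite /pprod big_seq; elim/big_ind: _ => //; first lra.
by move=> a b; exact: Rmult_le_pos.
Qed.

Lemma pprod_gt0 f ps : {in ps, forall p, 0 < f p} -> 0 < pprod f ps.
Proof.
move=> H; rewrite /pprod big_seq; elim/big_ind: _ => //; first lra.
by move=> a b; exact: Rmult_lt_0_compat.
Qed.

Lemma prime_inv_bound p : prime p -> 0 < / INR p <= / 2.
Proof.
move=> pp; have h := INR_ge2 p (prime_gt1 pp).
by split; [apply: Rinv_0_lt_compat | apply: Rinv_le_contravar]; lra.
Qed.

(** The Euler product: the expanded geometric series contain every [1/n]. Exponents up to [X]
    suffice since [logn p n < n <= X]. *)
Lemma geos_over X ps Phi x : {in ps, forall p, prime p} -> nonneg_mono Phi -> 0 < x ->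
  pprod (fun p => 1 - / INR p) ps * hsum_over X ps Phi x <= geos X.+1 ps Phi x.
Proof.
move=> H hP; elim: ps H x => [|p ps IH] H x x0.
  rewrite /pprod big_nil Rmult_1_l /= /hsum_over.
  rewrite big_mkcond /= big_seq (eq_bigr (fun n => if n == 1%N then Phi x else 0)); last first.
    move=> n; rewrite mem_iota add1n ltnS => /andP [n0 _].
    case: eqP => [->|/eqP n1]; first by rewrite /= Rinv_1 Rdiv_1_r Rmult_1_l.
    rewrite ifF // /prime_support; apply/negbTE; apply/allPn; exists (pdiv n) => //.
    by rewrite mem_primes n0 pdiv_dvd pdiv_prime // ltn_neqAle eq_sym n1.
  rewrite -big_seq; case: X => [|X]; first by rewrite big_nil; exact: (proj1 hP).
  rewrite big_cons eqxx big_seq big1 ?Rplus_0_r; first exact: Rle_refl.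
  by move=> n; rewrite mem_iota => /andP [h _]; rewrite gtn_eqF.
have H' : {in ps, forall p, prime p} by move=> q qps; apply: H; rewrite inE qps orbT.
have pp := H p (mem_head _ _); have [i0 i1] := prime_inv_bound p pp.
have p0 := prime_gt0 pp.
have c0 : 0 <= pprod (fun p => 1 - / INR p) ps.
  by apply: pprod_ge0 => q /H' /prime_inv_bound; lra.
rewrite /pprod big_cons -/(pprod _ ps).
apply: (@Rle_trans _ ((1 - / INR p) * pprod (fun p => 1 - / INR p) ps *
   (\rsum_(k < X.+1) (/ INR (p ^ k) * hsum_over X ps Phi (x / INR (p ^ k)))))).
  apply: Rmult_le_compat_l; last exact: hsum_over_cons.
  by apply: Rmult_le_pos; lra.
rewrite big_distrr /= /geo; apply: rsum_le => k _.
have pk : (0 < p ^ k)%N by rewrite expn_gt0 p0.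
have [z0 _] := div_pos_le x _ pk x0.
have := geo_coef_ge0 p k p0; have := IH H' _ z0.
set a := hsum_over _ _ _ _; set b := geos _ _ _ _; set c := pprod _ _ => h1 h2.
have := Rmult_le_compat_l _ _ _ h2 h1; lra.
Qed.

Lemma hsum_over_full X ps Phi x :
  (forall p, prime p -> (p <= X)%N -> p \in ps) -> hsum_over X ps Phi x = hsum X Phi x.
Proof.
move=> H; rewrite /hsum_over /hsum big_seq_cond [RHS]big_seq; apply: eq_bigl => n.
case E: (n \in iota 1 X) => //=.
move: E; rewrite mem_iota add1n ltnS => /andP [n0 nX]; apply/allP => p; rewrite mem_primes => /and3P [pp _ pn].
by apply: H => //; rewrite (leq_trans _ nX) // dvdn_leq.
Qed.

Lemma hsum_le X Y Phi Psi : (forall x, 0 < x <= Y -> Phi x <= Psi x) ->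
  forall x, 0 < x <= Y -> hsum X Phi x <= hsum X Psi x.
Proof.
move=> H x [x0 xY]; apply: rsum_le_seq => n; rewrite mem_iota => /andP [n0 _].
have [z0 zx] := div_pos_le x n n0 x0.
by apply: Rmult_le_compat_l; [exact: inv_INR_ge0 | apply: H; lra].
Qed.

Lemma iter_geos_ge X ps k Phi x : {in ps, forall p, prime p} ->
  (forall p, prime p -> (p <= X)%N -> p \in ps) -> nonneg_mono Phi -> 0 < x ->
  pprod (fun p => 1 - / INR p) ps ^ k * iter k (hsum X) Phi x <= iter k (geos X.+1 ps) Phi x.
Proof.
move=> H Hf hP; set c := pprod _ ps.
have c0 : 0 <= c by apply: pprod_ge0 => q /H /prime_inv_bound; lra.
have Hp : {in ps, forall p, (0 < p)%N} by move=> q /H /prime_gt0.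
elim: k x => [|k IH] x x0; first by rewrite /= Rmult_1_l; exact: Rle_refl.
rewrite /= Rmult_assoc.
apply: Rle_trans (geos_over X ps _ x H (iter_geos_good _ _ k _ Hp hP) x0).
rewrite hsum_over_full //; apply: Rmult_le_compat_l => //.
rewrite {1 3}/hsum big_distrr; apply: rsum_le_seq => n; rewrite mem_iota => /andP [n0 _] /=.
have [z0 _] := div_pos_le x n n0 x0.
by apply: Rle_trans _ (Rmult_le_compat_l _ _ _ (inv_INR_ge0 n) (IH _ z0)); right; ring.
Qed.

(** * Iterated harmonic sums against powers of the logarithm *)

Definition ind1 (x : R) : R := if Rle_dec 1 x then 1 else 0.
(** Exponent 0 is separate because [0 ^ 0 = 1], whereas the iteration must start from a function
    vanishing below 1. *)
Definition lnpow (k : nat) (x : R) : R :=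
  if k is 0 then ind1 x else Rmax (ln x) 0 ^ k / INR k`!.

Lemma ind1_good : nonneg_mono ind1.
Proof.
split=> [x _|x y [_ xy]]; rewrite /ind1; case: Rle_dec => h /=; try lra.
by case: Rle_dec => h' /=; lra.
by case: Rle_dec => h' /=; lra.
Qed.

Lemma pow_sub_le (a b : R) k : 0 <= b <= a -> a ^ k.+1 - b ^ k.+1 <= INR k.+1 * (a - b) * a ^ k.
Proof.
move=> [b0 ba]; elim: k => [|k IH]; first by rewrite /=; lra.
have a0 : 0 <= a ^ k by apply: pow_le; lra.
have h : b * (a ^ k.+1 - b ^ k.+1) <= b * (INR k.+1 * (a - b) * a ^ k).
  by apply: Rmult_le_compat_l.
have k0 := pos_INR k.+1.
have h2 : 0 <= INR k.+1 * (a - b) * a ^ k * (a - b).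
  by apply: Rmult_le_pos; [apply: Rmult_le_pos => //; apply: Rmult_le_pos; lra | lra].
rewrite (S_INR k.+1) -[a ^ k.+2]/(a * a ^ k.+1) -[b ^ k.+2]/(b * b ^ k.+1).
rewrite -[a ^ k.+1]/(a * a ^ k) in h *; lra.
Qed.

Lemma INR_fact k : 0 < INR k`!.
Proof. by apply: INR_gt0; rewrite fact_gt0. Qed.

(** Mean value bound: in the variable [ln], the derivative of [lnpow k.+1] is [lnpow k], largest at
    the upper end [x / n], and [ln (n+1) - ln n <= 1/n]. *)
Lemma lnpow_step k (n : nat) x : (0 < n)%N -> 0 < x ->
  lnpow k.+1 (x / INR n) - lnpow k.+1 (x / INR n.+1) <= / INR n * lnpow k (x / INR n).
Proof.
move=> n0 x0; have n1 := INR_gt0 n n0; have n2 : 0 < INR n.+1 by exact: INR_gt0.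
have en : INR n.+1 = INR n + 1 by rewrite S_INR.
have hln : ln (INR n.+1) - ln (INR n) <= / INR n.
  rewrite -ln_div //.
  have -> : INR n.+1 / INR n = 1 + / INR n by rewrite en; field; lra.
  have i0 := Rinv_0_lt_compat _ n1.
  rewrite -[X in _ <= X]ln_exp; apply: Rlt_le; apply: ln_increasing; first lra.
  by apply: exp_ineq1; lra.
have hln0 : ln (INR n) <= ln (INR n.+1) by apply: Rlt_le; apply: ln_increasing; lra.
set a := ln x - ln (INR n); set b := ln x - ln (INR n.+1).
have ab : a - b <= / INR n by rewrite /a /b; lra.
have ba : b <= a by rewrite /a /b; lra.
have i0 := Rinv_0_lt_compat _ n1.
have hab : Rmax a 0 - Rmax b 0 <= / INR n by rewrite /Rmax; do 2!case: Rle_dec => ? /=; lra.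
have hba : 0 <= Rmax b 0 <= Rmax a 0 by rewrite /Rmax; do 2!case: Rle_dec => ? /=; lra.
rewrite /lnpow !ln_div // -/a -/b.
have e : (Rmax a 0 ^ k.+1 / INR (k.+1)`! - Rmax b 0 ^ k.+1 / INR (k.+1)`!) <=
  / INR n * (Rmax a 0 ^ k / INR k`!).
  have h := pow_sub_le _ _ k hba.
  have f0 := INR_fact k; have k0 : 0 < INR k.+1 by exact: INR_gt0.
  rewrite factS mult_INR.
  have p0 : 0 <= Rmax a 0 ^ k by apply: pow_le; lra.
  have g0 : 0 < / (INR k.+1 * INR k`!) by apply: Rinv_0_lt_compat; apply: Rmult_lt_0_compat.
  apply: (@Rle_trans _ (INR k.+1 * (Rmax a 0 - Rmax b 0) * Rmax a 0 ^ k * / (INR k.+1 * INR k`!))).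
    rewrite /Rdiv -Rmult_minus_distr_r; apply: Rmult_le_compat_r; lra.
  have -> : INR k.+1 * (Rmax a 0 - Rmax b 0) * Rmax a 0 ^ k * / (INR k.+1 * INR k`!) =
    (Rmax a 0 - Rmax b 0) * (Rmax a 0 ^ k / INR k`!) by field; lra.
  apply: Rmult_le_compat_r hab.
  by apply: Rmult_le_pos => //; apply: Rlt_le; apply: Rinv_0_lt_compat.
case: k e => [|k] // e.
rewrite /ind1; case: Rle_dec => h; first by move: e; rewrite /=; lra.
have a0 : a <= 0.
  rewrite /a -ln_div //; rewrite -ln_1; case: (Rle_lt_dec (ln (x / INR n)) (ln 1)) => // h'.
  exfalso; apply: h; apply: Rlt_le; apply: ln_lt_inv => //; first lra.
  by apply: Rdiv_lt_0_compat.
rewrite !Rmax_right; [rewrite /= | |]; lra.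
Qed.

(** The steps telescope, and the last term vanishes because [x < X + 1]. *)
Lemma hsum_lnpow X k x : 0 < x <= INR X -> lnpow k.+1 x <= hsum X (lnpow k) x.
Proof.
move=> [x0 xX].
suff H m : lnpow k.+1 x - lnpow k.+1 (x / INR m.+1) <= hsum m (lnpow k) x.
  have e : lnpow k.+1 (x / INR X.+1) = 0.
    have X0 : 0 < INR X.+1 by exact: INR_gt0.
    rewrite /lnpow Rmax_right ?pow_ne_zero //; first by rewrite /Rdiv Rmult_0_l.
    rewrite ln_div //; suff : ln x <= ln (INR X.+1) by lra.
    by apply: Rlt_le; apply: ln_increasing => //; rewrite S_INR; lra.
  have := H X; rewrite e; lra.
elim: m => [|m IH].
  by rewrite /hsum big_nil [INR 1]/= Rdiv_1_r; lra.
have -> : hsum m.+1 (lnpow k) x = hsum m (lnpow k) x + / INR m.+1 * lnpow k (x / INR m.+1).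
  have e : iota 1 m.+1 = iota 1 m ++ [:: m.+1] by rewrite -(addn1 m) iotaD /= addn1.
  by rewrite /hsum e big_cat big_cons big_nil /= Rplus_0_r.
have := lnpow_step k m.+1 x isT x0; lra.
Qed.

Lemma iter_hsum_lnpow X k x : 0 < x <= INR X -> lnpow k x <= iter k (hsum X) ind1 x.
Proof.
elim: k x => [|k IH] x hx; first exact: Rle_refl.
apply: Rle_trans (hsum_lnpow X k x hx) _.
by rewrite /=; apply: (hsum_le X (INR X)) hx; exact: IH.
Qed.

(** * Lower bound for the sieve sum *)

(** An average of an affine function of [ln] sees only the mean of the log-dilation. Applied to a
    supporting line of a convex function this is Jensen's inequality. *)
Lemma mixes_affine eps ps (al be x : R) : {in ps, forall p, (0 < p)%N} -> 0 < x ->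
  mixes eps ps (fun y => al + be * ln y) x =
  al + be * (ln x - \rsum_(p <- ps) (eps p * ln (INR p))).
Proof.
elim: ps x => [|p ps IH] x H x0; first by rewrite big_nil /=; ring.
have p0 := H p (mem_head _ _); have p1 := INR_gt0 p p0.
have H' : {in ps, forall p, (0 < p)%N} by move=> q qps; apply: H; rewrite inE qps orbT.
have z0 : 0 < x / INR p by apply: Rdiv_lt_0_compat.
rewrite /= /mix (IH x H' x0) (IH _ H' z0) ln_div // big_cons.
set S := \big[_/_]_(_ <- _) _; rewrite /=; ring.
Qed.

Lemma mixes_scal eps ps (c : R) Phi x :
  mixes eps ps (fun y => c * Phi y) x = c * mixes eps ps Phi x.
Proof. by elim: ps x => [|p ps IH] x //=; rewrite /mix !IH; ring. Qed.

(** Only the event that all dilations are trivial is kept. For small [x] this loses less than the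
    shift by [E]. *)
Lemma mixes_ge_head eps ps Phi x : {in ps, forall p, (0 < p)%N /\ 0 <= eps p <= 1} ->
  (forall y, 0 < y -> 0 <= Phi y) -> 0 < x ->
  pprod (fun p => 1 - eps p) ps * Phi x <= mixes eps ps Phi x /\ 0 <= mixes eps ps Phi x.
Proof.
move=> H P0; elim: ps H x => [|p ps IH] H x x0.
  by rewrite /pprod big_nil Rmult_1_l /=; split; [exact: Rle_refl | exact: P0].
have [p0 e01] := H p (mem_head _ _).
have H' : {in ps, forall p, (0 < p)%N /\ 0 <= eps p <= 1}.
  by move=> q qps; apply: H; rewrite inE qps orbT.
have [z0 _] := div_pos_le x p p0 x0.
have [h1 h2] := IH H' x x0; have [_ h3] := IH H' _ z0.
rewrite /pprod big_cons -/(pprod _ ps) /= /mix Rmult_assoc.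
have h4 := Rmult_le_compat_l (1 - eps p) _ _ ltac:(lra) h1.
have h5 : 0 <= eps p * mixes eps ps Phi (x / INR p) by apply: Rmult_le_pos; lra.
have h6 : 0 <= (1 - eps p) * mixes eps ps Phi x by apply: Rmult_le_pos; lra.
by rewrite /= in h4 *; lra.
Qed.

Section Lower.
Variable (Om : nat -> nat -> bool).
Hypothesis om_lt : forall p, prime p -> (omega Om p < p)%N.
Let w (p : nat) : R := INR (omega Om p) / INR p.

Lemma w_bound p : prime p -> 0 <= w p < 1.
Proof.
move=> pp; have h := om_lt_R Om om_lt p pp; have p1 := INR_gt0 p (prime_gt0 pp).
have o0 := pos_INR (omega Om p); rewrite /w; split.
  by apply: Rmult_le_pos => //; apply: Rlt_le; apply: Rinv_0_lt_compat.
by apply: (Rmult_lt_reg_r (INR p)) => //; rewrite /Rdiv Rmult_assoc Rinv_l; lra.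
Qed.

Definition qsum (X : nat) ps (x : R) : R :=
  \rsum_(q <- iota 1 X | sqf q && prime_support ps q) (hq Om q * ind1 (x / INR q)).

Lemma ind1_ge0 x : 0 <= ind1 x.
Proof. by rewrite /ind1; case: Rle_dec => h /=; lra. Qed.

Lemma qsum_cons X p ps x : prime p -> p \notin ps -> 0 < x <= INR X ->
  qsum X ps x + hp Om p * qsum X ps (x / INR p) <= qsum X (p :: ps) x.
Proof.
move=> pp nps [x0 xX]; have p0 := prime_gt0 pp; have p1 := INR_gt0 p p0.
have hge q : 0 <= hq Om q by exact: hq_ge0.
have nd q : (0 < q)%N -> prime_support ps q -> ~~ (p %| q)%N.
  move=> q0 /allP h; apply/negP => pq; move: nps; rewrite h //.
  by rewrite mem_primes pp q0 pq.
rewrite {3}/qsum (bigID (fun q => (p %| q)%N)) /= Rplus_comm.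
apply: Rplus_le_compat.
  rewrite /qsum big_distrr /= -big_filter -[X in _ <= X]big_filter.
  apply: (@Rle_trans _ (\rsum_(q <- [seq q <- iota 1 X | [&& sqf q, prime_support ps q & (p * q <= X)%N]])
     (hq Om (p * q) * ind1 (x / INR (p * q))))).
    rewrite !big_filter big_mkcond [X in _ <= X]big_mkcond /=; apply: rsum_le_seq => q.
    rewrite mem_iota add1n ltnS => /andP [q0 qX].
    case sq : (sqf q) => /=; last exact: Rle_refl.
    case ov : (prime_support ps q) => /=; last exact: Rle_refl.
    have q1 := INR_gt0 q q0.
    have ex : x / INR p / INR q = x / INR (p * q) by rewrite mult_INR; field; lra.
    rewrite ex hq_mul ?nd // Rmult_assoc.
    case: ifP => [_|]; first exact: Rle_refl.
    (* Here [p q > X >= x], so the indicator on the left is 0. *)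
    move/negbT; rewrite -ltnNge => lt; right.
    rewrite /ind1; case: Rle_dec => h /=; last by ring.
    exfalso; have pq0 : 0 < INR (p * q) by apply: INR_gt0; rewrite muln_gt0 p0.
    have : INR (p * q) <= x.
      have := Rmult_le_compat_r _ _ _ (Rlt_le _ _ pq0) h.
      by rewrite /Rdiv Rmult_assoc Rinv_l; lra.
    by move/ltP/lt_INR: lt; lra.
  rewrite -(big_map (fun q => p * q)%N xpredT (fun q => hq Om q * ind1 (x / INR q))).
  apply: rsum_sub.
  - rewrite map_inj_uniq ?filter_uniq ?iota_uniq // => a b /eqP.
    by rewrite eqn_pmul2l // => /eqP.
  - by rewrite filter_uniq ?iota_uniq.
  - move=> m /mapP [q]; rewrite mem_filter mem_iota => /andP [/and3P [sq ov le] /andP [q0 _]] ->.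
    rewrite mem_filter mem_iota add1n ltnS le muln_gt0 p0 q0 /= dvdn_mulr // !andbT.
    rewrite (sqf_mul p) ?nd // sq /=; apply/allP => r.
    rewrite (perm_mem (primes_mul_prime _ _ pp q0 (nd q q0 ov))) !inE.
    by case/orP => [->//|rq]; rewrite (allP ov r rq) orbT.
  - by move=> m _; apply: Rmult_le_pos => //; exact: ind1_ge0.
rewrite /qsum -big_filter -[X in _ <= X]big_filter; apply: rsum_sub.
- by rewrite filter_uniq ?iota_uniq.
- by rewrite filter_uniq ?iota_uniq.
- move=> q; rewrite !mem_filter => /andP [/andP [sq ov] qi]; rewrite qi sq /= andbT.
  have q0 : (0 < q)%N by move: qi; rewrite mem_iota => /andP [].
  rewrite (nd q q0 ov) andbT; apply/allP => r rq.
  by rewrite inE (allP ov r rq) orbT.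
- by move=> m _; apply: Rmult_le_pos => //; exact: ind1_ge0.
Qed.

Lemma mixes_ind1_le X ps x : uniq ps -> {in ps, forall p, prime p} -> 0 < x <= INR X ->
  mixes w ps ind1 x <= pprod (fun p => 1 - w p) ps * qsum X ps x.
Proof.
elim: ps x => [|p ps IH] x u H hx.
  rewrite /pprod big_nil Rmult_1_l /= /qsum.
  case: X hx => [|X] hx; first by move: hx => /=; lra.
  rewrite big_mkcond big_cons /=.
  have -> : hq Om 1 = 1 by rewrite /hq /= big_nil.
  rewrite Rdiv_1_r Rmult_1_l -[X in X <= _]Rplus_0_r; apply: Rplus_le_compat_l.
  apply: rsum_ge0 => q _; case: ifP => _; last exact: Rle_refl.
  by apply: Rmult_le_pos; [exact: hq_ge0 | exact: ind1_ge0].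
move: u => /= /andP [nps u].
have pp := H p (mem_head _ _); have H' : {in ps, forall p, prime p}.
  by move=> q qps; apply: H; rewrite inE qps orbT.
have [w0 w1] := w_bound p pp; have p1 := INR_gt0 p (prime_gt0 pp).
have [x0 xX] := hx; have [z0 zx] := div_pos_le x p (prime_gt0 pp) x0.
have h1 := IH x u H' hx; have h2 := IH _ u H' (conj z0 (Rle_trans _ _ _ zx xX)).
set c := pprod _ ps in h1 h2.
have c0 : 0 <= c by apply: pprod_ge0 => q /H' /w_bound; lra.
rewrite /pprod big_cons -/(pprod _ ps) -/c /mix.
(* This identity turns the probability [w p] into the multiplicative weight [hp] once [1 - w p] is
   factored out. *)
have hw : w p = (1 - w p) * hp Om p.
  by have := om_lt_R Om om_lt p pp; rewrite /w /hp => ?; field; lra.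
have h3 := qsum_cons X p ps x pp nps hx.
apply: (@Rle_trans _ ((1 - w p) * (c * qsum X ps x) + w p * (c * qsum X ps (x / INR p)))).
  by apply: Rplus_le_compat; apply: Rmult_le_compat_l; lra.
rewrite {2}hw.
apply: (@Rle_trans _ ((1 - w p) * c * (qsum X ps x + hp Om p * qsum X ps (x / INR p)))).
  by right; ring.
by apply: Rmult_le_compat_l => //; apply: Rmult_le_pos; lra.
Qed.

Lemma Gsum_lower (k X : nat) ps (eps : nat -> R) : (0 < X)%N -> uniq ps ->
  {in ps, forall p, prime p} -> (forall p, prime p -> (p <= X)%N -> p \in ps) ->
  {in ps, forall p, 0 <= eps p <= 1 /\ (1 - / INR p) ^ k * (1 - eps p) <= 1 - w p} ->
  pprod (fun p => 1 - / INR p) ps ^ k * mixes eps ps (iter k (hsum X) ind1) (INR X) <=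
  pprod (fun p => 1 - w p) ps * Gsum Om X.
Proof.
move=> X0 u H Hf He; have X1 := INR_gt0 X X0.
set c := pprod (fun p => 1 - / INR p) ps.
have hX : 0 < INR X <= INR X by split=> //; exact: Rle_refl.
rewrite -mixes_scal.
apply: Rle_trans (_ : mixes eps ps (iter k (geos X.+1 ps) ind1) (INR X) <= _).
  apply: (mixes_le _ _ _ _ (INR X)) => // [p pps|y [y0 _]].
    by split; [exact: prime_gt0 (H p pps) | exact: (proj1 (He p pps))].
  by apply: iter_geos_ge => //; exact: ind1_good.
apply: Rle_trans (mixes_geos_le _ _ _ _ eps w _ _ ind1_good X1) _.
  move=> p pps; have [e1 e2] := He p pps; have := w_bound p (H p pps) => h.
  by split=> //; [exact: H | lra].
apply: Rle_trans (mixes_ind1_le X ps _ u H hX) _; apply: Rmult_le_compat_l.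
  by apply: pprod_ge0 => q /H /w_bound; lra.
rewrite /qsum /Gsum /sqfs big_filter big_mkcond [X in _ <= X]big_mkcond /=; apply: rsum_le => q _.
have hg := hq_ge0 Om om_lt q.
case: (sqf q) => /=; last exact: Rle_refl.
case: (prime_support ps q) => //=.
rewrite -[X in _ <= X]Rmult_1_r; apply: Rmult_le_compat_l => //.
by rewrite /ind1; case: Rle_dec => h /=; lra.
Qed.

Definition euler_ratio (k : nat) ps := pprod (fun p => 1 - w p) ps / pprod (fun p => 1 - / INR p) ps ^ k.

Lemma euler_partial_ratio k n :
  euler_partial Om k n = euler_ratio k [seq p <- iota 0 n | prime p].
Proof.
rewrite /euler_partial /euler_ratio.
have : {in [seq p <- iota 0 n | prime p], forall p, prime p} by move=> p; rewrite mem_filter => /andP [].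
elim: [seq p <- _ | _] => [|p ps IH] H.
  by rewrite /pprod !big_nil /= pow1; field.
have H' : {in ps, forall p, prime p} by move=> q qps; apply: H; rewrite inE qps orbT.
have [i0 i1] := prime_inv_bound p (H p (mem_head _ _)).
rewrite /= IH // /pprod !big_cons -/(pprod _ ps) -/(pprod _ ps) Rpow_mult_distr -/(w p).
have c0 : 0 < pprod (fun p => 1 - / INR p) ps.
  by apply: pprod_gt0 => q /H' /prime_inv_bound; lra.
have n1 := pow_lt (1 - / INR p) k ltac:(lra); have n2 := pow_lt _ k c0.
by field; lra.
Qed.

Lemma euler_ratio_lower (k X : nat) ps (eps : nat -> R) : (0 < X)%N -> uniq ps ->
  {in ps, forall p, prime p} -> (forall p, prime p -> (p <= X)%N -> p \in ps) ->
  {in ps, forall p, 0 <= eps p <= 1 /\ (1 - / INR p) ^ k * (1 - eps p) <= 1 - w p} ->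
  mixes eps ps (iter k (hsum X) ind1) (INR X) <= euler_ratio k ps * Gsum Om X.
Proof.
move=> X0 u H Hf He; have := Gsum_lower k X ps eps X0 u H Hf He.
rewrite /euler_ratio; set c := pprod (fun p => 1 - / INR p) ps ^ k.
have c0 : 0 < c by apply: pow_lt; apply: pprod_gt0 => q /H /prime_inv_bound; lra.
move=> h; apply: (Rmult_le_reg_l c) => //; apply: Rle_trans h _; right; field; lra.
Qed.
End Lower.

(* Lower approximation, scaled by 10^6, of the k-fold harmonic sums. *)
Fixpoint tN (k y : nat) : N :=
  if k is k'.+1 then
    foldr (fun n acc => (tN k' (y %/ n) / N.of_nat n + acc)%num) 0%num (iota 1 y)
  else 1000000%num.

Lemma hsum_good X Phi : nonneg_mono Phi -> nonneg_mono (hsum X Phi).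
Proof.
move=> [P0 Pm]; split=> [x x0|x y xy]; rewrite /hsum big_seq.
  apply: rsum_ge0 => n; rewrite mem_iota => /andP [n0 _].
  apply: Rmult_le_pos; first exact: inv_INR_ge0.
  by apply: P0; apply: Rdiv_lt_0_compat => //; exact: INR_gt0.
rewrite [X in _ <= X]big_seq; apply: rsum_le => n; rewrite mem_iota => /andP [n0 _].
by apply: Rmult_le_compat_l; [exact: inv_INR_ge0 | apply: Pm; exact: div_mono].
Qed.

Lemma iter_hsum_good X k : nonneg_mono (iter k (hsum X) ind1).
Proof. by elim: k => [|k IH]; [exact: ind1_good | exact: hsum_good]. Qed.

(** Both roundings go down: [y / n] is replaced by its floor, harmless by monotonicity, and each
    quotient by [n] is an integer division. *)
Lemma tN_le X k y : (0 < y <= X)%N ->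
  IZR (Z.of_N (tN k y)) <= 1000000 * iter k (hsum X) ind1 (INR y).
Proof.
elim: k y => [|k IH] y /andP [y0 yX].
  by rewrite /= /ind1; have := INR_ge1 y y0; case: Rle_dec => h /=; lra.
have y1 := INR_gt0 y y0.
rewrite [tN k.+1 y]/=.
apply: (@Rle_trans _ (\rsum_(n <- iota 1 y) (1000000 * (/ INR n * iter k (hsum X) ind1 (INR y / INR n))))).
  have : forall n, n \in iota 1 y -> (0 < n <= y)%N.
    by move=> n; rewrite mem_iota add1n ltnS.
  elim: (iota 1 y) => [|n s IHs] H; first by rewrite big_nil /=; lra.
  rewrite big_cons /= N2Z.inj_add plus_IZR; apply: Rplus_le_compat; last first.
    by apply: IHs => m ms; apply: H; rewrite inE ms orbT.
  have /andP [n0 ny] := H n (mem_head _ _); have n1 := INR_gt0 n n0.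
  have d0 : (0 < y %/ n)%N by rewrite divn_gt0.
  have := IH (y %/ n)%N; rewrite d0 (leq_trans (leq_div _ _) yX) => /(_ isT) h.
  have h1 : INR (y %/ n) <= INR y / INR n.
    apply: (Rmult_le_reg_r (INR n)) => //; rewrite /Rdiv Rmult_assoc Rinv_l; last lra.
    by rewrite Rmult_1_r -mult_INR; apply: le_INR; apply/leP; exact: leq_trunc_div.
  have h2 := proj2 (iter_hsum_good X k) _ _ (conj (INR_gt0 _ d0) h1).
  apply: (Rmult_le_reg_l (INR n)) => //.
  have -> : INR n * (1000000 * (/ INR n * iter k (hsum X) ind1 (INR y / INR n))) =
     1000000 * iter k (hsum X) ind1 (INR y / INR n) by field; lra.
  apply: (@Rle_trans _ (IZR (Z.of_N (tN k (y %/ n))))); last lra.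
  rewrite N2Z.inj_div INR_IZR_INZ -mult_IZR nat_N_Z; apply: IZR_le.
  by apply: Z.mul_div_le; move/ltP: n0; lia.
rewrite /= -big_distrr; apply: Rmult_le_compat_l; first lra.
rewrite {2}/hsum; apply: rsum_sub; rewrite ?iota_uniq //.
  by move=> n; rewrite !mem_iota !add1n !ltnS => /andP [-> /leq_trans]; exact.
move=> n; rewrite mem_iota => /andP [n0 _].
apply: Rmult_le_pos; first exact: inv_INR_ge0.
by apply: (proj1 (iter_hsum_good X k)); apply: Rdiv_lt_0_compat => //; exact: INR_gt0.
Qed.

(** * Numerical bounds and the correction terms *)

Lemma INR_ge_Z m n : (m <= n)%N -> IZR (Z.of_nat m) <= INR n.
Proof. by move=> h; rewrite -INR_IZR_INZ; apply: le_INR; apply/leP. Qed.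

Lemma exp_ge_pow (x : R) n : (0 < n)%N -> 0 <= 1 + x / INR n -> (1 + x / INR n) ^ n <= exp x.
Proof.
move=> n0 h; have n1 := INR_gt0 n n0.
have -> : exp x = exp (x / INR n) ^ n.
  have E m : exp (x / INR n) ^ m = exp (INR m * (x / INR n)).
    elim: m => [|m IH]; first by rewrite /= Rmult_0_l exp_0.
    by rewrite S_INR Rmult_plus_distr_r Rmult_1_l exp_plus -IH /=; ring.
  by rewrite E; congr exp; field; lra.
by apply: pow_incr; split=> //; exact: exp_ineq1_le.
Qed.

Lemma ln_le_exp a b : 0 < a -> a <= exp b -> ln a <= b.
Proof.
move=> a0 h; rewrite -(ln_exp b); case: (Req_dec a (exp b)) => [->|ne]; first exact: Rle_refl.
by apply: Rlt_le; apply: ln_increasing; lra.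
Qed.

Lemma ln_le a b : 0 < a -> a <= b -> ln a <= ln b.
Proof.
by move=> a0 [h| ->]; [apply: Rlt_le; apply: ln_increasing | exact: Rle_refl].
Qed.

Lemma ln_pow_nat a n : 0 < a -> ln (a ^ n) = INR n * ln a.
Proof.
move=> a0; elim: n => [|n IH]; first by rewrite /= ln_1; ring.
by rewrite S_INR [_ ^ _]/= ln_mult ?IH; [ring | | exact: pow_lt].
Qed.

(** Both bounds use [exp x >= (1 + x/n)^n], the lower one at [x = -2/3]. The power 256 is reached by
    eight squarings with rounding down. *)
Lemma ln2_bounds : 2 / 3 <= ln 2 <= 6945 / 10000.
Proof.
split.
  have h := exp_ge_pow (- (2 / 3)) 32 isT.
  have e32 : INR 32 = 32 by rewrite INR_IZR_INZ.
  rewrite e32 in h.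
  have {}h : 1 / 2 <= exp (- (2 / 3)).
    by apply: Rle_trans (h _); lra.
  have -> : 2 / 3 = ln (exp (2 / 3)) by rewrite ln_exp.
  apply: ln_le; first exact: exp_pos.
  have p := exp_pos (2 / 3); have e : exp (2 / 3) * exp (- (2 / 3)) = 1.
    by rewrite -exp_plus Rplus_opp_r exp_0.
  nra.
apply: ln_le_exp; first lra.
have h := exp_ge_pow (6945 / 10000) 256 isT.
have e256 : INR 256 = 256 by rewrite INR_IZR_INZ.
rewrite e256 in h; apply: Rle_trans (h _); last lra.
rewrite -[256%N]/(2 * (2 * (2 * (2 * (2 * (2 * (2 * 2)))))))%N.
set q := 1 + _.
have e : q ^ (2 * (2 * (2 * (2 * (2 * (2 * (2 * 2))))))) = (((((((q ^ 2) ^ 2) ^ 2) ^ 2) ^ 2) ^ 2) ^ 2) ^ 2.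
  by rewrite -!pow_mult; congr (_ ^ _).
rewrite e.
have sq (a b : R) : 0 <= a -> a <= b -> a ^ 2 <= b ^ 2 by move=> *; apply: pow_incr.
have q0 : 1005433 / 1000000 <= q ^ 2 by rewrite /q; lra.
have q2 : 1010895 / 1000000 <= (q ^ 2) ^ 2 by apply: Rle_trans (sq _ _ _ q0); lra.
have q3 : 1021908 / 1000000 <= ((q ^ 2) ^ 2) ^ 2 by apply: Rle_trans (sq _ _ _ q2); lra.
have q4 : 1044295 / 1000000 <= (((q ^ 2) ^ 2) ^ 2) ^ 2 by apply: Rle_trans (sq _ _ _ q3); lra.
have q5 : 109055 / 100000 <= ((((q ^ 2) ^ 2) ^ 2) ^ 2) ^ 2 by apply: Rle_trans (sq _ _ _ q4); lra.
have q6 : 118929 / 100000 <= (((((q ^ 2) ^ 2) ^ 2) ^ 2) ^ 2) ^ 2 by apply: Rle_trans (sq _ _ _ q5); lra.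
have q7 : 141441 / 100000 <= ((((((q ^ 2) ^ 2) ^ 2) ^ 2) ^ 2) ^ 2) ^ 2 by apply: Rle_trans (sq _ _ _ q6); lra.
by apply: Rle_trans (sq _ _ _ q7); lra.
Qed.

(** From [3^5 <= 2^8], [5^3 <= 2^7], [7^10 <= 2^29] and [9^5 <= 2^16]. *)
Lemma ln_small : [/\ ln 3 <= 112 / 100, ln 5 <= 16205 / 10000, ln 7 <= 2015 / 1000 & ln 9 <= 22224 / 10000].
Proof.
have [h1 h2] := ln2_bounds.
have p (a : R) (k m : nat) : 0 < a -> a ^ k <= 2 ^ m -> INR k * ln a <= INR m * ln 2.
  by move=> a0 h; rewrite -!ln_pow_nat; try lra; apply: ln_le => //; exact: pow_lt.
have c5 := p 5 3%N 7%N; have c7 := p 7 10%N 29%N; have c9 := p 9 5%N 16%N; have c3 := p 3 5%N 8%N.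
rewrite !INR_IZR_INZ /= in c3 c5 c7 c9.
by split; [have := c3 | have := c5 | have := c7 | have := c9]; lra.
Qed.

Lemma ln3_ge1 : 1 <= ln 3.
Proof. by rewrite -[X in X <= _]ln_exp; apply: ln_le; [exact: exp_pos | exact: exp_le_3]. Qed.

(* A primitive of - ln x / x^2. *)
Definition lnq (x : R) : R := (ln x + 1) / x.

(** Comparison of [ln x / x^2] with its integral over [[x - s, x]]. Using
    [ln (x - s) >= ln x - s / (x - s)], the second hypothesis is exactly the sign condition on the
    remainder. *)
Lemma lnq_step (x s : R) : 0 < s < x -> x <= ln x * (x - s) ->
  s * ln x / (x * x) <= lnq (x - s) - lnq x.
Proof.
move=> [s0 sx] h; rewrite /lnq.
have y0 : 0 < x - s by lra.
have hl : ln x - s / (x - s) <= ln (x - s).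
  have : ln (x / (x - s)) <= s / (x - s).
    apply: ln_le_exp; first by apply: Rdiv_lt_0_compat; lra.
    have -> : x / (x - s) = 1 + s / (x - s) by field; lra.
    exact: exp_ineq1_le.
  by rewrite ln_div; lra.
have i0 : 0 < / (x - s) by apply: Rinv_0_lt_compat.
have h2 : (ln x - s / (x - s) + 1) / (x - s) <= (ln (x - s) + 1) / (x - s).
  by apply: Rmult_le_compat_r; lra.
suff h3 : s * ln x / (x * x) <= (ln x - s / (x - s) + 1) / (x - s) - (ln x + 1) / x by lra.
have e : (ln x - s / (x - s) + 1) / (x - s) - (ln x + 1) / x - s * ln x / (x * x) =
  s * s * (ln x * (x - s) - x) / (x * x * ((x - s) * (x - s))) by field; lra.
suff : 0 <= s * s * (ln x * (x - s) - x) / (x * x * ((x - s) * (x - s))) by rewrite -e; lra.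
apply: Rmult_le_pos; first by apply: Rmult_le_pos; nra.
by apply: Rlt_le; apply: Rinv_0_lt_compat; apply: Rmult_lt_0_compat; nra.
Qed.

Lemma ln4_mul x s : 4 <= x -> 0 < s -> 4 * s <= x -> x <= ln x * (x - s).
Proof.
move=> x4 s0 sx; have h : 4 / 3 <= ln x.
  have := ln_le 4 x ltac:(lra) x4; have [h1 _] := ln2_bounds.
  have -> : 4 = 2 * 2 by ring.
  by rewrite ln_mult; lra.
nra.
Qed.

Definition primes_below (n : nat) := [seq p <- iota 0 n | prime p].

Lemma primes_belowP n p : p \in primes_below n = prime p && (p < n)%N.
Proof. by rewrite mem_filter mem_iota. Qed.

Lemma primes_below_uniq n : uniq (primes_below n).
Proof. by rewrite filter_uniq ?iota_uniq. Qed.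

Lemma primes_belowS n : primes_below n.+1 = primes_below n ++ (if prime n then [:: n] else [::]).
Proof. by rewrite /primes_below -(addn1 n) iotaD filter_cat /= add0n. Qed.

(** A crude choice valid for all [k]: the value 1 for small [p] makes the local condition trivial
    there. *)
Definition eps_gen (k p : nat) : R := if (p <= k)%N then 1 else (INR k / INR p) ^ 2.

Lemma eps_gen_bound k p : (0 < p)%N -> 0 <= eps_gen k p <= 1.
Proof.
move=> p0; rewrite /eps_gen; case: leqP => h; first lra.
have p1 := INR_gt0 p p0; have k0 := pos_INR k.
have kp : INR k <= INR p by apply: le_INR; apply/leP; exact: ltnW.
have q0 : 0 <= INR k / INR p by apply: Rmult_le_pos => //; apply: Rlt_le; apply: Rinv_0_lt_compat.
have q1 : INR k / INR p <= 1.
  by apply: (Rmult_le_reg_r (INR p)) => //; rewrite /Rdiv Rmult_assoc Rinv_l; lra.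
nra.
Qed.

(** Since [1 - (k/p)^2 = (1 + k/p) (1 - k/p)], Bernoulli's [1 + k/p <= (1 + 1/p)^k] leaves the
    factor [(1 - 1/p^2)^k <= 1]. *)
Lemma eps_gen_cond Om k p : prime p -> (omega Om p < p)%N -> (omega Om p <= k)%N ->
  (1 - / INR p) ^ k * (1 - eps_gen k p) <= 1 - INR (omega Om p) / INR p.
Proof.
move=> pp op ok; have p1 := INR_gt0 p (prime_gt0 pp); have [i0 i1] := prime_inv_bound p pp.
have o1 : INR (omega Om p) / INR p <= 1.
  apply: (Rmult_le_reg_r (INR p)) => //; rewrite /Rdiv Rmult_assoc Rinv_l; last lra.
  by have : INR (omega Om p) <= INR p by [apply: le_INR; apply/leP; exact: ltnW]; lra.
rewrite /eps_gen; case: leqP => h; first by rewrite Rminus_diag Rmult_0_r; lra.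
have o2 : INR (omega Om p) / INR p <= INR k / INR p.
  by apply: Rmult_le_compat_r; [lra | apply: le_INR; apply/leP].
have q1 : INR k / INR p < 1.
  apply: (Rmult_lt_reg_r (INR p)) => //; rewrite /Rdiv Rmult_assoc Rinv_l; last lra.
  by have : INR k < INR p by [apply: lt_INR; apply/ltP]; lra.
suff h2 : (1 - / INR p) ^ k * (1 - (INR k / INR p) ^ 2) <= 1 - INR k / INR p by lra.
have -> : 1 - (INR k / INR p) ^ 2 = (1 + INR k / INR p) * (1 - INR k / INR p) by ring.
rewrite -Rmult_assoc -[X in _ <= X]Rmult_1_l; apply: Rmult_le_compat_r; first lra.
have b := poly k (/ INR p) i0.
have t0 : 0 <= (1 - / INR p) ^ k by apply: pow_le; lra.
apply: (@Rle_trans _ ((1 - / INR p) ^ k * (1 + / INR p) ^ k)).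
  by apply: Rmult_le_compat_l.
rewrite -Rpow_mult_distr -[X in _ <= X](pow1 k); apply: pow_incr; nra.
Qed.

(** The sum is extended from primes to all integers: those up to [k] give [k ln k], and the tail
    gives [k^2 lnq k <= 2 k ln k] because [ln k >= 1]. *)
Lemma eps_gen_sum k n : (3 <= k)%N ->
  \rsum_(p <- primes_below n) (eps_gen k p * ln (INR p)) <= 3 * INR k * ln (INR k).
Proof.
move=> k3; have k1 : 3 <= INR k by exact: (INR_ge_Z 3).
have lk : 1 <= ln (INR k) by apply: Rle_trans ln3_ge1 _; apply: ln_le; lra.
have lnn m : (0 < m)%N -> 0 <= ln (INR m).
  by move=> m0; rewrite -ln_1; apply: ln_le; [lra | exact: INR_ge1].
pose T m := \rsum_(p <- iota 1 m) (eps_gen k p * ln (INR p)).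
have TS m : T m.+1 = T m + eps_gen k m.+1 * ln (INR m.+1).
  rewrite /T; have -> : iota 1 m.+1 = iota 1 m ++ [:: m.+1] by rewrite -(addn1 m) iotaD /= addn1.
  by rewrite big_cat big_cons big_nil /= Rplus_0_r.
have T1 m : (m <= k)%N -> T m <= INR m * ln (INR k).
  elim: m => [|m IH] mk; first by rewrite /T big_nil /=; lra.
  have -> : INR m.+1 * ln (INR k) = INR m * ln (INR k) + ln (INR k) by rewrite S_INR; ring.
  rewrite TS; apply: Rplus_le_compat.
    by apply: IH; exact: ltnW.
  rewrite /eps_gen mk Rmult_1_l; apply: ln_le; first exact: INR_gt0.
  by apply: le_INR; apply/leP.
have lnq0 m : (0 < m)%N -> 0 <= lnq (INR m).
  move=> m0; apply: Rmult_le_pos; first by have := lnn m m0; lra.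
  exact: inv_INR_ge0.
have T2 d : T (k + d)%N <= INR k * ln (INR k) + INR k * INR k * (lnq (INR k) - lnq (INR (k + d))).
  elim: d => [|d IH]; first by rewrite addn0 Rminus_diag Rmult_0_r Rplus_0_r; exact: T1.
  have e1 : eps_gen k (k + d).+1 = (INR k / INR (k + d).+1) ^ 2.
    by rewrite /eps_gen leqNgt ltnS leq_addr.
  rewrite addnS TS e1.
  set m := INR (k + d)%N.+1.
  have em : m = INR (k + d) + 1 by rewrite /m -S_INR.
  have mk : INR k <= INR (k + d) by apply: le_INR; apply/leP; exact: leq_addr.
  have := lnq_step m 1 ltac:(lra) (ln4_mul m 1 ltac:(lra) ltac:(lra) ltac:(lra)).
  have -> : m - 1 = INR (k + d) by lra.
  have -> : (INR k / m) ^ 2 * ln m = INR k * INR k * (1 * ln m / (m * m)) by field; lra.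
  move=> h; have h2 : 0 <= INR k * INR k by nra.
  have := Rmult_le_compat_l _ _ _ h2 h; lra.
have T3 m : T m <= 3 * INR k * ln (INR k).
  case: (leqP m k) => mk.
    apply: Rle_trans (T1 m mk) _; apply: Rmult_le_compat_r; first lra.
    by have := le_INR m k (elimT leP mk); lra.
  rewrite -(subnKC (ltnW mk)); apply: Rle_trans (T2 _) _.
  have := lnq0 (k + (m - k))%N; rewrite subnKC ?(ltnW mk) // => /(_ (leq_ltn_trans (leq0n _) mk)) h.
  have -> : 3 * INR k * ln (INR k) = INR k * ln (INR k) + INR k * INR k * (2 * ln (INR k) / INR k).
    by field; lra.
  apply: Rplus_le_compat_l; apply: Rmult_le_compat_l; first nra.
  have : lnq (INR k) <= 2 * ln (INR k) / INR k.
    by apply: Rmult_le_compat_r; [apply: Rlt_le; apply: Rinv_0_lt_compat | ]; lra.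
  lra.
apply: Rle_trans (T3 n); apply: rsum_sub; rewrite ?primes_below_uniq ?iota_uniq //.
  by move=> p; rewrite primes_belowP mem_iota add1n ltnS => /andP [/prime_gt0 -> /ltnW].
move=> p; rewrite mem_iota => /andP [p0 _]; have [h _] := eps_gen_bound k p p0.
by apply: Rmult_le_pos => //; exact: lnn.
Qed.

(* For p > 3 this makes (1 - 1/p)^3 (1 - eps3 p) equal to 1 - 3/p. *)
Definition eps3 (p : nat) : R := if (p <= 3)%N then 0 else (3 * INR p - 1) / (INR p - 1) ^ 3.

Lemma eps3_bound p : 0 <= eps3 p <= 1.
Proof.
rewrite /eps3; case: leqP => h; first lra.
have h4 : 4 <= INR p by exact: (INR_ge_Z 4).
have c0 : 0 < (INR p - 1) ^ 3 by apply: pow_lt; lra.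
have i0 := Rinv_0_lt_compat _ c0.
split; first by apply: Rmult_le_pos; lra.
apply: (Rmult_le_reg_r ((INR p - 1) ^ 3)) => //.
rewrite /Rdiv Rmult_assoc Rinv_l; last lra.
rewrite /=; have : 0 <= (INR p - 4) * (INR p * INR p) by apply: Rmult_le_pos; nra.
nra.
Qed.

Lemma eps3_cond Om p : prime p -> (omega Om p < p)%N -> (omega Om p <= 3)%N ->
  (1 - / INR p) ^ 3 * (1 - eps3 p) <= 1 - INR (omega Om p) / INR p.
Proof.
move=> pp op o3; rewrite /eps3; case: leqP => h.
  have : p = 2%N \/ p = 3%N by case: p pp h {op o3} => [|[|[|[|p]]]] //; auto.
  have : INR (omega Om p) <= INR p - 1.
    by have := le_INR _ _ (elimT leP op); rewrite S_INR; lra.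
  by move=> /[swap] [] [->|->] /=; lra.
have h4 : 4 <= INR p by exact: (INR_ge_Z 4).
have o1 : INR (omega Om p) <= 3 by rewrite -[3]/(IZR (Z.of_nat 3)) -INR_IZR_INZ; apply: le_INR; apply/leP.
have i0 : 0 < / INR p by apply: Rinv_0_lt_compat; lra.
have -> : (1 - / INR p) ^ 3 * (1 - (3 * INR p - 1) / (INR p - 1) ^ 3) = 1 - 3 / INR p by field; lra.
suff : INR (omega Om p) / INR p <= 3 / INR p by lra.
by apply: Rmult_le_compat_r; lra.
Qed.

Lemma not_prime_even j : prime (2 * j + 12) = false.
Proof.
apply/negbTE/negP => /primeP [_ /(_ 2%N)].
have -> : (2 %| 2 * j + 12)%N by rewrite dvdn_add // dvdn_mulr.
by move=> /(_ isT) /orP [//|]; rewrite !addnS.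
Qed.

Lemma primes_below_step j : primes_below (2 * j.+1 + 11) =
  primes_below (2 * j + 11) ++ (if prime (2 * j + 11) then [:: (2 * j + 11)%N] else [::]).
Proof.
have -> : (2 * j.+1 + 11 = (2 * j + 11).+2)%N by rewrite mulnS -addnA add2n.
by rewrite primes_belowS primes_belowS -(addnS _ 11) not_prime_even cats0.
Qed.

(** The constant is the value of [x^2 eps3] at [x = 11], namely [121 * 32 / 1000]. *)
Lemma eps3_le x p : INR p = x -> 11 <= x -> eps3 p <= 3872 / 1000 / (x * x).
Proof.
move=> e h; rewrite /eps3; case: leqP => hp.
  by exfalso; have := le_INR p 3 (elimT leP hp); rewrite e /=; lra.
rewrite e; have c0 : 0 < (x - 1) ^ 3 by apply: pow_lt; lra.
apply: (Rmult_le_reg_r ((x - 1) ^ 3)) => //.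
have -> : (3 * x - 1) / (x - 1) ^ 3 * (x - 1) ^ 3 = 3 * x - 1 by field; lra.
apply: (Rmult_le_reg_r (x * x)); first nra.
have -> : 3872 / 1000 / (x * x) * (x - 1) ^ 3 * (x * x) = 3872 / 1000 * (x - 1) ^ 3 by field; lra.
have -> : x = (x - 11) + 11 by ring.
set y := x - 11; have y0 : 0 <= y by rewrite /y; lra.
have : 0 <= y * y by nra.
have : 0 <= y * y * y by apply: Rmult_le_pos; nra.
rewrite /=; nra.
Qed.

(* Beyond 11 only odd numbers contribute, so lnq telescopes with step 2. *)
Lemma eps3_sum j :
  \rsum_(p <- primes_below (2 * j + 11)) (eps3 p * ln (INR p)) <= 1235 / 1000.
Proof.
have [_ l5 l7 l9] := ln_small.
(* The first constant bounds the terms at 5 and 7; 1936/1000 is half of the constant of [eps3_le],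
   because the step is 2. *)
suff h : \rsum_(p <- primes_below (2 * j + 11)) (eps3 p * ln (INR p)) <=
   54107 / 100000 + 1936 / 1000 * (lnq 9 - lnq (2 * INR j + 9)).
  have h9 : lnq 9 <= 32224 / 90000 by rewrite /lnq; lra.
  have hj : 0 <= lnq (2 * INR j + 9).
    have j0 := pos_INR j; apply: Rmult_le_pos.
      have : 0 <= ln (2 * INR j + 9) by rewrite -ln_1; apply: ln_le; lra.
      lra.
    by apply: Rlt_le; apply: Rinv_0_lt_compat; lra.
  lra.
elim: j => [|j IH].
  have -> : primes_below (2 * 0 + 11) = [:: 2; 3; 5; 7]%N by [].
  rewrite !big_cons big_nil /eps3 /=.
  have -> : 2 * 0 + 9 = 9 by ring.
  have -> : 1 + 1 + 1 + 1 + 1 = 5 by ring.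
  have -> : 5 + 1 + 1 = 7 by ring.
  lra.
rewrite primes_below_step big_cat /=.
set x := INR (2 * j + 11).
have ex : x = 2 * INR j + 11 by rewrite /x plus_INR mult_INR /=; ring.
have j0 := pos_INR j.
have e1 : 2 * INR j.+1 + 9 = x by rewrite S_INR ex; ring.
have e2 : 2 * INR j + 9 = x - 2 by rewrite ex; ring.
rewrite e1; rewrite e2 in IH.
have lx : 0 <= ln x by rewrite -ln_1; apply: ln_le; lra.
have st := lnq_step x 2 ltac:(lra) (ln4_mul x 2 ltac:(lra) ltac:(lra) ltac:(lra)).
have ep := eps3_le x (2 * j + 11) erefl ltac:(lra).
have hx : eps3 (2 * j + 11) * ln x <= 1936 / 1000 * (lnq (x - 2) - lnq x).
  apply: (@Rle_trans _ (3872 / 1000 / (x * x) * ln x)); first exact: Rmult_le_compat_r.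
  have -> : 3872 / 1000 / (x * x) * ln x = 1936 / 1000 * (2 * ln x / (x * x)) by field; lra.
  lra.
have [e0 _] := eps3_bound (2 * j + 11).
have hp : 0 <= eps3 (2 * j + 11) * ln x by apply: Rmult_le_pos.
have : \rsum_(p <- if prime (2 * j + 11) then [:: (2 * j + 11)%N] else [::]) (eps3 p * ln (INR p)) <=
   1936 / 1000 * (lnq (x - 2) - lnq x).
  by case: (prime _); rewrite ?big_cons big_nil -?/x; lra.
move: IH; set S1 := \big[_/_]_(_ <- primes_below _) _; set S2 := \big[_/_]_(_ <- _) _; lra.
Qed.

(** The factors at 5 and 7 give 7089/10000. For the others a product of terms [1 - e] is at least 1
    minus the sum of the [e], and [2 / (x^2 - 1)] telescopes along odd numbers. *)
Lemma eps3_prod j : 57 / 100 <= pprod (fun p => 1 - eps3 p) (primes_below (2 * j + 11)).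
Proof.
suff h : 7089 / 10000 * (1 - 1936 / 1000 * (/ 10 - / (2 * INR j + 10))) <=
    pprod (fun p => 1 - eps3 p) (primes_below (2 * j + 11)).
  have : 0 < / (2 * INR j + 10) by apply: Rinv_0_lt_compat; have := pos_INR j; lra.
  lra.
rewrite /pprod; elim: j => [|j IH].
  have -> : primes_below (2 * 0 + 11) = [:: 2; 3; 5; 7]%N by [].
  rewrite !big_cons big_nil /eps3 /=; lra.
rewrite primes_below_step big_cat /=.
set x := INR (2 * j + 11).
have ex : x = 2 * INR j + 11 by rewrite /x plus_INR mult_INR /=; ring.
have j0 := pos_INR j.
have e1 : 2 * INR j.+1 + 10 = x + 1 by rewrite S_INR ex; ring.
have e2 : 2 * INR j + 10 = x - 1 by rewrite ex; ring.
rewrite e1; rewrite e2 in IH.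
have ep := eps3_le x (2 * j + 11) erefl ltac:(lra).
have [e0 e3] := eps3_bound (2 * j + 11).
have hx : eps3 (2 * j + 11) <= 1936 / 1000 * (/ (x - 1) - / (x + 1)).
  apply: Rle_trans ep _.
  have -> : 1936 / 1000 * (/ (x - 1) - / (x + 1)) = 3872 / 1000 / (x * x - 1) by field; nra.
  by apply: Rmult_le_compat_l; [lra | apply: Rinv_le_contravar; nra].
have i1 : / (x + 1) <= / (x - 1) by apply: Rinv_le_contravar; lra.
have i2 : / (x - 1) <= / 10 by apply: Rinv_le_contravar; lra.
have i3 : 0 < / (x + 1) by apply: Rinv_0_lt_compat; lra.
set P := \rprod_(i <- primes_below (2 * j + 11)) (1 - eps3 i) in IH *.
case: (prime _); rewrite ?big_cons big_nil; last lra.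
set e := eps3 _ in hx e0 e3 *; set a := / (x - 1) in IH hx i1 i2; set b := / (x + 1) in hx i1 i3 *.
have : 7089 / 10000 * (1 - 1936 / 1000 * (/ 10 - a)) * (1 - e) <= P * (1 - e).
  by apply: Rmult_le_compat_r; lra.
rewrite Rmult_1_r; apply: Rle_trans.
have : 0 <= e * (1936 / 1000 * (/ 10 - a)) by apply: Rmult_le_pos; lra.
lra.
Qed.

(** * Summation by parts, tangents and the Euler product *)

Lemma abel (b H : nat -> R) J :
  \rsum_(i < J.+1) (b i * H i) =
  b J * (\rsum_(i < J.+1) H i) + \rsum_(i < J) ((b i - b i.+1) * (\rsum_(k < i.+1) H k)).
Proof.
elim: J => [|J IH]; first by rewrite !big_ord1 big_ord0 Rplus_0_r.
have e1 := rsum_recr J.+1 (fun i => b i * H i); have e2 := rsum_recr J.+1 H.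
have e3 := rsum_recr J (fun i => (b i - b i.+1) * (\rsum_(k < i.+1) H k)).
rewrite e1 IH e2 e3; ring.
Qed.

Lemma pow_sum_23 n : \rsum_(i < n) (2 / 3) ^ (n - i.+1) <= 3.
Proof.
suff -> : \rsum_(i < n) (2 / 3) ^ (n - i.+1) = 3 - 3 * (2 / 3) ^ n.
  have h : 0 <= (2 / 3) ^ n by apply: pow_le; lra.
  lra.
elim: n => [|n IH]; first by rewrite big_ord0 /=; lra.
rewrite big_ord_recl subSS subn0.
have -> : \rsum_(i < n) (2 / 3) ^ (n.+1 - (lift ord0 i).+1) = \rsum_(i < n) (2 / 3) ^ (n - i.+1).
  by apply: eq_bigr.
by rewrite IH /=; lra.
Qed.

(** The weights [b] decrease, so summation by parts reduces the bound to the extremal sequence with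
    partial sums exactly [al + be i]. The relative costs [c i / N] add up to at most
    [3 * 20 * 4^J / N], whence the 60. The sign of [al] is used with [b 0 <= 1]. *)
Lemma weighted_sum_lower (H : nat -> R) (J : nat) (N u al be : R)
    (b := fun i => N / (N + 20 * 4 ^ J * (2 / 3) ^ (J - i))) :
  0 < N -> al <= 0 -> 0 <= be ->
  (forall i, (i <= J)%N -> al + be * INR i <= u * (\rsum_(k < i.+1) H k)) ->
  al + be * (INR J - 60 * 4 ^ J / N) <= u * (\rsum_(i < J.+1) (b i * H i)).
Proof.
move=> N0 al0 be0 Hl.
have p4 : 0 < 4 ^ J by apply: pow_lt; lra.
have p23 i : 0 < (2 / 3) ^ i by apply: pow_lt; lra.
pose c i := 20 * 4 ^ J * (2 / 3) ^ (J - i).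
have c0 i : 0 < c i by apply: Rmult_lt_0_compat => //; lra.
have b0 i : 0 < b i by apply: Rdiv_lt_0_compat => //; have := c0 i; rewrite /c; lra.
have bl i : 1 - c i / N <= b i.
  rewrite /b -/(c i); have := c0 i => ci.
  have -> : 1 - c i / N = N / (N + c i) - c i * c i / (N * (N + c i)) by field; lra.
  have : 0 <= c i * c i / (N * (N + c i)).
    by apply: Rmult_le_pos; [nra | apply: Rlt_le; apply: Rinv_0_lt_compat; nra].
  lra.
have bdec i : (i < J)%N -> b i.+1 <= b i.
  move=> iJ; rewrite /b -/(c i) -/(c i.+1).
  apply: Rmult_le_compat_l; first lra.
  apply: Rinv_le_contravar; first by have := c0 i; lra.
  have -> : c i = c i.+1 * (2 / 3) by rewrite /c -(subnSK iJ) /=; ring.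
  by have := c0 i.+1; lra.
have b01 : b 0%N <= 1.
  rewrite /b -/(c 0%N); have := c0 0%N => ci.
  by apply: (Rmult_le_reg_r (N + c 0%N)); [lra | rewrite /Rdiv Rmult_assoc Rinv_l; lra].
pose H' i := if i is 0%N then al else be.
have sH' i : \rsum_(k < i.+1) H' k = al + be * INR i.
  rewrite big_ord_recl /= (eq_bigr (fun _ => be)) => [|k _ //].
  by rewrite rsum_const_ord; ring.
apply: (@Rle_trans _ (\rsum_(i < J.+1) (b i * H' i))); last first.
  rewrite !abel Rmult_plus_distr_l; apply: Rplus_le_compat.
    rewrite sH' -Rmult_assoc (Rmult_comm u) Rmult_assoc; apply: Rmult_le_compat_l.
      by have := b0 J; lra.
    exact: Hl.
  rewrite big_distrr; apply: rsum_le => i _; rewrite sH' /=.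
  rewrite -Rmult_assoc (Rmult_comm u) Rmult_assoc; apply: Rmult_le_compat_l.
    by have := bdec i (ltn_ord i); lra.
  by apply: Hl; exact: ltnW.
rewrite big_ord_recl /=.
have h1 : al <= b 0%N * al by have := b0 0%N; nra.
have h2 : INR J - 60 * 4 ^ J / N <= \rsum_(i < J) b i.+1.
  apply: (@Rle_trans _ (\rsum_(i < J) (1 + (- (20 * 4 ^ J / N)) * (2 / 3) ^ (J - i.+1)))).
    rewrite big_split /= rsum_const_ord -big_distrr /=.
    have hs := pow_sum_23 J; set S := \big[_/_]_(_ < _) _ in hs *.
    have : 0 <= 20 * 4 ^ J / N by apply: Rmult_le_pos; [lra | apply: Rlt_le; exact: Rinv_0_lt_compat].
    have -> : 60 * 4 ^ J / N = 20 * 4 ^ J / N * 3 by field; lra.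
    nra.
  apply: rsum_le => i _; apply: Rle_trans (bl i.+1); right; rewrite /c; field; lra.
have -> : \rsum_(i < J) (b (lift ord0 i) * be) = (\rsum_(i < J) b i.+1) * be.
  by rewrite big_distrl.
have := Rmult_le_compat_r _ _ _ be0 h2.
set S := \rsum_(i < J) b i.+1; rewrite /=; lra.
Qed.

Lemma pow_sub_ge (a b : R) k : 0 <= b <= a -> INR k.+1 * (a - b) * b ^ k <= a ^ k.+1 - b ^ k.+1.
Proof.
move=> [b0 ba]; elim: k => [|k IH]; first by rewrite /=; lra.
have h0 : 0 <= b ^ k by exact: pow_le.
have h : a * (INR k.+1 * (a - b) * b ^ k) <= a * (a ^ k.+1 - b ^ k.+1).
  by apply: Rmult_le_compat_l; lra.
have k0 := pos_INR k.+1.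
have h2 : 0 <= INR k.+1 * (a - b) * b ^ k * (a - b).
  by apply: Rmult_le_pos; [apply: Rmult_le_pos => //; apply: Rmult_le_pos; lra | lra].
rewrite (S_INR k.+1) -[a ^ k.+2]/(a * a ^ k.+1) -[b ^ k.+2]/(b * b ^ k.+1).
rewrite -[b ^ k.+1]/(b * b ^ k) in h *; lra.
Qed.

(** Convexity of the positive part to the power [m + 1], with its tangent at [y]. *)
Lemma tangent_le m (y L : R) : 0 <= y ->
  y ^ m.+1 / INR (m.+1)`! + y ^ m / INR m`! * (L - y) <= Rmax L 0 ^ m.+1 / INR (m.+1)`!.
Proof.
move=> y0; have f0 := INR_fact m; have m0 : 0 < INR m.+1 by exact: INR_gt0.
rewrite factS mult_INR.
have -> : y ^ m.+1 / (INR m.+1 * INR m`!) + y ^ m / INR m`! * (L - y) =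
  (y ^ m.+1 + INR m.+1 * (L - y) * y ^ m) / (INR m.+1 * INR m`!) by field; lra.
apply: Rmult_le_compat_r.
  by apply: Rlt_le; apply: Rinv_0_lt_compat; apply: Rmult_lt_0_compat.
have ym : 0 <= y ^ m by exact: pow_le.
case: (Rle_lt_dec L 0) => L0.
  rewrite Rmax_right //.
  have -> : 0 ^ m.+1 = 0 by rewrite /= Rmult_0_l.
  have : INR m.+1 * (L - y) <= - y by have := INR_ge1 m.+1 isT; nra.
  by move=> h; have := Rmult_le_compat_r _ _ _ ym h; rewrite /=; lra.
rewrite Rmax_left; last lra.
case: (Rle_lt_dec L y) => Ly.
  by have := pow_sub_le y L m (conj (Rlt_le _ _ L0) Ly); lra.
by have := pow_sub_ge L y m (conj y0 (Rlt_le _ _ Ly)); lra.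
Qed.

Lemma bernoulli_neg (x : R) k : 0 <= x <= 1 -> 1 - INR k * x <= (1 - x) ^ k.
Proof.
move=> [x0 x1]; elim: k => [|k IH]; first by rewrite /=; lra.
have h := Rmult_le_compat_l (1 - x) _ _ ltac:(lra) IH.
have : 0 <= INR k * x * x by have := pos_INR k => k0; apply: Rmult_le_pos; nra.
by rewrite S_INR /=; lra.
Qed.

Section Limit.
Variables (Om : nat -> nat -> bool) (k : nat) (P0 : seq nat).
Hypothesis om_lt : forall p, prime p -> (omega Om p < p)%N.
Hypothesis om_k : forall p, prime p -> p \notin P0 -> omega Om p = k.

Let u := euler_partial Om k.

Lemma euler_partial_gt0 n : 0 < u n.
Proof.
rewrite /u euler_partial_ratio; apply: Rdiv_lt_0_compat.
  by apply: pprod_gt0 => p; rewrite mem_filter => /andP [/(w_bound Om om_lt)]; lra.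
by apply: pow_lt; apply: pprod_gt0 => p; rewrite mem_filter => /andP [/prime_inv_bound]; lra.
Qed.

(** Beyond [P0] each new factor is [(1 - k/p) (1 - 1/p)^(-k)], at most 1 by Bernoulli. *)
Lemma euler_partial_decr n : (\max_(p <- P0) p < n)%N -> u n.+1 <= u n.
Proof.
move=> hn; rewrite /u !euler_partial_ratio -/(primes_below n.+1) -/(primes_below n) primes_belowS.
case: (boolP (prime n)) => pn; last by rewrite cats0; exact: Rle_refl.
have nP : n \notin P0.
  by apply/negP => nP; move: hn; rewrite ltnNge (leq_bigmax_seq n (F := id)).
have un := euler_partial_gt0 n; rewrite /u euler_partial_ratio -/(primes_below n) in un.
rewrite /euler_ratio /pprod !big_cat !big_cons !big_nil /= !Rmult_1_r Rpow_mult_distr.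
rewrite /euler_ratio /pprod in un.
set A := \rprod_(p <- primes_below n) (1 - INR _ / INR p) in un *.
set B := (\rprod_(p <- primes_below n) (1 - / INR p)) ^ k in un *.
have [i0 i1] := prime_inv_bound n pn.
have b0 : 0 < B.
  apply: pow_lt; apply: (pprod_gt0 (fun p => 1 - / INR p)) => p pp.
  have [j0 j1] := prime_inv_bound p (proj1 (andP (etrans (esym (mem_filter _ _ _)) pp))).
  lra.
have c0 : 0 < (1 - / INR n) ^ k by apply: pow_lt; lra.
have be := bernoulli_neg (/ INR n) k ltac:(lra).
set t := (1 - / INR n) ^ k in c0 be *; set w := 1 - INR (omega Om n) / INR n.
have tw : w <= t by rewrite /w om_k //; lra.
have -> : A * w / (B * t) = A / B * (w / t) by field; lra.
rewrite -[X in _ <= X]Rmult_1_r; apply: Rmult_le_compat_l; first lra.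
by apply: (Rmult_le_reg_r t) => //; rewrite /Rdiv Rmult_assoc Rinv_l; lra.
Qed.

(** [real (Lim_seq _)] is meaningful only once a finite limit is known; the partial products are
    positive and eventually decreasing. The bound is then passed to the limit along [2 j + 11], the
    indices at which the corrections are estimated. *)
Lemma euler_prod_ge (G L : R) (j0 : nat) : 
  (forall j, (j0 <= j)%N -> L <= u (2 * j + 11) * G) -> L <= euler_prod Om k * G.
Proof.
move=> H; set n0 := (\max_(p <- P0) p).+1.
have ex : ex_finite_lim_seq (fun n => u (n + n0)%coq_nat).
  apply: (ex_finite_lim_seq_decr _ 0) => n; last by apply: Rlt_le; exact: euler_partial_gt0.
  by apply: euler_partial_decr; exact: leq_addl.
have [l] := ex; rewrite -is_lim_seq_incr_n => hl.
have -> : euler_prod Om k = l by rewrite /euler_prod -/u (is_lim_seq_unique _ _ hl).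
have sub : is_lim_seq (fun j => u (2 * (j + j0) + 11)%N * G) (l * G).
  apply: (is_lim_seq_scal_r _ G l).
  apply: (is_lim_seq_subseq u l (fun j => (2 * (j + j0) + 11)%N)) hl.
  apply: eventually_subseq => n; apply/ltP.
  by rewrite ltn_add2r ltn_pmul2l // ltn_add2r.
apply: (is_lim_seq_le (fun _ => L) _ L (l * G) _ (is_lim_seq_const L) sub) => j.
by apply: H; exact: leq_addl.
Qed.
End Limit.

(** * Proof of the bounds *)

Section Main.
Variables (Om : nat -> nat -> bool) (k : nat) (P0 : seq nat).
Hypothesis om_lt : forall p, prime p -> (omega Om p < p)%N.
Hypothesis om_k : forall p, prime p -> p \notin P0 -> omega Om p = k.
Variables (eps : nat -> R) (E : R).
Hypothesis eps_cond : forall p, prime p ->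
  0 <= eps p <= 1 /\ (1 - / INR p) ^ k * (1 - eps p) <= 1 - INR (omega Om p) / INR p.

Lemma euler_partial_lower (n X : nat) : (0 < X < n)%N ->
  mixes eps (primes_below n) (iter k (hsum X) ind1) (INR X) <= euler_partial Om k n * Gsum Om X.
Proof.
move=> /andP [X0 Xn]; rewrite euler_partial_ratio; apply: euler_ratio_lower => //.
- exact: primes_below_uniq.
- by move=> p; rewrite mem_filter => /andP [].
- by move=> p pp pX; rewrite primes_belowP pp (leq_ltn_trans pX).
- by move=> p; rewrite mem_filter => /andP [/eps_cond].
Qed.

Hypothesis E0 : 0 <= E.
Hypothesis eps_sum : forall j, \rsum_(p <- primes_below (2 * j + 11)) (eps p * ln (INR p)) <= E.

(** Jensen's inequality with an explicit supporting line. The result is uniform in [j], so it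
    survives the passage to the limit. *)
Lemma euler_partial_affine (j X : nat) (al be : R) : (0 < k)%N -> (0 < X < 2 * j + 11)%N -> 0 <= be ->
  (forall L, al + be * L <= Rmax L 0 ^ k / INR k`!) ->
  al + be * (ln (INR X) - E) <= euler_partial Om k (2 * j + 11) * Gsum Om X.
Proof.
move=> k0 hX be0 Hf; apply: Rle_trans (euler_partial_lower _ _ hX).
have [X0 _] := andP hX; have X1 := INR_gt0 X X0.
apply: (@Rle_trans _ (mixes eps (primes_below (2 * j + 11)) (fun y => al + be * ln y) (INR X))).
  rewrite mixes_affine //; last by move=> p; rewrite mem_filter => /andP [/prime_gt0].
  by apply: Rplus_le_compat_l; apply: Rmult_le_compat_l => //; apply: Rplus_le_compat_l; apply: Ropp_le_contravar; exact: eps_sum.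
apply: (mixes_le _ _ _ _ (INR X)) => [p|y hy|].
- by rewrite mem_filter => /andP [pp _]; split; [exact: prime_gt0 | exact: (proj1 (eps_cond p pp))].
- by apply: Rle_trans (iter_hsum_lnpow X k y hy); rewrite /lnpow; case: (k) k0 Hf.
- by split=> //; exact: Rle_refl.
Qed.

Lemma sift_le_main (A : nat -> bool) (N : nat) : (0 < k)%N -> (100 <= N)%N ->
  let y := ln (INR N) / 2 - 343 / 100 - E in 0 < y ->
  INR (sift N A Om (sqrt (2 / 3 * INR N))) * (y ^ k / INR k`!) <= euler_prod Om k * INR N /\
  0 < euler_prod Om k.
Proof.
case: k om_k eps_cond euler_partial_affine => // m om_m _ affine _ N100 y y0.
have N1 : 100 <= INR N by exact: (INR_ge_Z 100).
have d0 : (0 < N %/ 100)%N by rewrite divn_gt0.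
(* So [2^J] lies between [sqrt N / 20] and [sqrt N / 10]. *)
set J := trunc_log 4 (N %/ 100).
have J1 : 100 * 4 ^ J <= INR N.
  have := trunc_logP (isT : 1 < 4)%N d0; rewrite -/J leq_divRL // mulnC => /leP/le_INR.
  by rewrite mult_INR INR_expn !INR_IZR_INZ.
have J2 : INR N < 400 * 4 ^ J.
  have := trunc_log_ltn (N %/ 100) (isT : 1 < 4)%N; rewrite -/J ltn_divLR // => /ltP/lt_INR.
  by rewrite mult_INR INR_expn !INR_IZR_INZ /=; lra.
have p4 : 0 < 4 ^ J by apply: pow_lt; lra.
have [_ l2] := ln2_bounds; have l2' := proj1 ln2_bounds; have [_ l5 _ _] := ln_small.
set f := y ^ m.+1 / INR (m.+1)`!; set be := y ^ m / INR m`!; set al := f - be * y.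
have be0 : 0 < be by apply: Rdiv_lt_0_compat; [exact: pow_lt | exact: INR_fact].
have f0 : 0 < f by apply: Rdiv_lt_0_compat; [exact: pow_lt | exact: INR_fact].
have tan L : al + be * L <= Rmax L 0 ^ m.+1 / INR (m.+1)`!.
  by apply: Rle_trans (tangent_le m y L (Rlt_le _ _ y0)); rewrite /al -/f -/be; lra.
(* At [-E] the tangent line lies below the function, which is 0 there. *)
have al0 : al - be * E <= 0.
  have := tan (- E); rewrite Rmax_right; last lra.
  have -> : 0 ^ m.+1 = 0 by rewrite /= Rmult_0_l.
  rewrite /Rdiv Rmult_0_l; lra.
pose b i := INR N / (INR N + 20 * 4 ^ J * (2 / 3) ^ (J - i)).
set Gb := \rsum_(i < J.+1) (b i * Hsum Om i).
have key j : (2 ^ J < 2 * j + 11)%N -> f <= euler_partial Om m.+1 (2 * j + 11) * Gb.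
  move=> hj.
  have h := weighted_sum_lower (Hsum Om) J (INR N) (euler_partial Om m.+1 (2 * j + 11))
    (al - be * E) (be * ln 2) ltac:(lra) al0 ltac:(nra).
  apply: Rle_trans (h _); last first.
    move=> i iJ; rewrite -Gsum_Hsum.
    have iX : (0 < 2 ^ i < 2 * j + 11)%N.
      by rewrite expn_gt0 /= (leq_ltn_trans _ hj) // leq_exp2l.
    apply: Rle_trans (affine j (2 ^ i)%N al be isT iX (Rlt_le _ _ be0) tan).
    by rewrite INR_expn ln_pow_nat; [right; change (INR 2) with (1 + 1); have -> : 1 + 1 = 2 by [ring]; ring | rewrite /=; lra].
  have e1 : ln (INR N) <= 4 * ln 2 + 2 * ln 5 + 2 * INR J * ln 2.
    have l4 : ln 4 = 2 * ln 2 by have -> : 4 = 2 * 2 by [ring]; rewrite ln_mult; lra.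
    have l400 : ln 400 = 4 * ln 2 + 2 * ln 5.
      have -> : 400 = 4 * (4 * (5 * 5)) by ring.
      by rewrite (ln_mult 4) ?(ln_mult 4 (5 * 5)) ?(ln_mult 5 5); lra.
    have -> : 4 * ln 2 + 2 * ln 5 + 2 * INR J * ln 2 = ln (400 * 4 ^ J).
      by rewrite ln_mult ?ln_pow_nat ?l4 ?l400; lra.
    by apply: ln_le; lra.
  have e2 : 60 * 4 ^ J / INR N <= 6 / 10.
    by apply: (Rmult_le_reg_r (INR N)); [lra | rewrite /Rdiv Rmult_assoc Rinv_l; lra].
  (* The 343/100 covers half of [ln 400], at most 3.0095, plus the cost [6/10 * ln 2] of the
     weights. *)
  have e3 : y <= INR J * ln 2 - 60 * 4 ^ J / INR N * ln 2 - E.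
    have : 60 * 4 ^ J / INR N * ln 2 <= 6 / 10 * (6945 / 10000).
      apply: Rmult_le_compat; try lra.
      by apply: Rmult_le_pos; [lra | apply: Rlt_le; apply: Rinv_0_lt_compat; lra].
    rewrite /y; lra.
  have := Rmult_le_compat_l _ _ _ (Rlt_le _ _ be0) e3.
  rewrite /al; lra.
have bge0 i : 0 < b i.
  apply: Rdiv_lt_0_compat; first lra.
  have : 0 < (2 / 3) ^ (J - i) by apply: pow_lt; lra.
  by move=> h; have : 0 < 20 * 4 ^ J * (2 / 3) ^ (J - i) by [apply: Rmult_lt_0_compat; lra]; lra.
have Gb0 : 0 <= Gb.
  apply: rsum_ge0 => i _; apply: Rmult_le_pos; first exact: Rlt_le.
  exact: Hsum_ge0.
have lim := euler_prod_ge Om m.+1 P0 om_lt om_m Gb f (2 ^ J) _.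
have {}lim : f <= euler_prod Om m.+1 * Gb.
  apply: lim => j hj; apply: key; rewrite (leq_ltn_trans hj) //.
  by rewrite (leq_ltn_trans (leq_pmull j (isT : 0 < 2)%N)) // addnS ltnS leq_addr.
have Gb1 : 0 < Gb by case: Gb0 => // e; move: lim; rewrite -e; lra.
have C0 : 0 < euler_prod Om m.+1 by nra.
split=> //.
(* This uses only [4^J <= N / 100], far below [2 N / 3]. *)
have Jz : 2 ^ J <= sqrt (2 / 3 * INR N).
  have p2 : 0 < 2 ^ J by apply: pow_lt; lra.
  rewrite -(sqrt_square (2 ^ J)); last lra.
  apply: sqrt_le_1; [nra | lra |].
  have -> : 2 ^ J * 2 ^ J = 4 ^ J by rewrite -Rpow_mult_distr; congr (_ ^ _); ring.
  lra.
have N0 : (0 < N)%N by exact: leq_trans N100.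
have hS := sift_weighted Om om_lt A N _ J N0 Jz Gb1.
rewrite -/b -/Gb in hS.
set S := INR (sift _ _ _ _) in hS *.
have S0 : 0 <= S by exact: pos_INR.
apply: (@Rle_trans _ (S * (euler_prod Om m.+1 * Gb))); first exact: Rmult_le_compat_l.
have -> : S * (euler_prod Om m.+1 * Gb) = euler_prod Om m.+1 * (S * Gb) by ring.
by apply: Rmult_le_compat_l; lra.
Qed.
End Main.

(* The unary literal is unfolded digit by digit and never evaluated. *)
Lemma INR_437400 : INR 437400 = 437400.
Proof.
cbv delta [Nat.of_num_uint Nat.of_uint Nat.of_uint_acc] beta iota fix match.
rewrite !Nat.tail_mul_spec -!/(Nat.mul _ _) !(S_INR, mult_INR).
by rewrite /=; lra.
Qed.

(** In units of 10^(-6), a lower bound for the sum of [1 / (n1 n2 n3)] over [n1 n2 n3 <= 256]. *)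
Lemma tN_3_256 : tN 3 256 = 62369675%num.
Proof. by vm_compute. Qed.

(** The comparison cubic has a double root at 14 and the same two leading coefficients as [P]; the
    difference is affine and positive. *)
Lemma Ppoly_pos t : 7 <= t -> 0 < Ppoly t.
Proof.
move=> t7; rewrite /Ppoly.
have : 0 <= (t - 14) * (t - 14) * (t - 6549 / 1000).
  by apply: Rmult_le_pos; [exact: Rle_0_sqr | lra].
rewrite /=; lra.
Qed.

Lemma Ppoly_le t : 7 <= t <= 203 / 10 -> Ppoly t <= 1280.
Proof.
move=> [t7 t20]; rewrite /Ppoly.
have : 0 <= (203 / 10 - t) * (t * t - 14249 / 1000 * t + 90).
  by apply: Rmult_le_pos; [lra | have := Rle_0_sqr (t - 71 / 10); rewrite /Rsqr; lra].
rewrite /=; lra.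
Qed.

(** The shift 9.33 is twice [343/100 + 1235/1000]. The inequality already fails at [t = 20], which
    is why smaller [t] are treated apart. *)
Lemma Ppoly_lt_cube t : 203 / 10 <= t -> Ppoly t < (t - 933 / 100) ^ 3.
Proof.
move=> t20; rewrite /Ppoly.
have : 0 <= (t - 203 / 10) * (t - 203 / 10) by exact: Rle_0_sqr.
rewrite /=; lra.
Qed.

Section Kappa3.
Variables (Om : nat -> nat -> bool) (P0 : seq nat).
Hypothesis om_lt : forall p, prime p -> (omega Om p < p)%N.
Hypothesis om_3 : forall p, prime p -> p \notin P0 -> omega Om p = 3%N.
Hypothesis om_le : forall p, prime p -> (omega Om p <= 3)%N.

Lemma eps3_ok p : prime p ->
  0 <= eps3 p <= 1 /\ (1 - / INR p) ^ 3 * (1 - eps3 p) <= 1 - INR (omega Om p) / INR p.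
Proof. by move=> pp; split; [exact: eps3_bound | apply: eps3_cond => //; [exact: om_lt | exact: om_le]]. Qed.

(** The sieve with [Q = 256] fixed, where [131072 = 2 * 256^2]. *)
Lemma sift_le_3_small (A : nat -> bool) (N : nat) : 437400 <= INR N ->
  INR (sift N A Om (sqrt (2 / 3 * INR N))) * (355 / 10) <= euler_prod Om 3 * (INR N + 131072) /\
  0 < euler_prod Om 3.
Proof.
move=> N1; set X := 256%N; set G := Gsum Om X.
have X1 : INR X = 256 by rewrite INR_IZR_INZ.
have G0 : 0 <= G by apply: rsum_ge0 => q _; exact: hq_ge0.
have key j : (X <= j)%N -> 355 / 10 <= euler_partial Om 3 (2 * j + 11) * G.
  move=> Xj; have hX : (0 < X < 2 * j + 11)%N.
    by rewrite (leq_ltn_trans Xj) // (leq_ltn_trans (leq_pmull j (isT : 0 < 2)%N)) // addnS ltnS leq_addr.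
  apply: Rle_trans (euler_partial_lower Om 3 om_lt eps3 eps3_ok _ _ hX).
  have X0 : 0 < INR X by lra.
  have hp : {in primes_below (2 * j + 11), forall p, (0 < p)%N /\ 0 <= eps3 p <= 1}.
    by move=> p; rewrite mem_filter => /andP [/prime_gt0 p0 _]; split=> //; exact: eps3_bound.
  (* The loss is the factor 57/100, and [57/100 * 62.369675 > 35.5]. *)
  have [h _] := mixes_ge_head eps3 _ _ _ hp (proj1 (iter_hsum_good X 3)) X0.
  apply: Rle_trans h.
  have t := tN_le X 3 X isT; rewrite tN_3_256 in t.
  have e := eps3_prod j.
  set a := pprod _ _ in e *; set b := iter _ _ _ _ in t *.
  have {}t : 62369675 <= 1000000 * b by exact: t.
  nra.
have lim : 355 / 10 <= euler_prod Om 3 * G := euler_prod_ge Om 3 P0 om_lt om_3 G _ X key.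
have G1 : 0 < G by case: G0 => // e; move: lim; rewrite -e; lra.
have C0 : 0 < euler_prod Om 3 by nra.
split=> //.
have Xz : INR X <= sqrt (2 / 3 * INR N).
  rewrite X1 -(sqrt_square 256); last lra.
  by apply: sqrt_le_1; lra.
have hS := sift_plain Om om_lt A N _ X isT Xz G1.
rewrite -/G X1 in hS.
set S := INR (sift _ _ _ _) in hS *.
have S0 : 0 <= S by exact: pos_INR.
apply: (@Rle_trans _ (S * (euler_prod Om 3 * G))); first exact: Rmult_le_compat_l.
have -> : S * (euler_prod Om 3 * G) = euler_prod Om 3 * (S * G) by ring.
by apply: Rmult_le_compat_l; lra.
Qed.
End Kappa3.

Theorem theorem2 (N : nat) (A : nat -> bool) (Om : nat -> nat -> bool)
    (kappa : nat) (P0 : seq nat) :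
  (0 < N)%N ->
  (forall a, A a -> (1 <= a <= N)%N) ->
  (3 <= kappa)%N ->
  (forall p, p \in P0 -> prime p) ->
  (forall p, prime p -> p \in P0 -> (omega Om p < kappa)%N) ->
  (forall p, prime p -> p \notin P0 -> omega Om p = kappa) ->
  (forall p, prime p -> (omega Om p < p)%N) ->
  let z := sqrt (2 / 3 * INR N) in
  ((kappa = 3%N -> (437400 <= N)%N ->
     INR (sift N A Om z) <
       48 * euler_prod Om kappa * INR N / Ppoly (ln (INR N)))
   /\
   (exp (r_kappa kappa) < INR N ->
     INR (sift N A Om z) <
       2 ^ kappa * INR (kappa`!) * euler_prod Om kappa
       * INR N / ln (INR N) ^ kappa
       * / (1 - r_kappa kappa / ln (INR N)))).
Proof.
move=> N0 _ k3 _ om_P0 om_k om_lt z.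
have om_le p : prime p -> (omega Om p <= kappa)%N.
  by move=> pp; case: (boolP (p \in P0)) => [/(om_P0 p pp)/ltnW|/(om_k p pp) ->].
split=> [ek /leP/le_INR N1|Nbig].
  rewrite INR_437400 in N1.
  subst kappa; set t := ln (INR N).
  have t7 : 7 <= t.
    have e3 : exp 7 <= 3 ^ 7.
      have -> : exp 7 = exp 1 ^ 7 by rewrite /= Rmult_1_r -!exp_plus; congr exp; ring.
      by apply: pow_incr; split; [exact: Rlt_le (exp_pos _) | exact: exp_le_3].
    by rewrite -(ln_exp 7); apply: ln_le; [exact: exp_pos | lra].
  have Pt := Ppoly_pos t t7.
  have C0 := sift_le_main Om 3 P0 om_lt om_k eps3 (1235 / 1000) (eps3_ok Om om_lt om_le)
     ltac:(lra) eps3_sum A N isT.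
  set S := INR (sift _ _ _ _) in C0 *; set C := euler_prod _ _ in C0 *.
  apply: (Rmult_lt_reg_r (Ppoly t)) => //.
  have -> : 48 * C * INR N / Ppoly t * Ppoly t = 48 * (C * INR N) by field; lra.
  have S0 : 0 <= S by exact: pos_INR.
  have N100 : (100 <= N)%N by apply/leP; apply: INR_le; rewrite [INR 100]INR_IZR_INZ /=; lra.
  case: (Rle_lt_dec (203 / 10) t) => ht.
    have [h Cpos] := C0 N100 ltac:(rewrite -/t; lra).
    rewrite -/t in h.
    have e : (t / 2 - 343 / 100 - 1235 / 1000) ^ 3 / INR 3`! = (t - 933 / 100) ^ 3 / 48.
      by have -> : INR 3`! = 6 by [rewrite INR_IZR_INZ]; field.
    rewrite e in h.
    have CN : 0 < C * INR N by apply: Rmult_lt_0_compat; lra.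
    have c0 := Ppoly_lt_cube t ht.
    (* Strictness comes from the cubic when [S > 0], and from a positive right side when [S = 0]. *)
    case: S0 => [S1|<-]; last lra.
    have : S * Ppoly t < S * (t - 933 / 100) ^ 3 by exact: Rmult_lt_compat_l.
    lra.
  (* Numerically [1280 / 35.5 * (1 + 131072 / 437400) < 47], which is below the required 48. *)
  have [h Cpos] : S * (355 / 10) <= C * (INR N + 131072) /\ 0 < C :=
    sift_le_3_small Om P0 om_lt om_k om_le A N N1.
  have Pl : Ppoly t <= 1280 by apply: Ppoly_le; lra.
  have h2 : S * Ppoly t <= S * 1280 by apply: Rmult_le_compat_l.
  have h3 : C * 437400 <= C * INR N by apply: Rmult_le_compat_l; lra.
  lra.
set t := ln (INR N).
have k1 : 3 <= INR kappa by exact: (INR_ge_Z 3).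
have lk : 1 <= ln (INR kappa) by apply: Rle_trans ln3_ge1 _; apply: ln_le; lra.
set K := INR kappa in k1 lk.
have kl : 3 <= K * ln K by nra.
have er : r_kappa kappa = 5961 / 10 * 10 ^ 12 * (K * (K * ln K)) by rewrite /r_kappa -/K; ring.
set r := r_kappa kappa in er Nbig *.
(* Chosen so that the shifted variable [y] is [(t - a) / 2]. *)
pose a := 686 / 100 + 6 * (K * ln K).
have aK : K * a < r by rewrite er /a; nra.
have a0 : 0 < a by rewrite /a; lra.
have ar : a < r by nra.
have N1 : 0 < INR N by exact: INR_gt0.
have rt : r < t by rewrite -(ln_exp r); apply: ln_increasing => //; exact: exp_pos.
have r100 : 100 < r by rewrite er; nra.
have N100 : (100 <= N)%N.
  apply/leP; apply: INR_le; rewrite [INR 100]INR_IZR_INZ /=.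
  by have := exp_ineq1_le r; lra.
have eps_ok p : prime p -> 0 <= eps_gen kappa p <= 1 /\
    (1 - / INR p) ^ kappa * (1 - eps_gen kappa p) <= 1 - INR (omega Om p) / INR p.
  move=> pp; split; first exact: eps_gen_bound (prime_gt0 pp).
  by apply: eps_gen_cond => //; [exact: om_lt | exact: om_le].
have [h Cpos] := sift_le_main Om kappa P0 om_lt om_k (eps_gen kappa) (3 * K * ln K) eps_ok
   ltac:(lra) (fun j => eps_gen_sum kappa (2 * j + 11) k3) A N (leq_trans (isT : 0 < 3)%N k3) N100
   ltac:(rewrite -/t; move: aK ar; rewrite /a; lra).
rewrite -/t -/z in h.
set S := INR (sift _ _ _ _) in h *; set C := euler_prod _ _ in h Cpos *.
have S0 : 0 <= S by exact: pos_INR.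
have t0 : 0 < t by lra.
have tk : 0 < t ^ kappa by exact: pow_lt.
have f0 := INR_fact kappa.
have p2 : 0 < 2 ^ kappa by apply: pow_lt; lra.
have rt1 : 0 < 1 - r / t.
  have -> : 1 - r / t = (t - r) / t by field; lra.
  by apply: Rdiv_lt_0_compat; lra.
have ey : (t / 2 - 343 / 100 - 3 * K * ln K) ^ kappa = t ^ kappa * (1 - a / t) ^ kappa / 2 ^ kappa.
  rewrite -Rpow_mult_distr /Rdiv -pow_inv -Rpow_mult_distr; congr (_ ^ _).
  by rewrite /a; field; lra.
have at1 : a / t <= 1.
  by apply: (Rmult_le_reg_r t) => //; rewrite /Rdiv Rmult_assoc Rinv_l; lra.
have at0 : 0 <= a / t by apply: Rlt_le; exact: Rdiv_lt_0_compat.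
have be := bernoulli_neg (a / t) kappa (conj at0 at1); rewrite -/K in be.
(* Bernoulli turns the shift [a] into the relative loss [kappa a / t], and [kappa a < r]. *)
have rl : 1 - r / t < (1 - a / t) ^ kappa.
  apply: Rlt_le_trans be.
  suff : K * (a / t) < r / t by lra.
  have -> : K * (a / t) = K * a / t by field; lra.
  by apply: Rmult_lt_compat_r => //; exact: Rinv_0_lt_compat.
have CN : 0 < 2 ^ kappa * INR kappa`! * C * INR N.
  by apply: Rmult_lt_0_compat => //; apply: Rmult_lt_0_compat => //; apply: Rmult_lt_0_compat.
have -> : 2 ^ kappa * INR kappa`! * C * INR N / t ^ kappa * / (1 - r / t) =
  2 ^ kappa * INR kappa`! * C * INR N / (t ^ kappa * (1 - r / t)) by field; lra.
have tr : 0 < t ^ kappa * (1 - r / t) by exact: Rmult_lt_0_compat.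
apply: (Rmult_lt_reg_r (t ^ kappa * (1 - r / t))) => //.
have -> : 2 ^ kappa * INR kappa`! * C * INR N / (t ^ kappa * (1 - r / t)) * (t ^ kappa * (1 - r / t)) =
  2 ^ kappa * INR kappa`! * C * INR N.
  by set w := t ^ kappa * (1 - r / t) in tr *; field; lra.
case: S0 => [S1|<-]; last lra.
apply: (@Rlt_le_trans _ (S * (t ^ kappa * (1 - a / t) ^ kappa))).
  by apply: Rmult_lt_compat_l => //; exact: Rmult_lt_compat_l.
have {}h := Rmult_le_compat_l _ _ _ (Rlt_le _ _ (Rmult_lt_0_compat _ _ p2 f0)) h.
rewrite ey in h.
have e : 2 ^ kappa * INR kappa`! * (S * (t ^ kappa * (1 - a / t) ^ kappa / 2 ^ kappa / INR kappa`!)) =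
  S * (t ^ kappa * (1 - a / t) ^ kappa).
  by set v := (1 - a / t) ^ kappa; field; lra.
by rewrite e in h; lra.
Qed.
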